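(* Let $(g(t,X_t))_{t\ge0}$ be a continuous $L^1$-bounded martingale on $[0,\infty)$ with Widder's representation $g(t,X_t)=\int_{\mathbb{R}^d}\mathcal{E}(v\cdot X)_t\,\mu(dv)$ ($P$-a.s. for all $t\ge0$), where $\mu$ is a finite signed measure on $\mathbb{R}^d$. Then the following assertions hold: (i) If $|\mu|$ has quadratic exponential moments of all orders, i.e. $\int_{\mathbb{R}^d}e^{\lambda|v|^2}|\mu|(dv)<\infty$ for all $\lambda>0$, then there is a family $(b_\alpha)_{\alpha\in\mathbb{N}^d}$ of coefficients in $\mathbb{R}$ such that, for all $t\ge0$, the series $\sum_{\alpha\in\mathbb{N}^d}b_\alpha H_\alpha(t,X_t)$ converges absolutely to $g(t,X_t)$ in $L^1$, and therefore in $L^p$ for all $p>1$. The coefficients can be represented as $$b_\alpha=\frac1{\alpha!}\int_{\mathbb{R}^d}v^\alpha\,\mu(dv),\qquad\alpha\in\mathbb{N}^d.$$ (ii) Conversely, if $\mu$ is positive and there is a family $(b_\alpha)_{\alpha\in\mathbb{N}^d}$ of real coefficients such that the series $\sum_{\alpha\in\mathbb{N}^d}b_\alpha H_\alpha(t,X_t)$ converges, for some rearrangement of the terms, to $g(t,X_t)$ in $L^1$ for all $t\ge0$, then $\mu$ has quadratic exponential moments of all orders. Moreover, the function $f(z):=\int_{\mathbb{R}^d}e^{v\cdot z}\mu(dv)$, $z\in\mathbb{C}^d$, is well defined, analytic of order $2$, and can be represented, for $z\in\mathbb{C}^d$ and $t>0$, as $$f(z)=\sum_{\alpha\in\mathbb{N}^d}b_\alpha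 z^\alpha=E\left[g(t,X_t)\exp\left(\frac1t\left(z\cdot X_t-\frac{z^Tz}{2}\right)\right)\right].$$
   Context: $X$ is a $d$-dimensional Brownian motion (started at $0$) on a complete probability space $(\Omega,\mathcal{F},P)$ with its (augmented) Brownian filtration; $L^p=L^p(\Omega,\mathcal{F},P)$ with norm $\|\cdot\|_p$. $L^1$-bounded means that the $L^1$-norms are bounded uniformly in $t\ge0$. $\mathcal{E}(v\cdot X)_t=\exp\left(v\cdot X_t-\tfrac12|v|^2t\right)$; $|\mu|$ is the total variation measure of $\mu$. $\mathbb{N}$ includes $0$; for $\alpha\in\mathbb{N}^d$, $\alpha!=\prod_i\alpha_i!$ and $z^\alpha=\prod_iz_i^{\alpha_i}$. For $z\in\mathbb{C}^d$, $x\in\mathbb{R}^d$: $z\cdot x=x\cdot z=\sum_iz_ix_i$, $z^Tz=\sum_iz_i^2$. $H_\alpha(t,x)=\prod_{i=1}^dH_{\alpha_i}(t,x_i)$, where $\exp\left(\lambda x-\tfrac12\lambda^2t\right)=\sum_{n\ge0}\frac{\lambda^n}{n!}H_n(t,x)$. Absolute convergence of $\sum_\alpha V_\alpha$ in $L^p$ means $\sum_\alpha\|V_\alpha\|_p<\infty$. ''Analytic of order $2$'' means: $f$ is entire on $\mathbb{C}^d$ and there are constants $C,c>0$ with $|f(z)|\le Ce^{c|z|^2}$ for all $z\in\mathbb{C}^d$. *)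

(* Defs.v *)
From HB Require Import structures.
From mathcomp Require Import all_boot all_order all_algebra.
From mathcomp Require Import all_classical all_reals all_analysis.
From mathcomp Require Import complex ring.
Set Implicit Arguments.
Unset Strict Implicit.
Unset Printing Implicit Defensive.
Import Order.TTheory GRing.Theory Num.Theory.
Import numFieldNormedType.Exports.
Local Open Scope classical_set_scope.
Local Open Scope ring_scope.

(* H_n(t, x) is n! times the coefficient of l^n in the expansion of
   exp(l x - l^2 t / 2), i.e. the n-th derivative at l = 0; the expansion
   itself is [hermite_generating] below. *)
Definition hermite (R : realType) (n : nat) (t x : R) : R :=
  derive1n n (fun l : R => expR (l * x - l ^+ 2 * t / 2)) 0.

Section hermite_generating.
Variable R : realType.
Implicit Types (c : R^nat) (l K : R).

Definition entire_coef c :=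
  forall K, 0 < K -> exists M, forall n, `|c n| * K ^+ n <= M.

Lemma entire_coef_cvg c l : entire_coef c -> cvgn (pseries c l).
Proof.
move=> ec; pose K := 2 * `|l| + 1.
have K0 : 0 < K by rewrite ltr_wpDl// mulr_ge0.
have [M cM] := ec K K0.
have M0 : 0 <= M by apply: le_trans (cM 0%N); rewrite mulr_ge0// exprn_ge0// ltW.
apply: normed_cvg.
apply: (@series_le_cvg _ _ (geometric M 2^-1)) => [n|n|n|].
- exact: normr_ge0.
- by rewrite /geometric/= mulr_ge0// exprn_ge0.
- rewrite /geometric/= normrM normrX.
  apply: le_trans (_ : (`|c n| * K ^+ n) * 2^-1 ^+ n <= _); last first.
    by rewrite ler_wpM2r ?cM// exprn_ge0.
  rewrite -mulrA ler_wpM2l// -exprMn lerXn2r ?nnegrE ?mulr_ge0// ?ltW//.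
  by rewrite ltr_pdivlMr// mulrC ltrDl.
- by apply: is_cvg_geometric_series; rewrite ger0_norm// invf_lt1// ltr1n.
Qed.

Lemma entire_coef_diffs c : entire_coef c -> entire_coef (pseries_diffs c).
Proof.
move=> ec K K0; have [M cM] := ec (2 * K) (mulr_gt0 (ltr0Sn R 1) K0).
exists (M / K) => n; rewrite ler_pdivlMr// -mulrA -exprSr /pseries_diffs.
apply: le_trans (cM n.+1); rewrite normrM exprMn mulrA ler_wpM2r ?exprn_ge0 ?(ltW K0)//.
by rewrite [leLHS]mulrC ler_wpM2l// ger0_norm// -natrX ler_nat ltnW// ltn_expl.
Qed.

Lemma entire_coef_derive1 c l : entire_coef c ->
  is_derive l 1 (fun y => limn (pseries c y)) (limn (pseries (pseries_diffs c) l)).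
Proof.
move=> ec; apply: (@pseries_snd_diffs _ _ (`|l| + 1)); try apply: entire_coef_cvg.
- by [].
- exact: entire_coef_diffs.
- exact/entire_coef_diffs/entire_coef_diffs.
- by rewrite [ltRHS]ger0_norm ?addr_ge0// ltrDl.
Qed.

Lemma pseries0 c : limn (pseries c 0) = c 0%N.
Proof.
apply/cvg_lim => //; rewrite -cvg_shiftS.
apply: cvg_near_cst; apply: nearW => n.
rewrite /pseries seriesEnat/= big_nat_recl//= expr0 mulr1 big1 ?addr0// => i _.
by rewrite expr0n mulr0.
Qed.

Lemma derive1n_pseries c n : entire_coef c ->
  derive1n n (fun y => limn (pseries c y)) 0 = n`!%:R * c n.
Proof.
move=> ec.
have H : derive1n n (fun y => limn (pseries c y)) =
         (fun y => limn (pseries (iter n (@pseries_diffs R) c) y)) /\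
         entire_coef (iter n (@pseries_diffs R) c).
  elim: n => [//|n [IH1 IH2]]; split; last exact: entire_coef_diffs.
  rewrite derive1nS IH1; apply/funext => y; rewrite derive1E.
  exact: (@derive_val _ _ _ _ _ _ _ (entire_coef_derive1 y IH2)).
rewrite H.1 pseries0.
suff: forall m, iter n (@pseries_diffs R) c m = ((m + n) ^_ n)%:R * c (m + n)%N.
  by move=> ->; rewrite add0n ffactnn.
elim: n {H} => [|n IH] m; first by rewrite addn0 ffactn0 mul1r.
rewrite iterS {1}/pseries_diffs IH addSnnS mulrA -natrM; congr (_%:R * _).
by rewrite ffactnSr mulnC addnS subSn ?leq_addl// addnK.
Qed.

Section coefficients.
Variables t x : R.

Fixpoint hcoef2 (n : nat) : R * R :=
  if n is m.+1 then
    ((hcoef2 m).2, (x * (hcoef2 m).2 - t * (hcoef2 m).1) / m.+2%:R)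
  else (1, x).
Definition hcoef n := (hcoef2 n).1.

Lemma hcoefSS n : n.+2%:R * hcoef n.+2 = x * hcoef n.+1 - t * hcoef n.
Proof. by rewrite /hcoef /= mulrC divfK// pnatr_eq0. Qed.

Lemma entire_hcoef : entire_coef hcoef.
Proof.
move=> K K0; pose u n : R := `|hcoef n| * K ^+ n.
have u0 n : 0 <= u n by rewrite mulr_ge0// exprn_ge0// ltW.
pose B : R := `|x| * K + `|t| * K ^+ 2.
have uSS n : n.+2%:R * u n.+2 <= B * Num.max (u n) (u n.+1).
  rewrite /u mulrA -[n.+2%:R in leLHS]ger0_norm// -normrM hcoefSS.
  rewrite /B mulrDl.
  apply: (@le_trans _ _ (`|x| * K * u n.+1 + `|t| * K ^+ 2 * u n)).
    rewrite (@le_trans _ _ ((`|x| * `|hcoef n.+1| + `|t| * `|hcoef n|) * K ^+ n.+2))//.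
      rewrite ler_wpM2r ?exprn_ge0 ?(ltW K0)// (le_trans (ler_normB _ _))//.
      by rewrite !normrM.
    rewrite /u le_eqVlt; apply/orP; left; apply/eqP.
    by rewrite mulrDl !exprS expr0 !mulrA; congr (_ + _); ring.
  by rewrite lerD// ler_wpM2l ?mulr_ge0 ?exprn_ge0 ?(ltW K0)// le_max lexx ?orbT.
have B0 : 0 <= B by rewrite addr_ge0// mulr_ge0 ?exprn_ge0 ?(ltW K0).
have [N BN] : exists N : nat, B <= N%:R.
  by eexists; exact: ltW (archi_boundP B0).
pose M := \big[Num.max/0]_(i < N.+2) u i.
have MP n : u n <= M /\ u n.+1 <= M.
  have small k : (k < N.+2)%N -> u k <= M.
    by move=> kN; exact: (@le_bigmax _ _ _ _ (fun i : 'I_N.+2 => u i) (Ordinal kN)).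
  elim: n => [|n [IH1 IH2]]; first by split; apply: small.
  split => //; have [nN|Nn] := ltnP n.+2 N.+2; first exact: small.
  have n20 : 0 < n.+2%:R :> R by [].
  rewrite -(ler_pM2l n20) (le_trans (uSS n))//.
  apply: ler_pM => //.
  - by rewrite le_max u0.
  - by rewrite (le_trans BN)// ler_nat (leq_trans _ Nn)// leqW// leqW.
  - by rewrite ge_max IH1.
by exists M => n; have [] := MP n.
Qed.

Let F l := limn (pseries hcoef l).
Let G l := expR (l * x - l ^+ 2 * t / 2).

Let diffs_hcoef l :
  limn (pseries (pseries_diffs hcoef) l) = (x - l * t) * F l.
Proof.
have cF : pseries hcoef l @ \oo --> F l.
  exact/entire_coef_cvg/entire_hcoef.
apply/cvg_lim => //; rewrite -cvg_shiftS.
have -> : (fun n => pseries (pseries_diffs hcoef) l n.+1) =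
    (fun n => x * pseries hcoef l n.+1 - l * t * pseries hcoef l n).
  apply/funext => n; rewrite /pseries !seriesEnat/= big_nat_recl//.
  rewrite [in X in x * X]big_nat_recl// mulrDr -addrA.
  have -> : pseries_diffs hcoef 0 * l ^+ 0 = x * (hcoef 0 * l ^+ 0).
    by rewrite /pseries_diffs /hcoef/= !expr0 !mul1r !mulr1.
  congr (_ + _); rewrite !mulr_sumr -sumrB; apply: eq_bigr => i _.
  rewrite /pseries_diffs hcoefSS exprS; ring.
rewrite mulrBl; apply: cvgB; apply: cvgM => //; try exact: cvg_cst.
by rewrite (cvg_shiftS (pseries hcoef l)).
Qed.

Let FG : F = G.
Proof.
pose Q l := F l * expR (- (l * x - l ^+ 2 * t / 2)).
have dQ l : is_derive l 1 Q 0.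
  have dF : is_derive l 1 F ((x - l * t) * F l).
    by rewrite -diffs_hcoef; exact: (entire_coef_derive1 l entire_hcoef).
  have dE : is_derive l 1 (fun l => - (l * x - l ^+ 2 * t / 2)) (- (x - l * t)).
    by apply: is_derive_eq; rewrite /GRing.scale/=; field; rewrite ?pnatr_eq0.
  have dX : is_derive l 1 (fun l => expR (- (l * x - l ^+ 2 * t / 2)))
     (- (x - l * t) * expR (- (l * x - l ^+ 2 * t / 2))).
    rewrite [in X in is_derive _ _ _ X]mulrC.
    exact: (@is_derive1_comp _ expR _ l _ _ (is_derive_expR _) dE).
  by apply: is_derive_eq; rewrite /GRing.scale/=; ring.
have Qc l : Q l = 1.
  rewrite (is_derive_0_is_cst l 0 dQ) /Q /F pseries0 /hcoef/=.
  by rewrite mul0r expr0n/= !mul0r subrr oppr0 expR0 mulr1.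
apply/funext => l; rewrite -[LHS]mulr1.
rewrite -[X in _ * X](expRxMexpNx_1 (l * x - l ^+ 2 * t / 2)).
by rewrite mulrCA -/(Q l) Qc mulr1.
Qed.

Lemma hermiteE n : hermite n t x = n`!%:R * hcoef n.
Proof.
by rewrite /hermite -/G -[X in derive1n n X]FG (derive1n_pseries _ entire_hcoef).
Qed.

Lemma hermite_generating l :
  series (fun n => l ^+ n / n`!%:R * hermite n t x) @ \oo -->
  expR (l * x - l ^+ 2 * t / 2).
Proof.
have -> : series (fun n => l ^+ n / n`!%:R * hermite n t x) = pseries hcoef l.
  rewrite /pseries; congr series; apply/funext => n.
  by rewrite hermiteE mulrA divfK ?pnatr_eq0 -?lt0n ?fact_gt0// mulrC.
by rewrite -[expR _]/(G l) -FG; exact/entire_coef_cvg/entire_hcoef.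
Qed.

End coefficients.
End hermite_generating.

Section signed_measures.
Context d (T : measurableType d) (R : realType).
Variable mu : {charge set T -> \bar R}.

(* A Hahn decomposition is unique up to null sets, so the Jordan parts, and
   everything built on them below, do not depend on the one chosen here. *)
Definition hahn_pos : set T := sval (cid (Hahn_decomposition mu)).
Definition hahn_neg : set T :=
  sval (cid (svalP (cid (Hahn_decomposition mu)))).
Definition hahn_pos_neg : hahn_decomposition mu hahn_pos hahn_neg :=
  svalP (cid (svalP (cid (Hahn_decomposition mu)))).

Definition total_variation : {measure set T -> \bar R} :=
  charge_variation hahn_pos_neg.

Definition charge_integral (f : T -> R) : R :=
  \int[jordan_pos hahn_pos_neg]_x f x - \int[jordan_neg hahn_pos_neg]_x f x.

Definition charge_integrable (f : T -> R) : Prop :=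
  total_variation.-integrable setT (EFin \o f).

End signed_measures.

Section complex_integrals.
Context d (T : measurableType d) (R : realType).
Implicit Type f : T -> R[i].

Definition cintegrable (m : {measure set T -> \bar R}) f : Prop :=
  m.-integrable setT (EFin \o (@complex.Re R \o f)) /\
  m.-integrable setT (EFin \o (@complex.Im R \o f)).

Definition cintegral (m : {measure set T -> \bar R}) f : R[i] :=
  Complex (\int[m]_x complex.Re (f x)) (\int[m]_x complex.Im (f x)).

Definition charge_cintegrable (mu : {charge set T -> \bar R}) f : Prop :=
  cintegrable (total_variation mu) f.

Definition charge_cintegral (mu : {charge set T -> \bar R}) f : R[i] :=
  Complex (charge_integral mu (@complex.Re R \o f))
          (charge_integral mu (@complex.Im R \o f)).

End complex_integrals.

Section euclidean.
Variables (R : realType) (d : nat).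

Definition dotp (v x : d.-tuple R) : R := \sum_(i < d) tnth v i * tnth x i.

Definition cdotp (v : d.-tuple R) (z : 'rV[R[i]]_d) : R[i] :=
  \sum_(i < d) (tnth v i)%:C%C * z 0 i.

(* z^T z, without conjugation *)
Definition csqr (z : 'rV[R[i]]_d) : R[i] := \sum_(i < d) z 0 i ^+ 2.

(* |z|^2; the library norm on row vectors is the sup norm *)
Definition cnormsq (z : 'rV[R[i]]_d) : R :=
  \sum_(i < d) (complex.Re (z 0 i) ^+ 2 + complex.Im (z 0 i) ^+ 2).

Definition cexp (w : R[i]) : R[i] :=
  (expR (complex.Re w))%:C%C * Complex (cos (complex.Im w)) (sin (complex.Im w)).

Definition stoch_exp (v : d.-tuple R) (t : R) (x : d.-tuple R) : R :=
  expR (dotp v x - dotp v v * t / 2).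

Definition mfact (a : d.-tuple nat) : nat := \prod_(i < d) (tnth a i)`!.

Definition mpow (v : d.-tuple R) (a : d.-tuple nat) : R :=
  \prod_(i < d) tnth v i ^+ tnth a i.

Definition cmpow (z : 'rV[R[i]]_d) (a : d.-tuple nat) : R[i] :=
  \prod_(i < d) z 0 i ^+ tnth a i.

Definition mhermite (a : d.-tuple nat) (t : R) (x : d.-tuple R) : R :=
  \prod_(i < d) hermite (tnth a i) t (tnth x i).

Definition quad_exp_moments (mu : {charge set (d.-tuple R) -> \bar R}) : Prop :=
  forall lambda : R, 0 < lambda ->
    (\int[total_variation mu]_v (expR (lambda * dotp v v))%:E < +oo)%E.

(* entire: complex (Frechet) differentiable at every point of C^d *)
Definition analytic_order2 (f : 'rV[R[i]]_d -> R[i]) : Prop :=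
  (forall z, differentiable (f : 'rV[R[i]]_d -> R[i]^o) z) /\
  exists C c : R, [/\ 0 < C, 0 < c &
    forall z, `|f z| <= (C * expR (c * cnormsq z))%:C%C].

(* The sum of a family indexed by multi-indices does not depend on an
   enumeration exactly when it converges absolutely. *)
Definition abs_sums_to (u : d.-tuple nat -> R[i]) (s : R[i]) : Prop :=
  (\esum_(a in [set: d.-tuple nat]) (complex.Re `|u a|)%:E < +oo)%E /\
  forall e : nat -> d.-tuple nat, bijective e ->
    (fun n => \sum_(k < n) u (e k) : R[i]^o) @ \oo --> (s : R[i]^o).

End euclidean.

Section brownian.
Context (dO : measure_display) (Omega : measurableType dO) (R : realType).
Variables (P : probability Omega R) (d : nat).

Definition Lp_norm (p : R) (Y : Omega -> R) : \bar R :=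
  'N[P]_(p%:E)[EFin \o Y].

(* The partial sums of V, taken in the order given by e, tend to Y in L^p. *)
Definition Lp_series_cvg (p : R) (V : d.-tuple nat -> Omega -> R)
    (e : nat -> d.-tuple nat) (Y : Omega -> R) : Prop :=
  (fun n => Lp_norm p (fun w => \sum_(k < n) V (e k) w - Y w)) @ \oo --> 0%E.

Definition Lp_abs_cvg (p : R) (V : d.-tuple nat -> Omega -> R)
    (Y : Omega -> R) : Prop :=
  (\esum_(a in [set: d.-tuple nat]) Lp_norm p (V a) < +oo)%E /\
  forall e, bijective e -> Lp_series_cvg p V e Y.

Variable X : R -> Omega -> d.-tuple R.

Definition past (t : R) : set (set Omega) :=
  [set A | exists s B, [/\ 0 <= s <= t, measurable B & A = X s @^-1` B]].

Definition natural_filtration (t : R) : set (set Omega) := <<s past t >>.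

Definition augmented_filtration (t : R) : set (set Omega) :=
  <<s past t `|` [set N | P.-negligible N] >>.

Definition increment (s t : R) (w : Omega) : d.-tuple R :=
  [tuple tnth (X t w) i - tnth (X s w) i | i < d].

Record brownian_motion : Prop := BrownianMotion {
  bm_measurable : forall t, 0 <= t -> measurable_fun setT (X t) ;
  bm_start : {ae P, forall w, X 0 w = [tuple 0 | i < d]} ;
  bm_independent : forall s t A B, 0 <= s -> s <= t ->
    natural_filtration s A -> measurable B ->
    P (A `&` increment s t @^-1` B) = (P A * P (increment s t @^-1` B))%E ;
  bm_gaussian : forall s t (B : 'I_d -> set R), 0 <= s -> s < t ->
    (forall i, measurable (B i)) ->
    P [set w | forall i, B i (tnth (increment s t w) i)] =
    (\prod_(i < d) normal_prob 0 (Num.sqrt (t - s)) (B i))%E ;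
  bm_continuous : {ae P, forall w, forall i : 'I_d,
    {within [set t | 0 <= t], continuous (fun t => tnth (X t w) i)}} }.

(* A process on [0, +oo[ is given on all of R; its values at negative times
   play no role. *)
Record martingale (F : R -> set (set Omega)) (M : R -> Omega -> R) : Prop :=
  Martingale {
  mart_adapted : forall t (B : set R), 0 <= t -> measurable B ->
    F t (M t @^-1` B) ;
  mart_integrable : forall t, 0 <= t -> P.-integrable setT (EFin \o M t) ;
  mart_cond_expectation : forall s t A, 0 <= s -> s <= t -> F s A ->
    \int[P]_(w in A) M t w = \int[P]_(w in A) M s w }.

Definition continuous_paths (M : R -> Omega -> R) : Prop :=
  {ae P, forall w, {within [set t | 0 <= t], continuous (fun t => M t w)}}.

Definition L1_bounded (M : R -> Omega -> R) : Prop :=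
  exists C : R, forall t, 0 <= t -> (Lp_norm 1 (M t) <= C%:E)%E.

Definition widder_representation (g : R -> d.-tuple R -> R)
    (mu : {charge set (d.-tuple R) -> \bar R}) : Prop :=
  forall t, 0 <= t -> {ae P, forall w,
    g t (X t w) = charge_integral mu (fun v => stoch_exp v t (X t w))}.

End brownian.

(* Main.v *)
Require Import Defs.
From HB Require Import structures.
From mathcomp Require Import all_boot all_order all_algebra.
From mathcomp Require Import all_classical all_reals all_analysis.
From mathcomp Require Import complex measurable_realfun.
From mathcomp Require Import ring lra.
Import Order.TTheory GRing.Theory Num.Theory.
Import numFieldNormedType.Exports.
Set Implicit Arguments.
Unset Strict Implicit.
Unset Printing Implicit Defensive.
Local Open Scope classical_set_scope.
Local Open Scope ring_scope.


(** The theorem follows from one domination of the Hermite expansion. Give the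
    multi-index [a] the weight [mwt a], which is 2 to the power -|a|; the total
    weight is 2^d, and [gap F] is the weight outside the finite list [F]. A
    family whose terms are at most [C * mwt a] has sums over finite lists [F]
    that miss its total by at most [C * gap F], and the gap tends to 0 along any
    enumeration. This form of the Weierstrass test replaces the rearrangement
    arguments in both parts.

    Write h_a = H_a / a!. Cauchy's estimate for the generating function and
    Young's inequality give, for every e > 0,
      |v^a h_a(t, x)| <= mwt a * exp(e |x|^2) * exp((1/e + 2t) |v|^2)
    ([mhcoef_gauss]), hence the same bound, with the gap as a factor, for the
    error of a partial sum of the stochastic exponential
    ([stoch_exp_expansion]). In part (i) the quadratic exponential moments allow
    integration in v, which leaves a domination by exp(e |x|^2); it belongs to
    [L^p] once e is small compared with 1 / (p t)
    ([hermite_expansion_of_quadratic_moments]).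

    For part (ii), let theta_z = exp((z . X_t - z^T z / 2) / t). Under the law of
    [X_t] the stochastic exponential of v pairs with theta_z to exp(v . z), and
    h_a pairs with it to z^a / a! ([expectation_stoch_exp_tilt],
    [expectation_mhcoef_tilt]). Convergence in [L^1] bounds the terms in [L^1];
    pairing them with theta_z for z = i s, whose modulus is the constant
    exp(|s|^2 / (2t)), bounds |b_a s^a| ([coefficient_bound]). The time t is
    arbitrarily large, so optimizing in s makes b_a so small that the series is
    dominated by mwt a * exp(e |x|^2) for every e > 0
    ([hermite_series_dominated]), and the limit inherits the domination
    ([hermite_remainder]).

    Thus g(t, x) grows at most like exp(e |x|^2). Weighting Widder's
    representation with exp(|X_t|^2 / (8t)) keeps the expectation finite, while
    Tonelli's theorem turns it into a multiple of the integral of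
    exp(t |v|^2 / 6) against mu: since t is arbitrary, all quadratic exponential
    moments are finite ([quad_exp_moments_positive]). Fubini's theorem now gives
    f(z) = E[g(t, X_t) theta_z] ([transform_expectation]), termwise pairing of
    the dominated expansion gives the power series ([transform_power_series]),
    and differentiation under the integral sign gives analyticity
    ([laplace_transform_analytic]).

    The complex Gaussian identities need no contour integration. The complex
    generating function comes from the linear differential equation that it
    satisfies in a real scaling of its argument, and the pairings come from
    comparing coefficients of power series in a real variable
    ([power_series_unique]). *)

(** * Summation over multi-indices *)

Section multi_index_weights.
Variables (R : realType) (d : nat).
Implicit Types (a : d.-tuple nat) (F G : seq (d.-tuple nat)).

Definition mwt a : R := \prod_(i < d) 2^-1 ^+ tnth a i.

(** The weight that [F] leaves out: the weights of all multi-indices add up to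
    the [d]-th power of a geometric series of sum 2. *)
Definition gap F : R := 2 ^+ d - \sum_(a <- F) mwt a.

Definition box (N : nat) : seq (d.-tuple nat) :=
  [seq [tuple (f i : nat) | i < d] | f : {ffun 'I_d -> 'I_N}].

Lemma mwt_ge0 a : 0 <= mwt a.
Proof. by apply: prodr_ge0 => i _; rewrite exprn_ge0. Qed.

Lemma mem_box N a : (a \in box N) = [forall i, (tnth a i < N)%N].
Proof.
apply/mapP/forallP => [[f _ ->] i|aN]; first by rewrite tnth_mktuple.
exists [ffun i => Ordinal (aN i)]; first by rewrite mem_enum.
by apply: eq_from_tnth => i; rewrite tnth_mktuple ffunE.
Qed.

Lemma uniq_box N : uniq (box N).
Proof.
rewrite map_inj_uniq ?enum_uniq// => f g fg; apply/ffunP => i; apply: val_inj.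
by move/(congr1 (fun a => tnth a i)): fg; rewrite !tnth_mktuple.
Qed.

Lemma sum_box (V : comNzRingType) (u : 'I_d -> nat -> V) N :
  \sum_(a <- box N) \prod_(i < d) u i (tnth a i) =
  \prod_(i < d) \sum_(n < N) u i n.
Proof.
rewrite bigA_distr_bigA big_map big_enum /=; apply: eq_bigr => f _.
by apply: eq_bigr => i _; rewrite tnth_mktuple.
Qed.

Lemma sub_box F : exists N0, forall N, (N0 <= N)%N -> {subset F <= box N}.
Proof.
exists (\max_(a <- F) \max_(i < d) (tnth a i).+1) => N FN a aF.
rewrite mem_box; apply/forallP => i; apply: leq_trans FN.
apply: (@leq_trans (\max_(i < d) (tnth a i).+1)).
  exact: (leq_bigmax (F := fun i : 'I_d => (tnth a i).+1) i).
exact: (@leq_bigmax_seq _ F predT (fun a : d.-tuple nat => \max_(i < d) (tnth a i).+1) a aF isT).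
Qed.

Lemma big_sub_uniq (V : zmodType) (u : d.-tuple nat -> V) F G :
    uniq F -> uniq G -> {subset F <= G} ->
  \sum_(a <- G) u a - \sum_(a <- F) u a = \sum_(a <- G | a \notin F) u a.
Proof.
move=> uF uG FG; rewrite (bigID (mem F))/=.
suff -> : \sum_(a <- G | a \in F) u a = \sum_(a <- F) u a by rewrite addrAC subrr add0r.
rewrite -big_filter; apply: perm_big; apply: uniq_perm => //.
  exact: filter_uniq.
by move=> a; rewrite mem_filter; case: (boolP (a \in F)) => //= /FG.
Qed.

Lemma gapB F G : gap F - gap G = \sum_(a <- G) mwt a - \sum_(a <- F) mwt a.
Proof. by rewrite /gap; ring. Qed.

Lemma dist_sum_sub (V : normedZmodType R) (u : d.-tuple nat -> V) (C : R) F G :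
    (forall a, `|u a| <= C * mwt a) ->
    uniq F -> uniq G -> {subset F <= G} ->
  `|\sum_(a <- G) u a - \sum_(a <- F) u a| <= C * (gap F - gap G).
Proof.
move=> uC uF uG FG; rewrite big_sub_uniq// gapB.
rewrite big_sub_uniq// mulr_sumr (le_trans (ler_norm_sum _ _ _))//.
by apply: ler_sum => a _.
Qed.

Let half_lt1 : `|2^-1 : R| < 1.
Proof. by rewrite ger0_norm// invf_lt1// ltr1n. Qed.

Lemma sum_geometric2 n : \sum_(i < n) (2^-1 : R) ^+ i = 2 * (1 - 2^-1 ^+ n).
Proof.
have h := subrX1 (2^-1 : R) n.
have -> : \sum_(i < n) (2^-1 : R) ^+ i = -2 * ((2^-1 - 1) * \sum_(i < n) (2^-1 : R) ^+ i).
  by field.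
by rewrite -h; ring.
Qed.

Lemma sum_mwt_box N : \sum_(a <- box N) mwt a = (2 * (1 - 2^-1 ^+ N)) ^+ d.
Proof.
rewrite (sum_box (fun _ n => 2^-1 ^+ n)) (eq_bigr (fun=> 2 * (1 - 2^-1 ^+ N))).
  by rewrite prodr_const card_ord.
by move=> i _; rewrite sum_geometric2.
Qed.

Lemma gap_box_ge0 N : 0 <= gap (box N).
Proof.
rewrite /gap sum_mwt_box subr_ge0 lerXn2r ?nnegrE//.
  by rewrite mulr_ge0// subr_ge0 exprn_ile1// invf_le1// ler1n.
by rewrite ler_piMr// gerBl exprn_ge0.
Qed.

Lemma gap_le F G : uniq F -> uniq G -> {subset F <= G} -> gap G <= gap F.
Proof.
move=> uF uG FG; rewrite -subr_ge0 gapB big_sub_uniq//.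
by apply: sumr_ge0 => a _; exact: mwt_ge0.
Qed.

Lemma gap_ge0 F : uniq F -> 0 <= gap F.
Proof.
move=> uF; have [N FN] := sub_box F.
apply: le_trans (gap_box_ge0 N) _; apply: gap_le => //; first exact: uniq_box.
exact: FN.
Qed.

Lemma gap_nil : gap [::] = 2 ^+ d. Proof. by rewrite /gap big_nil subr0. Qed.

Lemma gap_box_cvg : gap (box N) @[N --> \oo] --> 0.
Proof.
have h : (fun n => 1 - 2^-1 ^+ n : R) @ \oo --> (1 : R).
  have := @cvgB _ R^o _ _ _ (cst (1 : R)) _ _ _ (cvg_cst _) (cvg_expr half_lt1).
  by rewrite subr0; apply.
have h2 := cvg_comp _ (fun x : R => x ^+ d) h (@exprn_continuous R d 1).
have h3 : 2 ^+ d - 2 ^+ d * (1 - 2^-1 ^+ n) ^+ d @[n --> \oo] -->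
    (2 ^+ d - 2 ^+ d * 1 ^+ d : R).
  apply: cvgB; first exact: cvg_cst.
  by apply: cvgM => //; exact: cvg_cst.
have -> : (fun N => gap (box N)) =
    (fun n => 2 ^+ d - 2 ^+ d * (1 - 2^-1 ^+ n) ^+ d).
  by apply/funext => n; rewrite /gap sum_mwt_box exprMn.
by move: h3; rewrite expr1n mulr1 subrr.
Qed.

(** A family dominated by the weights is summed by its box sums, and the error
    made by any finite partial sum is the weight that this sum leaves out. *)
Lemma dist_box_limit (u : d.-tuple nat -> R) (C s : R) F :
    (forall a, `|u a| <= C * mwt a) ->
    (\sum_(a <- box N) u a) @[N --> \oo] --> s -> uniq F ->
  `|s - \sum_(a <- F) u a| <= C * gap F.
Proof.
move=> uC us uF.
have C0 : 0 <= C.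
  have := uC [tuple 0%N | i < d]; rewrite /mwt big1 ?mulr1.
    exact: le_trans.
  by move=> i _; rewrite tnth_mktuple expr0.
have [N0 FN] := sub_box F.
have h : `|\sum_(a <- box N) u a - \sum_(a <- F) u a| @[N --> \oo] -->
         `|s - \sum_(a <- F) u a|.
  by apply: cvg_norm; apply: cvgB => //; exact: cvg_cst.
apply: (cvgr_to_le h); exists N0 => // N N0N.
apply: le_trans (dist_sum_sub uC uF (uniq_box N) (FN _ N0N)) _.
by rewrite ler_wpM2l// gerBl gap_box_ge0.
Qed.

Definition prefix_seq (e : nat -> d.-tuple nat) n := [seq e k | k <- iota 0 n].

Lemma sum_prefix (V : nmodType) (u : d.-tuple nat -> V) (e : nat -> d.-tuple nat) n :
  \sum_(k < n) u (e k) = \sum_(a <- prefix_seq e n) u a.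
Proof.
by rewrite big_map -(big_mkord xpredT (fun k => u (e k))) /index_iota subn0.
Qed.

Lemma uniq_prefix e n : injective e -> uniq (prefix_seq e n).
Proof. by move=> ie; rewrite map_inj_uniq// iota_uniq. Qed.

Lemma sub_prefix e F : bijective e ->
  exists N0, forall N, (N0 <= N)%N -> {subset F <= prefix_seq e N}.
Proof.
case=> e' ee' e'e; exists (\max_(a <- F) (e' a).+1) => N FN a aF.
apply/mapP; exists (e' a); last by rewrite e'e.
rewrite mem_iota add0n; apply: leq_trans FN.
exact: (@leq_bigmax_seq _ F predT (fun a => (e' a).+1) a aF isT).
Qed.

(** Every box is exhausted by a long enough prefix of the enumeration, and the
    gap decreases with inclusion. *)
Lemma gap_prefix_cvg e : bijective e -> gap (prefix_seq e n) @[n --> \oo] --> 0.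
Proof.
move=> be; apply/cvgr0Pnorm_lt => eps eps0.
have [N _ /(_ N (leqnn N)) gN] := (cvgr0Pnorm_lt _).1 gap_box_cvg _ eps0.
have [N0 FN] := sub_prefix (box N) be.
exists N0 => // n N0n; apply: le_lt_trans gN.
have ue := uniq_prefix n (bij_inj be).
rewrite !ger0_norm ?gap_box_ge0// ?gap_ge0//.
by apply: gap_le => //; [exact: uniq_box|exact: FN].
Qed.

(** The gap of a finite set of indices is nonnegative, so that finite sums of the
    weights are at most 2^d. *)
Lemma esum_mwt_lty (c : R) (u : d.-tuple nat -> \bar R) : 0 <= c ->
    (forall a, 0 <= u a <= (c * mwt a)%:E)%E ->
  (\esum_(a in [set: d.-tuple nat]) u a < +oo)%E.
Proof.
move=> c0 uc; apply: (@le_lt_trans _ _ (c * 2 ^+ d)%:E); last exact: ltry.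
apply: ge_ereal_sup => _ [A [fA _] <-].
rewrite fsbig_finite//=.
apply: (@le_trans _ _ (\sum_(a <- finmap.enum_fset (fset_set A)) (c * mwt a)%:E)%E).
  by apply: lee_sum => a _; case/andP: (uc a).
rewrite sumEFin lee_fin -mulr_sumr ler_wpM2l//.
by rewrite -subr_ge0; exact: (gap_ge0 (finmap.fset_uniq _)).
Qed.

End multi_index_weights.

(** * Hermite coefficients and their generating function *)

Section hermite_bounds.
Variable R : realType.
Implicit Types t x l v : R.

(** Replacing [t] by [- t] and [x] by its modulus makes all terms of the recursion
    nonnegative. *)
Lemma hcoef_le_abs t x n : 0 <= t -> `|hcoef t x n| <= hcoef (- t) `|x| n.
Proof.
move=> t0.
suff : `|hcoef t x n| <= hcoef (- t) `|x| n /\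
       `|hcoef t x n.+1| <= hcoef (- t) `|x| n.+1 by case.
elim: n => [|n [IH1 IH2]]; first by rewrite /hcoef/= normr1.
split => //; have n20 : 0 < n.+2%:R :> R by [].
rewrite -(ler_pM2l n20) -{1}[n.+2%:R]ger0_norm// -normrM !hcoefSS mulNr opprK.
rewrite (le_trans (ler_normB _ _))// !normrM (ger0_norm t0).
by rewrite lerD// ler_wpM2l.
Qed.

Lemma hermite_generating_hcoef t x l :
  series (fun n => l ^+ n * hcoef t x n) @ \oo --> expR (l * x - l ^+ 2 * t / 2).
Proof.
have -> : (fun n => l ^+ n * hcoef t x n) =
    (fun n => l ^+ n / n`!%:R * hermite n t x).
  by apply/funext => k; rewrite hermiteE mulrA divfK.
exact: hermite_generating.
Qed.

(** The majorant has nonnegative coefficients, so that a single term is at most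
    the whole generating function. *)
Lemma hcoef_bound t x l n : 0 <= t -> 0 <= l ->
  `|hcoef t x n| * l ^+ n <= expR (l * `|x| + l ^+ 2 * t / 2).
Proof.
move=> t0 l0; pose u k := l ^+ k * hcoef (- t) `|x| k.
have u0 k : 0 <= u k.
  by rewrite mulr_ge0 ?exprn_ge0// (le_trans _ (hcoef_le_abs _ _ t0)).
have us : series u @ \oo --> expR (l * `|x| + l ^+ 2 * t / 2).
  by have := @hermite_generating_hcoef (- t) `|x| l; rewrite mulrN !mulNr opprK.
apply: (@le_trans _ _ (series u n.+1)).
  rewrite /series/= big_nat_recr//= (@le_trans _ _ (u n))//.
    by rewrite mulrC ler_wpM2l ?exprn_ge0// hcoef_le_abs.
  by rewrite lerDr sumr_ge0.
rewrite -(cvg_lim _ us)//; apply: nondecreasing_cvgn_le; last exact: (cvgP _ us).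
apply/nondecreasing_seqP => k.
by rewrite /series/= big_nat_recr//= lerDl.
Qed.

(** Cauchy's estimate on the circle of radius twice that of the argument: it
    turns the generating function into a geometrically decaying expansion. *)
Lemma hcoef_geometric t x v n : 0 <= t ->
  `|v| ^+ n * `|hcoef t x n| <=
  2^-1 ^+ n * expR (2 * `|v| * `|x| + 2 * v ^+ 2 * t).
Proof.
move=> t0.
have h := @hcoef_bound t x (2 * `|v|) n t0 (mulr_ge0 (ler0n R 2) (normr_ge0 v)).
have -> : `|v| ^+ n * `|hcoef t x n| =
    2^-1 ^+ n * (`|hcoef t x n| * (2 * `|v|) ^+ n).
  have e : (2^-1 : R) ^+ n * 2 ^+ n = 1 by rewrite -exprMn mulVf ?expr1n.
  rewrite exprMn -[LHS]mul1r -[X in X * _ = _]e.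
  by move: (2^-1 ^+ n) (2 ^+ n) (`|v| ^+ n) => A B C; ring.
rewrite ler_wpM2l ?exprn_ge0//; apply: le_trans h _.
rewrite ler_expR lerD2l exprMn real_normK ?num_real//.
by rewrite le_eqVlt; apply/orP; left; apply/eqP; field.
Qed.

Lemma two_mul_le_sqr (e a b : R) : 0 < e -> 2 * a * b <= e * b ^+ 2 + a ^+ 2 / e.
Proof.
move=> e0; rewrite -subr_ge0.
have -> : e * b ^+ 2 + a ^+ 2 / e - 2 * a * b = (e * b - a) ^+ 2 / e.
  by field; rewrite gt_eqF.
by rewrite divr_ge0 ?sqr_ge0// ltW.
Qed.

(** Young's inequality separates the two variables of the Cauchy estimate. *)
Lemma hcoef_gauss t x v n e : 0 <= t -> 0 < e ->
  `|v ^+ n * hcoef t x n| <=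
  2^-1 ^+ n * (expR (e * x ^+ 2) * expR ((e^-1 + 2 * t) * v ^+ 2)).
Proof.
move=> t0 e0; rewrite normrM normrX (le_trans (hcoef_geometric _ _ _ t0))//.
rewrite ler_wpM2l ?exprn_ge0// -expRD ler_expR.
have := two_mul_le_sqr `|v| `|x| e0.
rewrite !real_normK ?num_real// => h.
apply: le_trans (_ : (e * x ^+ 2 + v ^+ 2 / e) + 2 * v ^+ 2 * t <= _).
  by rewrite lerD2r.
by rewrite le_eqVlt; apply/orP; left; apply/eqP; field; rewrite gt_eqF.
Qed.

Lemma measurable_hcoef t n : measurable_fun setT (fun x : R => hcoef t x n).
Proof.
suff : measurable_fun setT (fun x : R => (hcoef2 t x n).1) /\
       measurable_fun setT (fun x : R => (hcoef2 t x n).2) by case.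
elim: n => [|n [IH1 IH2]] /=; first by split; [exact: measurable_cst|exact: measurable_id].
split => //; apply: measurable_funM => //; apply: measurable_funB.
  by apply: measurable_funM.
by apply: measurable_funM => //; exact: measurable_cst.
Qed.

End hermite_bounds.

Section complex_generating_function.
Variable R : realType.
Local Notation Re := (@complex.Re R).
Local Notation Im := (@complex.Im R).
Implicit Types (t x l p q : R) (w z : R[i]).

Lemma cReM w z : Re (w * z) = Re w * Re z - Im w * Im z.
Proof. by case: w z => [a b] [c e]. Qed.

Lemma cImM w z : Im (w * z) = Re w * Im z + Im w * Re z.
Proof. by case: w z => [a b] [c e]. Qed.

Lemma cReX_bound w n :
  `|Re (w ^+ n)| + `|Im (w ^+ n)| <= (`|Re w| + `|Im w|) ^+ n.
Proof.
elim: n => [|n IH]; first by rewrite !expr0/= normr1 normr0 addr0.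
rewrite !exprS cReM cImM.
apply: le_trans (_ : (`|Re w| + `|Im w|) * (`|Re (w ^+ n)| + `|Im (w ^+ n)|) <= _).
  apply: le_trans (lerD (ler_normB _ _) (ler_normD _ _)) _.
  by rewrite !normrM le_eqVlt; apply/orP; left; apply/eqP; ring.
by rewrite ler_wpM2l// addr_ge0.
Qed.

(** The two components under one name, so that an argument that applies to both
    is carried out once. *)
Definition cpart (c : bool) w : R := if c then Re w else Im w.

Lemma cpartZ c (r : R) w : cpart c (r%:C%C * w) = r * cpart c w.
Proof. by case: c; rewrite /cpart ?cReM ?cImM/= mul0r ?subr0 ?addr0. Qed.

Lemma cpartB c w z : cpart c (w - z) = cpart c w - cpart c z.
Proof. by case: c w z => [] [a b] [p q]. Qed.

(** The generating function at the complex argument [l w], as a function of the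
    real variable [l]: [U] and [V] are the real and imaginary parts of the sum of
    the series, [a] and [b] those of the expected exponent. *)
Section fixed_argument.
Variables (t x : R) (w : R[i]).
Let cU n := Re (w ^+ n) * hcoef t x n.
Let cV n := Im (w ^+ n) * hcoef t x n.
Let M := `|Re w| + `|Im w|.

Let entire_bound (c : R^nat) :
  (forall n, `|c n| <= M ^+ n * `|hcoef t x n|) -> entire_coef c.
Proof.
move=> cM K K0; have [B hB] := @entire_hcoef R t x ((M + 1) * K)
  (mulr_gt0 (ltr_wpDl (addr_ge0 (normr_ge0 _) (normr_ge0 _)) ltr01) K0).
exists B => n; apply: le_trans (hB n).
rewrite exprMn mulrA ler_wpM2r ?exprn_ge0 ?(ltW K0)//.
rewrite (le_trans (cM n))// mulrC ler_wpM2l// lerXn2r ?nnegrE ?addr_ge0//.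
by rewrite lerDl.
Qed.

Let entire_cU : entire_coef cU.
Proof.
apply: entire_bound => n; rewrite normrM ler_wpM2r//.
by apply: le_trans (cReX_bound _ _); rewrite lerDl.
Qed.

Let entire_cV : entire_coef cV.
Proof.
apply: entire_bound => n; rewrite normrM ler_wpM2r//.
by apply: le_trans (cReX_bound _ _); rewrite lerDr.
Qed.

Let U l := limn (pseries cU l).
Let V l := limn (pseries cV l).
Let w2 := w ^+ 2.

(* The recursion of the coefficients, multiplied by powers of [l] and summed. *)
Let diffsE (f g h : R^nat) (a b c e l : R) :
    entire_coef f -> entire_coef g ->
    pseries_diffs h 0%N = x * (a * f 0%N + b * g 0%N) ->
    (forall n, pseries_diffs h n.+1 = x * (a * f n.+1 + b * g n.+1)
                                 - t * (c * f n + e * g n)) ->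
  limn (pseries (pseries_diffs h) l) =
  x * (a * limn (pseries f l) + b * limn (pseries g l))
  - t * l * (c * limn (pseries f l) + e * limn (pseries g l)).
Proof.
move=> ef eg h0 hS.
have cf : pseries f l @ \oo --> limn (pseries f l) by exact: entire_coef_cvg.
have cg : pseries g l @ \oo --> limn (pseries g l) by exact: entire_coef_cvg.
apply/cvg_lim => //; rewrite -cvg_shiftS.
have -> : (fun n => pseries (pseries_diffs h) l n.+1) =
    (fun n => x * (a * pseries f l n.+1 + b * pseries g l n.+1)
              - t * l * (c * pseries f l n + e * pseries g l n)).
  apply/funext => n; rewrite /pseries !seriesEnat/= big_nat_recl//.
  rewrite [in X in a * X]big_nat_recl// [in X in b * X]big_nat_recl//.
  under eq_bigr => i _ do rewrite hS.
  rewrite h0 !expr0 !mulr1.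
  set SF := \sum_(0 <= i < n) f i.+1 * l ^+ i.+1.
  set SG := \sum_(0 <= i < n) g i.+1 * l ^+ i.+1.
  set Sf := \sum_(0 <= i < n) f i * l ^+ i.
  set Sg := \sum_(0 <= i < n) g i * l ^+ i.
  suff -> : \sum_(0 <= i < n) (x * (a * f i.+1 + b * g i.+1) -
      t * (c * f i + e * g i)) * l ^+ i.+1 =
      x * (a * SF + b * SG) - t * l * (c * Sf + e * Sg) by ring.
  rewrite /SF /SG /Sf /Sg !mulr_sumr -[X in x * X]big_split/=.
  rewrite -[X in t * l * X]big_split/= !mulr_sumr -sumrB.
  by apply: eq_bigr => i _; rewrite exprS; ring.
apply: cvgB; apply: cvgM => //; try exact: cvg_cst;
  by apply: cvgD; apply: cvgM => //; try exact: cvg_cst; rewrite ?(cvg_shiftS (pseries _ l)).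
Qed.

Let hSS n : n.+2%:R * hcoef t x n.+2 = x * hcoef t x n.+1 - t * hcoef t x n.
Proof. exact: hcoefSS. Qed.

Let diffsU l : limn (pseries (pseries_diffs cU) l) =
  x * (Re w * U l + - Im w * V l) - t * l * (Re w2 * U l + - Im w2 * V l).
Proof.
apply: diffsE => //.
  by rewrite /pseries_diffs /cU /cV expr1 expr0 /hcoef/=; ring.
move=> n; rewrite /pseries_diffs /cU /cV mulrCA hSS mulrBr; congr (_ - _).
  by rewrite exprS cReM; ring.
by rewrite -addn2 exprD [_ ^+ n * _]mulrC cReM; ring.
Qed.

Let diffsV l : limn (pseries (pseries_diffs cV) l) =
  x * (Im w * U l + Re w * V l) - t * l * (Im w2 * U l + Re w2 * V l).
Proof.
apply: diffsE => //.
  by rewrite /pseries_diffs /cU /cV expr1 expr0 /hcoef/=; ring.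
move=> n; rewrite /pseries_diffs /cU /cV mulrCA hSS mulrBr; congr (_ - _).
  by rewrite exprS cImM; ring.
by rewrite -addn2 exprD [_ ^+ n * _]mulrC cImM; ring.
Qed.

Let a l := l * (x * Re w) - l ^+ 2 * (t * Re w2) / 2.
Let b l := l * (x * Im w) - l ^+ 2 * (t * Im w2) / 2.

Let dquad (c e l : R) :
  is_derive l 1 (fun l : R => l * c - l ^+ 2 * e / 2) (c - l * e).
Proof. by apply: is_derive_eq; rewrite /GRing.scale/=; field. Qed.

Let dU l : is_derive l 1 U
  ((x * Re w - l * (t * Re w2)) * U l - (x * Im w - l * (t * Im w2)) * V l).
Proof.
rewrite [X in is_derive _ _ _ X](_ : _ = limn (pseries (pseries_diffs cU) l)).
  exact: entire_coef_derive1.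
by rewrite diffsU; ring.
Qed.

Let dV l : is_derive l 1 V
  ((x * Re w - l * (t * Re w2)) * V l + (x * Im w - l * (t * Im w2)) * U l).
Proof.
rewrite [X in is_derive _ _ _ X](_ : _ = limn (pseries (pseries_diffs cV) l)).
  exact: entire_coef_derive1.
by rewrite diffsV; ring.
Qed.

Let dE l : is_derive l 1 (fun l => expR (- a l))
  (- (x * Re w - l * (t * Re w2)) * expR (- a l)).
Proof.
have da : is_derive l 1 (fun l => - a l) (- (x * Re w - l * (t * Re w2))).
  have := dquad (x * Re w) (t * Re w2) l => ?.
  exact: is_deriveN.
rewrite [in X in is_derive _ _ _ X]mulrC.
exact: (@is_derive1_comp _ expR _ l _ _ (is_derive_expR _) da).
Qed.

Let dcos l : is_derive l 1 (fun l => cos (b l))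
  (- (x * Im w - l * (t * Im w2)) * sin (b l)).
Proof.
have db := dquad (x * Im w) (t * Im w2) l.
rewrite mulNr -mulrN [in X in is_derive _ _ _ X]mulrC.
exact: (@is_derive1_comp _ (@cos R) _ l _ _ (is_derive_cos _) db).
Qed.

Let dsin l : is_derive l 1 (fun l => sin (b l))
  ((x * Im w - l * (t * Im w2)) * cos (b l)).
Proof.
have db := dquad (x * Im w) (t * Im w2) l.
rewrite [in X in is_derive _ _ _ X]mulrC.
exact: (@is_derive1_comp _ (@sin R) _ l _ _ (is_derive_sin _) db).
Qed.

Let U0 : U 0 = 1.
Proof. by rewrite /U pseries0 /cU expr0 mul1r. Qed.

Let V0 : V 0 = 0.
Proof. by rewrite /V pseries0 /cV expr0 mul0r. Qed.

Let a0 : a 0 = 0. Proof. by rewrite /a expr0n/= !mul0r subrr. Qed.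
Let b0 : b 0 = 0. Proof. by rewrite /b expr0n/= !mul0r subrr. Qed.

(* [U + i V] and the exponential solve the same linear equation, so that their
   quotient, whose parts are [Q1] and [Q2], is constant. *)
Let Q1 l : expR (- a l) * (U l * cos (b l) + V l * sin (b l)) = 1.
Proof.
have dQ (k : R) : is_derive k 1
    (fun l => expR (- a l) * (U l * cos (b l) + V l * sin (b l))) 0.
  have ? := dU k; have ? := dV k; have ? := dE k.
  have ? := dcos k; have ? := dsin k.
  by apply: is_derive_eq; rewrite /GRing.scale/=; ring.
rewrite (is_derive_0_is_cst l 0 dQ) a0 b0 U0 V0 oppr0 expR0 cos0 sin0.
by rewrite !(mulr1, mulr0, addr0).
Qed.

Let Q2 l : expR (- a l) * (V l * cos (b l) - U l * sin (b l)) = 0.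
Proof.
have dQ (k : R) : is_derive k 1
    (fun l => expR (- a l) * (V l * cos (b l) - U l * sin (b l))) 0.
  have ? := dU k; have ? := dV k; have ? := dE k.
  have ? := dcos k; have ? := dsin k.
  by apply: is_derive_eq; rewrite /GRing.scale/=; ring.
rewrite (is_derive_0_is_cst l 0 dQ) a0 b0 U0 V0 oppr0 expR0 cos0 sin0.
by rewrite !(mulr1, mulr0, subr0).
Qed.

Let UE l : U l = expR (a l) * cos (b l).
Proof.
have e1 := expRxMexpNx_1 (a l); have cs := cos2Dsin2 (b l).
have h : U l * (cos (b l) ^+ 2 + sin (b l) ^+ 2) * (expR (a l) * expR (- a l)) =
  expR (a l) * (cos (b l) * (expR (- a l) * (U l * cos (b l) + V l * sin (b l)))
  - sin (b l) * (expR (- a l) * (V l * cos (b l) - U l * sin (b l)))) by ring.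
by move: h; rewrite e1 cs Q1 Q2 !mulr1 mulr0 subr0.
Qed.

Let VE l : V l = expR (a l) * sin (b l).
Proof.
have e1 := expRxMexpNx_1 (a l); have cs := cos2Dsin2 (b l).
have h : V l * (cos (b l) ^+ 2 + sin (b l) ^+ 2) * (expR (a l) * expR (- a l)) =
  expR (a l) * (sin (b l) * (expR (- a l) * (U l * cos (b l) + V l * sin (b l)))
  + cos (b l) * (expR (- a l) * (V l * cos (b l) - U l * sin (b l)))) by ring.
by move: h; rewrite e1 cs Q1 Q2 !mulr1 mulr0 addr0.
Qed.

Let hermite_generating_Re :
  series (fun n => Re (w ^+ n) * hcoef t x n) @ \oo -->
  Re (cexp (w * x%:C%C - w ^+ 2 * (t / 2)%:C%C)).
Proof.
have -> : Re (cexp (w * x%:C%C - w ^+ 2 * (t / 2)%:C%C)) = U 1.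
  rewrite UE /cexp cReM /= mul0r subr0 raddfB /= (raddfB (@complex.Im R)) /=.
  rewrite expr2 !cReM !cImM /= /a /b /w2 expr2 cReM cImM !(mulr0, mul0r, subr0, addr0, add0r).
  by congr (expR _ * cos _); field.
have := entire_coef_cvg (l := 1) entire_cU; rewrite -/(U 1) => h.
have -> : series (fun n => Re (w ^+ n) * hcoef t x n) = pseries cU 1.
  apply/funext => n; rewrite /pseries /series/=.
  by apply: eq_bigr => i _; rewrite expr1n mulr1.
exact: h.
Qed.

Let hermite_generating_Im :
  series (fun n => Im (w ^+ n) * hcoef t x n) @ \oo -->
  Im (cexp (w * x%:C%C - w ^+ 2 * (t / 2)%:C%C)).
Proof.
have -> : Im (cexp (w * x%:C%C - w ^+ 2 * (t / 2)%:C%C)) = V 1.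
  rewrite VE /cexp cImM /= mul0r addr0 raddfB /= (raddfB (@complex.Im R)) /=.
  rewrite expr2 !cReM !cImM /= /a /b /w2 expr2 cReM cImM !(mulr0, mul0r, subr0, addr0, add0r).
  by congr (expR _ * sin _); field.
have := entire_coef_cvg (l := 1) entire_cV; rewrite -/(V 1) => h.
have -> : series (fun n => Im (w ^+ n) * hcoef t x n) = pseries cV 1.
  apply/funext => n; rewrite /pseries /series/=.
  by apply: eq_bigr => i _; rewrite expr1n mulr1.
exact: h.
Qed.

Lemma hermite_generating_cpart c :
  series (fun n => cpart c (w ^+ n) * hcoef t x n) @ \oo -->
  cpart c (cexp (w * x%:C%C - w ^+ 2 * (t / 2)%:C%C)).
Proof.
by case: c; [exact: hermite_generating_Re|exact: hermite_generating_Im].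
Qed.

End fixed_argument.
End complex_generating_function.

(** * Expectations of products of independent factors *)

Section integral_against_density.
Local Open Scope ereal_scope.
Context d1 d2 (T : measurableType d1) (T' : measurableType d2) (R : realType).
Variables (m : {measure set T -> \bar R}) (nu : {measure set T' -> \bar R}).
Variables (W : T -> R) (Y : T -> T') (c : \bar R).
Hypotheses (W0 : forall x, (0 <= W x)%R) (mW : measurable_fun setT W).
Hypotheses (mY : measurable_fun setT Y) (cfin : c \is a fin_num).
Hypothesis densityE : forall B, measurable B ->
  \int[m]_x (W x * \1_B (Y x))%:E = c * nu B.

Import HBNNSimple.

Let densityE_nnsfun (h : {nnsfun T' >-> R}) :
  \int[m]_x (W x * h (Y x))%:E = c * \int[nu]_y (h y)%:E.
Proof.
have mh r : measurable (h @^-1` [set r]) by exact: measurable_sfunP.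
have m1 r : measurable_fun setT (fun x => (W x * \1_(h @^-1` [set r]) (Y x))%:E).
  apply/measurable_EFinP; apply: measurable_funM => //.
  by apply: measurableT_comp => //; exact: measurable_indic.
transitivity (\int[m]_x \sum_(r \in range h)
    (r%:E * (W x * \1_(h @^-1` [set r]) (Y x))%:E)).
  apply: eq_integral => x _; rewrite fimfunE EFinM -fsumEFin// ge0_mule_fsumr.
    by apply: eq_fsbigr => r _; rewrite !EFinM muleCA.
  by move=> r; rewrite EFinM nnfun_muleindic_ge0.
rewrite ge0_integral_fsum//; last 2 first.
- by move=> r; exact: measurable_funeM.
- move=> r x _; rewrite EFinM muleCA mule_ge0 ?lee_fin//.
  exact: nnfun_muleindic_ge0.
rewrite integralT_nnsfun sintegralE ge0_mule_fsumr; last first.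
  by move=> r; exact: nnsfun_mulemu_ge0.
apply: eq_fsbigr => r /[!inE] -[y _ <-].
rewrite ge0_integralZl//; first by rewrite densityE// muleCA.
- by move=> x _; rewrite lee_fin mulr_ge0.
- by rewrite lee_fin.
Qed.

(** Once a measure weighted by [W] and transported by [Y] agrees with a multiple
    of [nu] on sets, it does so on nonnegative functions, by monotone
    approximation. *)
Lemma ge0_integral_density (f : T' -> \bar R) :
    measurable_fun setT f -> (forall y, 0 <= f y) ->
  \int[m]_x ((W x)%:E * f (Y x)) = c * \int[nu]_y f y.
Proof.
move=> mf f0; pose f_ := nnsfun_approx measurableT mf.
have cf y : (f_ n y)%:E @[n --> \oo] --> f y.
  by apply: cvg_nnsfun_approx => // *.
have mf_ n : measurable_fun setT (fun x => (W x * f_ n (Y x))%:E).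
  apply/measurable_EFinP; apply: measurable_funM => //.
  exact: measurableT_comp.
have nd y : {homo (fun n => f_ n y) : a b / (a <= b)%N >-> (a <= b)%R}.
  by move=> a b ab; exact/lefP/nd_nnsfun_approx.
have -> : \int[m]_x ((W x)%:E * f (Y x)) =
    limn (fun n => \int[m]_x (W x * f_ n (Y x))%:E).
  rewrite -monotone_convergence//.
  - apply: eq_integral => x _; apply/esym/cvg_lim => //.
    by under eq_fun do rewrite EFinM; exact: cvgeZl.
  - by move=> n x _; rewrite lee_fin mulr_ge0.
  - by move=> x _ a b ab; rewrite lee_fin ler_wpM2l// nd.
have -> : \int[nu]_y f y = limn (fun n => \int[nu]_y (f_ n y)%:E).
  rewrite -monotone_convergence//.
  - by apply: eq_integral => x _; apply/esym/cvg_lim => //.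
  - by move=> n; exact/measurable_EFinP.
  - by move=> n x _; rewrite lee_fin.
  - by move=> x _ a b ab; rewrite lee_fin nd.
rewrite -limeMl//.
  by congr (limn _); apply/funext => n; rewrite densityE_nnsfun.
apply/ereal_nondecreasing_is_cvgn => a b ab; apply: ge0_le_integral => //.
- by move=> x _; rewrite lee_fin.
- exact/measurable_EFinP/measurable_funTS.
- exact/measurable_EFinP/measurable_funTS.
- by move=> x _; rewrite lee_fin; exact: nd.
Qed.

End integral_against_density.

Section expectation_of_products.
Local Open Scope ereal_scope.
Context d1 d2 (T : measurableType d1) (T' : measurableType d2) (R : realType).
Variables (m : {measure set T -> \bar R}) (nu : {measure set T' -> \bar R}).
Variables (n : nat) (Y : 'I_n -> T -> T').
Hypothesis nuT : nu setT < +oo.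
Hypothesis mY : forall i, measurable_fun setT (Y i).
Hypothesis rectangles : forall B : 'I_n -> set T', (forall i, measurable (B i)) ->
  m [set x | forall i, B i (Y i x)] = \prod_(i < n) nu (B i).

(** For indicators this is the rule on rectangles. A general factor replaces an
    indicator by [ge0_integral_density], the other factors being the weight. *)
Lemma ge0_integral_prod (f : 'I_n -> T' -> R) :
    (forall i, measurable_fun setT (f i)) -> (forall i y, (0 <= f i y)%R) ->
    (forall i, \int[nu]_y (f i y)%:E < +oo) ->
  \int[m]_x (\prod_(i < n) f i (Y i x))%:E =
  \prod_(i < n) \int[nu]_y (f i y)%:E.
Proof.
(* Induction on a list [s] of the indices whose factors need not be indicators;
   the factor of one index is freed by comparing two measures on its range. *)
suff gen (s : seq 'I_n) : forall f : 'I_n -> T' -> R,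
    (forall i, measurable_fun setT (f i)) -> (forall i y, (0 <= f i y)%R) ->
    (forall i, \int[nu]_y (f i y)%:E < +oo) ->
    (forall i, i \notin s -> exists2 B, measurable B & f i = \1_B) ->
    \int[m]_x (\prod_(i < n) f i (Y i x))%:E =
    \prod_(i < n) \int[nu]_y (f i y)%:E.
  move=> mf f0 foo; apply: (gen (enum 'I_n)) => // i; by rewrite mem_enum.
elim: s => [|i s IH] {}f mf f0 foo fs.
  have {fs}fs i : exists B, measurable B /\ f i = \1_B.
    by have [//|B mB fB] := fs i; exists B.
  pose B i := sval (cid (fs i)).
  have mB i : measurable (B i) := (svalP (cid (fs i))).1.
  have fB i : f i = \1_(B i) := (svalP (cid (fs i))).2.
  transitivity (\int[m]_x (\1_[set x | forall i, B i (Y i x)] x)%:E).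
    apply: eq_integral => x _; congr EFin; rewrite indicE.
    have [h|h] := pselect (forall i, B i (Y i x)).
      by rewrite mem_set// big1// => i _; rewrite fB indicE mem_set.
    rewrite memNset//; move/existsNP : h => [i hi].
    by rewrite (bigD1 i)//= fB indicE memNset// mul0r.
  rewrite integral_indic//; last first.
    have -> : [set x | forall i, B i (Y i x)] = \bigcap_(i in setT) (Y i @^-1` B i).
      by apply/seteqP; split => x /=; [move=> h i _|move=> h i]; exact: h.
    apply: fin_bigcap_measurable => [|i _]; first exact: finite_finset.
    by rewrite -[_ @^-1` _]setTI; exact: mY.
  rewrite setIT rectangles//; apply: eq_bigr => i _.
  by rewrite fB integral_indic// setIT.
pose W x := (\prod_(j < n | j != i) f j (Y j x))%R.
transitivity (\int[m]_x ((W x)%:E * (f i (Y i x))%:E)).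
  by apply: eq_integral => x _; rewrite (bigD1 i)//= mulrC EFinM.
rewrite [RHS](bigD1 i)//= muleC.
apply: (@ge0_integral_density _ _ _ _ _ m nu W (Y i) _ _ _ _ _ _ (EFin \o f i)) => //.
- by move=> x; exact: prodr_ge0.
- rewrite /W; under eq_fun do rewrite -big_filter.
  by apply: measurable_prod => j _; exact: measurableT_comp.
- apply: (big_ind (fun x : \bar R => x \is a fin_num)) => // [x y xfin yfin|j _].
    exact: fin_numM.
  by rewrite ge0_fin_numE//; apply: integral_ge0 => y _; rewrite lee_fin.
- move=> B mB.
  pose g j := if j == i then \1_B else f j.
  transitivity (\int[m]_x (\prod_(j < n) g j (Y j x))%:E).
    apply: eq_integral => x _; rewrite (bigD1 i)//= /g eqxx mulrC.
    by congr (_ * _)%:E; apply: eq_bigr => j /negbTE ->.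
  rewrite IH.
  + rewrite (bigD1 i)//= /g eqxx integral_indic// setIT muleC.
    by congr (_ * _); apply: eq_bigr => j /negbTE ->.
  + by move=> j; rewrite /g; case: ifP => // _; exact: measurable_indic.
  + by move=> j y; rewrite /g; case: ifP.
  + move=> j; rewrite /g; case: ifP => // _.
    rewrite integral_indic// setIT.
    by apply: le_lt_trans nuT; apply: le_measure; rewrite ?inE.
  + move=> j js; rewrite /g; case: ifP => [_|/negbT ji]; first by exists B.
    by apply: fs; rewrite inE negb_or ji.
- exact/measurable_EFinP.
- by move=> y; rewrite lee_fin.
Qed.

End expectation_of_products.

(** * Complex-valued integrands *)

Section complex_exponential.
Variable R : realType.
Local Notation normc := (@Normc.normc R).
Implicit Types w z : R[i].

Lemma norm_normc w : `|w| = (normc w)%:C%C. Proof. by []. Qed.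

Lemma normc_ge0 w : 0 <= normc w.
Proof. by case: w => a b; exact: sqrtr_ge0. Qed.

Lemma ler_norm_Re w : `|complex.Re w| <= normc w.
Proof.
case: w => a b /=; rewrite -sqrtr_sqr ler_sqrt ?addr_ge0 ?sqr_ge0//.
by rewrite lerDl sqr_ge0.
Qed.

Lemma ler_norm_Im w : `|complex.Im w| <= normc w.
Proof.
case: w => a b /=; rewrite -sqrtr_sqr ler_sqrt ?addr_ge0 ?sqr_ge0//.
by rewrite lerDr sqr_ge0.
Qed.

Lemma ler_norm_cpart c w : `|cpart c w| <= normc w.
Proof. by case: c; [exact: ler_norm_Re|exact: ler_norm_Im]. Qed.

Lemma normc_le_ReIm w : normc w <= `|complex.Re w| + `|complex.Im w|.
Proof.
case: w => a b /=; rewrite -[leRHS]ger0_norm ?addr_ge0// -sqrtr_sqr.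
rewrite ler_sqrt ?sqr_ge0// sqrrD !real_normK ?num_real// lerD2r lerDl.
by rewrite mulrn_wge0// mulr_ge0.
Qed.

Lemma normcR (x : R) : normc x%:C%C = `|x|.
Proof. by rewrite /= expr0n addr0 sqrtr_sqr. Qed.

Lemma normcX w n : normc (w ^+ n) = normc w ^+ n.
Proof.
elim: n => [|n IH]; first exact: Normc.normc1.
by rewrite !exprS Normc.normcM IH.
Qed.

Lemma normc_prod (I : Type) (r : seq I) (P : pred I) (f : I -> R[i]) :
  normc (\prod_(i <- r | P i) f i) = \prod_(i <- r | P i) normc (f i).
Proof. exact: (big_morph normc (@Normc.normcM R) (@Normc.normc1 R)). Qed.

Lemma normc_exp w : normc (cexp w) = expR (complex.Re w).
Proof.
rewrite /cexp Normc.normcM normcR ger0_norm ?expR_ge0//= cos2Dsin2 sqrtr1.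
by rewrite mulr1.
Qed.

Lemma cexpD w z : cexp (w + z) = cexp w * cexp z.
Proof.
case: w z => [a b] [c e]; rewrite /cexp/= expRD cosD sinD.
by apply/eqP; rewrite eq_complex/=; apply/andP; split; apply/eqP; ring.
Qed.

Lemma cexp0 : cexp 0 = 1 :> R[i].
Proof. by rewrite /cexp/= expR0 cos0 sin0 mul1r. Qed.

Lemma cexp_real (x : R) : cexp x%:C%C = (expR x)%:C%C.
Proof. by rewrite /cexp/= cos0 sin0 mulr1. Qed.

Lemma cexp_sum (I : Type) (r : seq I) (P : pred I) (f : I -> R[i]) :
  cexp (\sum_(i <- r | P i) f i) = \prod_(i <- r | P i) cexp (f i).
Proof. exact: (big_morph (@cexp R) cexpD cexp0). Qed.

End complex_exponential.

Section complex_integration.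
Context d (T : measurableType d) (R : realType) (m : {measure set T -> \bar R}).
Local Notation normc := (@Normc.normc R).
Local Notation Re := (@complex.Re R).
Local Notation Im := (@complex.Im R).
Implicit Types (f g : T -> R[i]) (G : T -> R) (c : R[i]).

Definition cmeasurable f :=
  measurable_fun setT (Re \o f) /\ measurable_fun setT (Im \o f).

Lemma cmeasurable_cst c : cmeasurable (cst c).
Proof. by split; exact: measurable_cst. Qed.

Lemma cmeasurable_real G : measurable_fun setT G ->
  cmeasurable (fun x => (G x)%:C%C).
Proof. by move=> mG; split => //; exact: measurable_cst. Qed.

Lemma cmeasurableD f g :
  cmeasurable f -> cmeasurable g -> cmeasurable (fun x => f x + g x).
Proof.
move=> [mf1 mf2] [mg1 mg2]; split.
  by rewrite (_ : _ \o _ = fun x => Re (f x) + Re (g x));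
    [exact: measurable_funD|apply/funext => x; rewrite -raddfD].
by rewrite (_ : _ \o _ = fun x => Im (f x) + Im (g x));
  [exact: measurable_funD|apply/funext => x; rewrite -raddfD].
Qed.

Lemma cmeasurableM f g :
  cmeasurable f -> cmeasurable g -> cmeasurable (fun x => f x * g x).
Proof.
move=> [mf1 mf2] [mg1 mg2]; split.
  rewrite (_ : _ \o _ = fun x => Re (f x) * Re (g x) - Im (f x) * Im (g x)).
    by apply: measurable_funB; exact: measurable_funM.
  by apply/funext => x/=; rewrite cReM.
rewrite (_ : _ \o _ = fun x => Re (f x) * Im (g x) + Im (f x) * Re (g x)).
  by apply: measurable_funD; exact: measurable_funM.
by apply/funext => x/=; rewrite cImM.
Qed.

Lemma cmeasurable_sum (I : Type) (r : seq I) (P : pred I) (f : I -> T -> R[i]) :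
  (forall i, P i -> cmeasurable (f i)) ->
  cmeasurable (fun x => \sum_(i <- r | P i) f i x).
Proof.
move=> mf; elim: r => [|i r IH].
  by under eq_fun do rewrite big_nil; exact: cmeasurable_cst.
under eq_fun do rewrite big_cons.
by case: (boolP (P i)) => // Pi; apply: cmeasurableD => //; exact: mf.
Qed.

Lemma cmeasurable_prod (I : Type) (r : seq I) (P : pred I) (f : I -> T -> R[i]) :
  (forall i, P i -> cmeasurable (f i)) ->
  cmeasurable (fun x => \prod_(i <- r | P i) f i x).
Proof.
move=> mf; elim: r => [|i r IH].
  by under eq_fun do rewrite big_nil; exact: cmeasurable_cst.
under eq_fun do rewrite big_cons.
by case: (boolP (P i)) => // Pi; apply: cmeasurableM => //; exact: mf.
Qed.

Lemma cmeasurable_cexp f : cmeasurable f -> cmeasurable (fun x => cexp (f x)).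
Proof.
move=> [mf1 mf2]; have ms : measurable_fun setT (@sin R).
  by apply: continuous_measurable_fun; exact: continuous_sin.
have mc : measurable_fun setT (@cos R).
  by apply: continuous_measurable_fun; exact: continuous_cos.
apply: cmeasurableM.
  by apply: (@cmeasurable_real (expR \o (Re \o f))); exact: measurableT_comp.
by split; exact: measurableT_comp.
Qed.

Lemma cintegrable_le f G : cmeasurable f -> m.-integrable setT (EFin \o G) ->
  (forall x, normc (f x) <= G x) -> cintegrable m f.
Proof.
move=> [mf1 mf2] iG fG; split.
  apply: le_integrable iG => //; first exact/measurable_EFinP.
  move=> x _ /=; rewrite lee_fin (le_trans (ler_norm_Re _))// (le_trans (fG x))//.
  exact: ler_norm.
apply: le_integrable iG => //; first exact/measurable_EFinP.
move=> x _ /=; rewrite lee_fin (le_trans (ler_norm_Im _))// (le_trans (fG x))//.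
exact: ler_norm.
Qed.

(** The factor 2 pays for bounding the two components separately. *)
Lemma normc_cintegral_le f G : cintegrable m f -> m.-integrable setT (EFin \o G) ->
  (forall x, normc (f x) <= G x) -> normc (cintegral m f) <= 2 * \int[m]_x G x.
Proof.
move=> [if1 if2] iG fG; rewrite (le_trans (normc_le_ReIm _))//= mulr_natl mulr2n.
by apply: lerD; (apply: le_trans (le_normr_Rintegral _ _) _ => //);
  apply: le_Rintegral => //;
  [exact: (integrable_norm if1)| |exact: (integrable_norm if2)| ] => x _;
  apply: le_trans (fG x); rewrite ?ler_norm_Re ?ler_norm_Im.
Qed.

Lemma cintegrableD f g :
  cintegrable m f -> cintegrable m g -> cintegrable m (fun x => f x + g x).
Proof.
move=> [if1 if2] [ig1 ig2]; split.
  by apply: eq_integrable (integrableD _ if1 ig1) => // x _ /=; rewrite -EFinD -raddfD.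
by apply: eq_integrable (integrableD _ if2 ig2) => // x _ /=; rewrite -EFinD -raddfD.
Qed.

Lemma cintegralD f g : cintegrable m f -> cintegrable m g ->
  cintegral m (fun x => f x + g x) = cintegral m f + cintegral m g.
Proof.
move=> [if1 if2] [ig1 ig2]; rewrite /cintegral.
under eq_Rintegral do rewrite raddfD.
under [X in Complex _ X]eq_Rintegral do rewrite raddfD.
by rewrite !RintegralD.
Qed.

Lemma cintegrableZl c f : cintegrable m f -> cintegrable m (fun x => c * f x).
Proof.
move=> [if1 if2]; split.
  have := integrableB measurableT (integrableZl measurableT (Re c) if1)
    (integrableZl measurableT (Im c) if2).
  by apply: eq_integrable => // x _ /=; rewrite -!EFinM -EFinB cReM.
have := integrableD measurableT (integrableZl measurableT (Re c) if2)
  (integrableZl measurableT (Im c) if1).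
by apply: eq_integrable => // x _ /=; rewrite -!EFinM -EFinD cImM.
Qed.

Lemma cintegralZl c f : cintegrable m f ->
  cintegral m (fun x => c * f x) = c * cintegral m f.
Proof.
move=> [if1 if2]; rewrite /cintegral.
under eq_Rintegral do rewrite cReM.
under [X in Complex _ X]eq_Rintegral do rewrite cImM.
have i1 (a : R) : m.-integrable setT (EFin \o (fun x => a * Re (f x))).
  by apply: eq_integrable (integrableZl _ a if1).
have i2 (a : R) : m.-integrable setT (EFin \o (fun x => a * Im (f x))).
  by apply: eq_integrable (integrableZl _ a if2).
rewrite RintegralB// RintegralD// !RintegralZl//.
by case: c => a b; apply/eqP; rewrite eq_complex/= !eqxx.
Qed.

Lemma cintegral_sum (I : Type) (r : seq I) (f : I -> T -> R[i]) :
  (forall i, cintegrable m (f i)) ->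
  cintegrable m (fun x => \sum_(i <- r) f i x) /\
  cintegral m (fun x => \sum_(i <- r) f i x) = \sum_(i <- r) cintegral m (f i).
Proof.
move=> if_; elim: r => [|i r [IH1 IH2]].
  under eq_fun do rewrite big_nil; rewrite big_nil; split.
    by split; exact: integrable0.
  by rewrite /cintegral; congr Complex; rewrite /Rintegral integral0.
under eq_fun do rewrite big_cons.
by rewrite big_cons; split; [exact: cintegrableD|rewrite cintegralD// IH2].
Qed.

Lemma cintegral_real G : m.-integrable setT (EFin \o G) ->
  cintegrable m (fun x => (G x)%:C%C) /\
  cintegral m (fun x => (G x)%:C%C) = (\int[m]_x G x)%:C%C.
Proof.
move=> iG; split; first by split => //; exact: integrable0.
by rewrite /cintegral/= /Rintegral integral0.
Qed.

Lemma eq_cintegral f g : f =1 g -> cintegral m f = cintegral m g.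
Proof. by move=> /funext ->. Qed.

End complex_integration.

Section complex_expectation_of_products.
Context d1 d2 (T : measurableType d1) (T' : measurableType d2) (R : realType).
Variables (m : {measure set T -> \bar R}) (nu : {measure set T' -> \bar R}).
Variables (n : nat) (Y : 'I_n -> T -> T').
Hypothesis nuT : (nu setT < +oo)%E.
Hypothesis mY : forall i, measurable_fun setT (Y i).
Hypothesis rectangles : forall B : 'I_n -> set T', (forall i, measurable (B i)) ->
  m [set x | forall i, B i (Y i x)] = (\prod_(i < n) nu (B i))%E.

(* A complex number is the combination, with coefficients 1, i, -1 and -i, of the
   positive and negative parts of its components; [part f k] is the one that
   goes with the [k]-th power of i. *)
Let cunit (k : 'I_4) : R[i] := 'i%C ^+ k.

Let part (f : T' -> R[i]) (k : 'I_4) (y : T') : R :=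
  let a := if odd k then complex.Im (f y) else complex.Re (f y) in
  (`|a| + (-1) ^+ (1 < k)%N * a) / 2.

Let part_ge0 f k y : 0 <= part f k y.
Proof.
rewrite /part divr_ge0//; set a := if _ then _ else _.
case: (1 < k)%N; first by rewrite expr1 mulN1r subr_ge0 ler_norm.
by rewrite expr0 mul1r -[X in _ + X]opprK subr_ge0 -normrN ler_norm.
Qed.

Let part_sum f y : f y = \sum_(k < 4) cunit k * (part f k y)%:C%C.
Proof.
rewrite !big_ord_recl big_ord0 /cunit /part/= /bump/=.
case: (f y) => a b; apply/eqP.
rewrite !exprS expr0 !mulr1 eq_complex/=.
by apply/andP; split; apply/eqP; field.
Qed.

Let part_integrable f k : cintegrable nu f ->
  nu.-integrable setT (EFin \o part f k).
Proof.
move=> [if1 if2]; rewrite /part.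
have gen (a : T' -> R) (s : R) : nu.-integrable setT (EFin \o a) ->
    nu.-integrable setT (EFin \o (fun y => (`|a y| + s * a y) / 2)).
  move=> ia; have ia2 := integrable_norm ia.
  have := integrableZl measurableT 2^-1 (integrableD measurableT ia2
     (integrableZl measurableT s ia)).
  by apply: eq_integrable => // y _ /=; rewrite mulrC.
by case: (odd k); exact: gen.
Qed.

(** Independence factorizes expectations of complex integrands: every factor is
    a combination of four nonnegative ones, and both sides are multilinear. *)
Lemma cintegral_prod (f : 'I_n -> T' -> R[i]) : (forall i, cintegrable nu (f i)) ->
  cintegrable m (fun x => \prod_(i < n) f i (Y i x)) /\
  cintegral m (fun x => \prod_(i < n) f i (Y i x)) =
  \prod_(i < n) cintegral nu (f i).
Proof.
suff gen (s : seq 'I_n) : forall f : 'I_n -> T' -> R[i],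
    (forall i, cintegrable nu (f i)) ->
    (forall i, i \notin s -> exists g : T' -> R,
       (forall y, 0 <= g y) /\ f i = (fun y => (g y)%:C%C)) ->
    cintegrable m (fun x => \prod_(i < n) f i (Y i x)) /\
    cintegral m (fun x => \prod_(i < n) f i (Y i x)) =
    \prod_(i < n) cintegral nu (f i).
  by move=> if_; apply: (gen (enum 'I_n)) => // i; rewrite mem_enum.
elim: s => [|i s IH] {}f if_ fs.
  pose g i := sval (cid (fs i isT)).
  have g0 i y : 0 <= g i y := (svalP (cid (fs i isT))).1 y.
  have fg i : f i = (fun y => (g i y)%:C%C) := (svalP (cid (fs i isT))).2.
  have ig i : nu.-integrable setT (EFin \o g i).
    by have [+ _] := if_ i; rewrite fg.
  have mg i : measurable_fun setT (g i).
    by apply/measurable_EFinP; exact: measurable_int (ig i).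
  have goo i : (\int[nu]_y (g i y)%:E < +oo)%E.
    by apply: integrable_lty => //; exact: ig.
  have gfin i : (\int[nu]_y (g i y)%:E = (\int[nu]_y g i y)%:E)%E.
    by rewrite /Rintegral fineK//; exact: (integrable_fin_num measurableT (ig i)).
  have E := ge0_integral_prod nuT mY rectangles mg g0 goo.
  have Efin : (\int[m]_x (\prod_(i < n) g i (Y i x))%:E =
      (\prod_(i < n) \int[nu]_y g i y)%:E)%E.
    rewrite E; under eq_bigr do rewrite gfin.
    by elim/big_rec2: _ => // j x y _ ->.
  have iP : m.-integrable setT (EFin \o fun x => \prod_(i < n) g i (Y i x)).
    apply/integrableP; split.
      apply/measurable_EFinP; apply: measurable_prod => j _.
      exact: measurableT_comp.
    under eq_integral do rewrite /= ger0_norm ?prodr_ge0//.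
    by rewrite Efin ltry.
  have fE : (fun x => \prod_(i < n) f i (Y i x)) =
      (fun x => (\prod_(i < n) g i (Y i x))%:C%C).
    apply/funext => x; rewrite rmorph_prod; apply: eq_bigr => j _.
    by rewrite fg.
  have [c1 c2] := cintegral_real iP; rewrite fE; split => //.
  rewrite c2 /Rintegral Efin/= rmorph_prod; apply: eq_bigr => j _.
  by rewrite fg (cintegral_real (ig j)).2.
pose F k j := if j == i then (fun y => (part (f i) k y)%:C%C) else f j.
have iF k j : cintegrable nu (F k j).
  rewrite /F; case: ifP => // _.
  by apply: (cintegral_real _).1; exact: part_integrable.
have FE : (fun x => \prod_(j < n) f j (Y j x)) =
    (fun x => \sum_(k < 4) cunit k * \prod_(j < n) F k j (Y j x)).
  apply/funext => x; rewrite (bigD1 i)//= (part_sum (f i)) mulr_suml.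
  apply: eq_bigr => k _; rewrite [in RHS](bigD1 i)//= /F eqxx mulrA.
  by congr (_ * _); apply: eq_bigr => j /negbTE ->.
have IHk k := IH (F k) (iF k).
have {}IHk k : cintegrable m (fun x => \prod_(j < n) F k j (Y j x)) /\
    cintegral m (fun x => \prod_(j < n) F k j (Y j x)) =
    \prod_(j < n) cintegral nu (F k j).
  apply: IHk => j js; rewrite /F; case: ifP => [_|/negbT ji].
    by exists (part (f i) k); split => //; exact: part_ge0.
  by apply: fs; rewrite inE negb_or ji.
have [S1 S2] := cintegral_sum (index_enum 'I_4)
  (fun k => cintegrableZl (cunit k) (IHk k).1).
rewrite FE; split => //; rewrite S2.
have [_ S3] := cintegral_sum (index_enum 'I_4)
  (fun k => cintegrableZl (cunit k) (cintegral_real (part_integrable k (if_ i))).1).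
rewrite (bigD1 i)//= (_ : cintegral nu (f i) =
  \sum_(k < 4) cunit k * (\int[nu]_y part (f i) k y)%:C%C).
  rewrite mulr_suml; apply: eq_bigr => k _.
  rewrite cintegralZl; last exact: (IHk k).1.
  rewrite (IHk k).2 (bigD1 i)//= {1}/F eqxx mulrA; congr (_ * _ * _).
    by rewrite (cintegral_real (part_integrable k (if_ i))).2.
  by apply: eq_bigr => j /negbTE ji; rewrite /F ji.
rewrite (eq_cintegral _ (part_sum (f i))) S3; apply: eq_bigr => k _.
have [c1 c2] := cintegral_real (part_integrable k (if_ i)).
by rewrite cintegralZl// c2.
Qed.

End complex_expectation_of_products.

(** * Power series and their termwise integration *)

Section power_series.
Variable R : realType.

(** The terms of a convergent series are bounded. *)
Lemma entire_of_cvg (c : R^nat) :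
  (forall v, cvgn (series (fun n => v ^+ n * c n))) -> entire_coef c.
Proof.
move=> cc K K0; have /cvg_series_bounded/pinfty_ex_gt0[M M0 cM] := cc K.
exists M => n; have /= := cM n I.
by rewrite normrM mulrC normrX (gtr0_norm K0).
Qed.

(** The coefficients are the derivatives of the sum at 0. *)
Lemma power_series_unique (c c' : R^nat) (F : R -> R) :
  (forall v, series (fun n => v ^+ n * c n) @ \oo --> F v) ->
  (forall v, series (fun n => v ^+ n * c' n) @ \oo --> F v) -> c = c'.
Proof.
have gen (b : R^nat) : (forall v, series (fun n => v ^+ n * b n) @ \oo --> F v) ->
    forall n, b n = derive1n n F 0 / n`!%:R.
  move=> bF n; have eb : entire_coef b.
    by apply: entire_of_cvg => v; exact: cvgP (bF v).
  have -> : F = (fun v => limn (pseries b v)).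
    apply/funext => v; apply/esym/cvg_lim => //.
    have -> : pseries b v = series (fun n => v ^+ n * b n); last exact: bF.
    by apply/funext => k; apply: eq_bigr => i _; rewrite mulrC.
  rewrite (derive1n_pseries _ eb) mulrC mulKf//.
by move=> cF c'F; apply/funext => n; rewrite (gen c)// (gen c').
Qed.

Lemma hcoef01 n : hcoef (0 : R) 1 n = n`!%:R^-1.
Proof.
suff : hcoef (0 : R) 1 n = n`!%:R^-1 /\ hcoef (0 : R) 1 n.+1 = n.+1`!%:R^-1 by case.
elim: n => [|n [IH1 IH2]]; first by rewrite /hcoef/= fact0 invr1.
split => //; have := hcoefSS (0 : R) 1 n; rewrite mul0r subr0 mul1r IH2 => h.
have n0 : n.+2%:R != 0 :> R by rewrite pnatr_eq0.
by rewrite factS natrM invfM -h mulKf.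
Qed.

End power_series.

Section exchange_series_integral.
Context d (T : measurableType d) (R : realType) (m : {measure set T -> \bar R}).

Lemma geometric_partial_sum (u : R^nat) (G : R) n :
  (forall k, `|u k| <= 2^-1 ^+ k * G) -> `|series u n| <= 2 * G.
Proof.
move=> uG; have G0 : 0 <= G by have := uG 0%N; rewrite expr0 mul1r; exact: le_trans.
rewrite /series/= (le_trans (ler_norm_sum _ _ _))//.
apply: le_trans (_ : \sum_(0 <= k < n) 2^-1 ^+ k * G <= _).
  by apply: ler_sum => k _.
rewrite -mulr_suml big_mkord sum_geometric2 ler_wpM2r//.
by rewrite ler_piMr// gerBl exprn_ge0.
Qed.

(** The geometric weights bound all partial sums by [2 * G], which dominates. *)
Lemma cvg_series_Rintegral (u : nat -> T -> R) (s G : T -> R) :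
    (forall n, measurable_fun setT (u n)) -> measurable_fun setT s ->
    m.-integrable setT (EFin \o G) ->
    (forall n x, `|u n x| <= 2^-1 ^+ n * G x) ->
    (forall x, series (u ^~ x) @ \oo --> s x) ->
  series (fun n => \int[m]_x u n x) @ \oo --> \int[m]_x s x.
Proof.
move=> mu ms iG uG us.
have iu n : m.-integrable setT (EFin \o u n).
  apply: le_integrable (integrableZl measurableT (2^-1 ^+ n) iG) => //.
    exact/measurable_EFinP.
  by move=> x _; rewrite /= lee_fin (le_trans (uG n x))// ler_norm.
have i2G : m.-integrable setT (EFin \o (fun x => 2 * G x)).
  by apply: eq_integrable (integrableZl measurableT 2 iG).
have [|||||iS _ cI] := @dominated_convergence _ _ _ m setT measurableT
  (fun n x => (series (u ^~ x) n)%:E) (EFin \o s) (EFin \o (fun x => 2 * G x)).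
- move=> n; apply/measurable_EFinP; rewrite /series/=.
  by apply: measurable_sum => k.
- exact/measurable_EFinP.
- by apply/aeW => x _; apply: cvg_EFin; [exact: nearW|exact: us].
- exact: i2G.
- apply/aeW => x n _; rewrite /= lee_fin.
  by apply: geometric_partial_sum => k; exact: uG.
have -> : series (fun n => \int[m]_x u n x) =
    (fun n => fine (\int[m]_x (series (u ^~ x) n)%:E)).
  apply/funext => n; rewrite /series/=.
  under eq_integral do rewrite -sumEFin.
  rewrite integral_sum//.
  rewrite -sum_fine// => k _.
  exact: (integrable_fin_num measurableT (iu k)).
apply: fine_cvg; rewrite /Rintegral fineK//.
exact: (integrable_fin_num measurableT iS).
Qed.

End exchange_series_integral.

(** * Gaussian integrals on the line *)

Section gaussian_integrals.
Variables (R : realType) (t : R).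
Hypothesis t0 : 0 < t.
Local Notation Re := (@complex.Re R).
Local Notation Im := (@complex.Im R).
Local Notation normc := (@Normc.normc R).

(** The same function of sets as [normal_prob], viewed as a measure for the
    canonical measurable structure of [R], which is the one that the coordinates
    of a tuple carry. *)
Definition gauss (B : set R) : \bar R := normal_prob 0 (Num.sqrt t) B.

Let gauss0 : gauss set0 = 0%E.
Proof. exact: (measure0 (normal_prob 0 (Num.sqrt t))). Qed.

Let gauss_ge0 B : (0 <= gauss B)%E.
Proof. exact: (measure_ge0 (normal_prob 0 (Num.sqrt t))). Qed.

Let gauss_sigma_additive : semi_sigma_additive gauss.
Proof. exact: (@measure_semi_sigma_additive _ _ _ (normal_prob 0 (Num.sqrt t))). Qed.

HB.instance Definition _ := isMeasure.Build _ _ _ gauss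
  gauss0 gauss_ge0 gauss_sigma_additive.

Let st0 : Num.sqrt t != 0. Proof. by rewrite gt_eqF// sqrtr_gt0. Qed.

Lemma ge0_integral_gauss (f : R -> \bar R) :
  measurable_fun setT f -> (forall x, 0 <= f x)%E ->
  (\int[gauss]_x f x =
   \int[lebesgue_measure]_x ((normal_pdf 0 (Num.sqrt t) x)%:E * f x))%E.
Proof.
move=> mf f0; rewrite -[LHS]mul1e; apply/esym.
have dE B : measurable B -> (\int[lebesgue_measure]_x
    (normal_pdf 0 (Num.sqrt t) x * \1_B (idfun x : R))%:E = 1 * gauss B)%E.
  move=> mB; rewrite mul1e [RHS]integral_mkcond.
  by apply: eq_integral => x _; rewrite epatch_indic/= -EFinM.
exact: (@ge0_integral_density _ _ _ _ _ (@lebesgue_measure R) gauss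
  (normal_pdf 0 (Num.sqrt t)) (idfun : measurableTypeR R -> R) 1%E
  (normal_pdf_ge0 0 _) (measurable_normal_pdf 0 _) (@measurable_id _ _ setT)
  isT dE f mf f0).
Qed.

(** Multiplied by an exponential, one Gaussian density becomes another one, so
    that completing the square replaces every integration. *)
Lemma integral_gauss_exp (l s : R) : 0 < s ->
  (\int[gauss]_x (expR (l * x + (t^-1 - s ^- 2) / 2 * x ^+ 2))%:E =
   (s / Num.sqrt t * expR (l ^+ 2 * s ^+ 2 / 2))%:E)%E.
Proof.
move=> s0; have sn0 : s != 0 by rewrite gt_eqF.
pose C := s / Num.sqrt t * expR (l ^+ 2 * s ^+ 2 / 2).
have C0 : 0 <= C by rewrite mulr_ge0 ?expR_ge0// divr_ge0 ?sqrtr_ge0// ltW.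
have mE : measurable_fun setT
    (fun x : R => (expR (l * x + (t^-1 - s ^- 2) / 2 * x ^+ 2))%:E).
  apply/measurable_EFinP; apply: measurableT_comp => //.
  apply: measurable_funD; first exact: measurable_funM.
  by apply: measurable_funM => //; exact: measurable_funX.
rewrite ge0_integral_gauss//.
transitivity (\int[lebesgue_measure]_x
    (C%:E * (normal_pdf (l * s ^+ 2) s x)%:E))%E; last first.
  rewrite ge0_integralZl//; last 2 first.
  - by apply/measurable_EFinP; exact: measurable_normal_pdf.
  - by move=> x _; rewrite lee_fin normal_pdf_ge0.
  by rewrite integral_normal_pdf mule1.
apply: eq_integral => x _; rewrite -!EFinM; congr EFin.
rewrite !normal_pdfE//= /normal_fun /normal_peak.
have sq2 : Num.sqrt t ^+ 2 = t by rewrite sqr_sqrtr// ltW.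
have pk (r : R) : 0 < r -> Num.sqrt (r ^+ 2 * pi *+ 2) = r * Num.sqrt (pi *+ 2).
  by move=> r0; rewrite -mulrnAr sqrtrM ?sqr_ge0// sqrtr_sqr gtr0_norm.
rewrite !pk ?sqrtr_gt0// -[LHS]mulrA -expRD /C.
have q0 : Num.sqrt (pi *+ 2) != 0 :> R.
  by rewrite gt_eqF// sqrtr_gt0 mulrn_wgt0// pi_gt0.
rewrite sq2 [RHS]mulrACA -expRD; congr (_ * expR _).
  by field; rewrite st0 sn0 q0.
by field; rewrite sn0 (gt_eqF t0).
Qed.

Lemma integral_gauss_mgf (l : R) :
  (\int[gauss]_x (expR (l * x))%:E = (expR (l ^+ 2 * t / 2))%:E)%E.
Proof.
have st : 0 < Num.sqrt t by rewrite sqrtr_gt0.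
have := integral_gauss_exp l st; rewrite sqr_sqrtr ?ltW// divff// mul1r => <-.
by apply: eq_integral => x _; rewrite subrr !mul0r addr0.
Qed.

(** The case where the width [s] is the square root of [2 * t]. *)
Lemma integral_gauss_sqr (l : R) :
  (\int[gauss]_x (expR (l * x + (4 * t)^-1 * x ^+ 2))%:E =
   (Num.sqrt 2 * expR (l ^+ 2 * t))%:E)%E.
Proof.
have s0 : 0 < Num.sqrt (2 * t) by rewrite sqrtr_gt0 mulr_gt0.
have := integral_gauss_exp l s0; rewrite sqr_sqrtr ?mulr_ge0 ?ltW//.
have -> : l ^+ 2 * (2 * t) / 2 = l ^+ 2 * t by field.
rewrite sqrtrM// mulfK//.
by have -> : (t^-1 - (2 * t)^-1) / 2 = (4 * t)^-1 by field; rewrite gt_eqF.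
Qed.

Lemma integrable_gauss_sqr (k l : R) : gauss.-integrable setT
  (EFin \o (fun x => k * expR (l * x + (4 * t)^-1 * x ^+ 2))).
Proof.
rewrite (_ : _ \o _ =
  (fun x => k%:E * (expR (l * x + (4 * t)^-1 * x ^+ 2))%:E)%E)//.
apply: integrableZl => //; apply/integrableP; split.
  apply/measurable_EFinP; apply: measurableT_comp => //.
  apply: measurable_funD; first exact: measurable_funM.
  by apply: measurable_funM => //; exact: measurable_funX.
under eq_integral do rewrite /= ger0_norm ?expR_ge0//.
by rewrite integral_gauss_sqr ltry.
Qed.

Lemma gauss_setT : gauss setT = 1%E.
Proof. exact: (@probability_setT _ _ _ (normal_prob 0 (Num.sqrt t))). Qed.

Lemma integrable_gauss_le (f : R -> R) (k l : R) : measurable_fun setT f ->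
  (forall x, `|f x| <= k * expR (l * x + (4 * t)^-1 * x ^+ 2)) ->
  gauss.-integrable setT (EFin \o f).
Proof.
move=> mf fk; apply: le_integrable (integrable_gauss_sqr k l) => //.
  exact/measurable_EFinP.
by move=> x _; rewrite /= lee_fin (le_trans (fk x))// ler_norm.
Qed.

Let e4 : 0 < (4 * t)^-1. Proof. by rewrite invr_gt0 mulr_gt0. Qed.

Let herm_dom (v x : R) n : `|v ^+ n * hcoef t x n| <= 2^-1 ^+ n *
  (expR ((4 * t + 2 * t) * v ^+ 2) * expR (0 * x + (4 * t)^-1 * x ^+ 2)).
Proof.
have := hcoef_gauss x v n (ltW t0) e4; rewrite invrK => h.
by rewrite mul0r add0r (mulrC (expR ((4 * t + _) * _))).
Qed.

Let cpart_eta (w : R[i]) : w = Complex (cpart true w) (cpart false w). Proof. by case: w. Qed.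

Let cmeasurable_cpart b (f : R -> R[i]) : cmeasurable f ->
  measurable_fun setT (fun x => cpart b (f x)).
Proof. by case: b => -[]. Qed.

Let integrable_cpart b (f : R -> R[i]) : cintegrable gauss f ->
  gauss.-integrable setT (EFin \o (fun x => cpart b (f x))).
Proof. by case: b => -[]. Qed.

Let cpart_cintegral b (f : R -> R[i]) :
  cpart b (cintegral gauss f) = \int[gauss]_x cpart b (f x).
Proof. by case: b. Qed.

Let integrable_hcoef n : gauss.-integrable setT (EFin \o (fun x => hcoef t x n)).
Proof.
apply: integrable_gauss_le; first exact: measurable_hcoef.
by move=> x; have := herm_dom 1 x n; rewrite expr1n mul1r mulrA; exact.
Qed.

Let cvg_series0 (c : R^nat) : series (fun n => c n * (n == 0%N)%:R) @ \oo --> c 0%N.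
Proof.
rewrite -cvg_shiftS; apply: cvg_near_cst; apply: nearW => n.
rewrite /series/= big_nat_recl//= mulr1 big1 ?addr0// => i _.
by rewrite mulr0.
Qed.

Let affine_measurable (a b : R) : measurable_fun setT (fun x : R => a * x + b).
Proof. by apply: measurable_funD => //; exact: measurable_funM. Qed.

(** Both sides are the coefficients of one power series in [v]: the exponential
    martingale of parameter [v] has expectation 1 for every [v]. *)
Lemma Rintegral_hcoef n : \int[gauss]_x hcoef t x n = (n == 0%N)%:R.
Proof.
suff E : (fun n => \int[gauss]_x hcoef t x n) = (fun n => (n == 0%N)%:R).
  exact: (congr1 (fun c => c n) E).
apply: (@power_series_unique _ _ _ (fun=> 1)) => v; last first.
  by have := @cvg_series0 (fun n => v ^+ n); rewrite expr0.
have mE : measurable_fun setT (fun x : R => expR (v * x - v ^+ 2 * t / 2)).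
  by apply: measurableT_comp => //; exact: affine_measurable.
have h := @cvg_series_Rintegral _ _ _ gauss (fun n x => v ^+ n * hcoef t x n)
  (fun x => expR (v * x - v ^+ 2 * t / 2)) _
  (fun n => measurable_funM (measurable_cst _) (measurable_hcoef t n)) mE
  (integrable_gauss_sqr (expR ((4 * t + 2 * t) * v ^+ 2)) 0)
  (fun n x => herm_dom v x n) (fun x => @hermite_generating_hcoef R t x v).
have e1 : \int[gauss]_x expR (v * x - v ^+ 2 * t / 2) = 1.
  rewrite /Rintegral (_ : integral _ _ _ = 1%E)//.
  under eq_integral do rewrite expRD mulrC EFinM.
  rewrite ge0_integralZl//; last first.
    by apply/measurable_EFinP; apply: measurableT_comp => //; exact: measurable_funM.
  by rewrite integral_gauss_mgf -EFinM -expRD addNr expR0.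
rewrite e1 in h; move: h.
by under eq_fun do rewrite RintegralZl//.
Qed.

Lemma normc_cexp_quad (w : R[i]) (x : R) :
  normc (cexp (w * x%:C%C - w ^+ 2 * (t / 2)%:C%C)) =
  expR (- (Re (w ^+ 2) * (t / 2))) * expR (Re w * x).
Proof.
rewrite normc_exp -expRD; congr expR.
by rewrite raddfB/= !cReM/= !mulr0 !subr0 addrC.
Qed.

Let lin_le (l x : R) : expR (l * x) <= expR (l * x + (4 * t)^-1 * x ^+ 2).
Proof. by rewrite ler_expR lerDl mulr_ge0 ?sqr_ge0// ltW. Qed.

Let cmeasurable_affine (a b : R[i]) : cmeasurable (fun x : R => a * x%:C%C + b).
Proof.
apply: cmeasurableD; last exact: cmeasurable_cst.
apply: cmeasurableM; first exact: cmeasurable_cst.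
exact: (cmeasurable_real (@measurable_id _ _ _)).
Qed.

(** In the complex expansion only the term of degree 0 has a nonzero integral. *)
Lemma cintegral_cexp_quad (w : R[i]) :
  cintegrable gauss (fun x => cexp (w * x%:C%C - w ^+ 2 * (t / 2)%:C%C)) /\
  cintegral gauss (fun x => cexp (w * x%:C%C - w ^+ 2 * (t / 2)%:C%C)) = 1.
Proof.
have mc : cmeasurable (fun x : R => cexp (w * x%:C%C - w ^+ 2 * (t / 2)%:C%C)).
  by apply: cmeasurable_cexp; exact: cmeasurable_affine.
have ic : cintegrable gauss (fun x => cexp (w * x%:C%C - w ^+ 2 * (t / 2)%:C%C)).
  apply: (cintegrable_le mc
    (integrable_gauss_sqr (expR (- (Re (w ^+ 2) * (t / 2)))) (Re w))) => x.
  by rewrite normc_cexp_quad ler_wpM2l ?expR_ge0// lin_le.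
split => //; rewrite [LHS]cpart_eta.
have E b : cpart b (cintegral gauss
    (fun x => cexp (w * x%:C%C - w ^+ 2 * (t / 2)%:C%C))) = cpart b 1.
  rewrite cpart_cintegral.
  have h := @cvg_series_Rintegral _ _ _ gauss
    (fun n x => cpart b (w ^+ n) * hcoef t x n) _ _
    (fun n => measurable_funM (measurable_cst _) (measurable_hcoef t n))
    (cmeasurable_cpart b mc)
    (integrable_gauss_sqr (expR ((4 * t + 2 * t) * normc w ^+ 2)) 0) _
    (fun x => @hermite_generating_cpart R t x w b).
  have {}h := h _; apply: (cvg_unique _ (h _)) => //.
    move=> n x; apply: le_trans (herm_dom (normc w) x n).
    by rewrite !normrM ler_wpM2r// -normcX (le_trans (ler_norm_cpart _ _))// ler_norm.
  have -> : (fun n => \int[gauss]_x (cpart b (w ^+ n) * hcoef t x n)) =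
      (fun n => cpart b (w ^+ n) * (n == 0%N)%:R).
    by apply/funext => n; rewrite RintegralZl// Rintegral_hcoef.
  by have := @cvg_series0 (fun n => cpart b (w ^+ n)); rewrite expr0.
by rewrite !E.
Qed.

(** The one-dimensional factor of the exponential in the representation of the
    transform. It is the quotient of the Gaussian densities centred at [z] and at
    0, continued to complex [z]. *)
Definition ctilt (z : R[i]) (x : R) : R[i] :=
  cexp ((t^-1)%:C%C * (z * x%:C%C - z ^+ 2 / 2)).

Lemma half_complex : (2^-1 : R[i]) = (2^-1 : R)%:C%C.
Proof. by rewrite fmorphV rmorph_nat. Qed.

Lemma normc_ctilt z x :
  normc (ctilt z x) = expR (- (Re (z ^+ 2) / (2 * t))) * expR (Re z / t * x).
Proof.
rewrite normc_exp -expRD; congr expR.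
rewrite half_complex cReM/= mul0r subr0 raddfB/= !cReM/= !mulr0 !subr0.
by field; rewrite gt_eqF.
Qed.

Lemma cmeasurable_ctilt z : cmeasurable (ctilt z).
Proof.
apply: cmeasurable_cexp; apply: cmeasurableM; first exact: cmeasurable_cst.
exact: cmeasurable_affine.
Qed.

(** Completing the square in the product of the two exponentials. *)
Lemma exp_ctilt z (v x : R) : (expR (v * x - v ^+ 2 * t / 2))%:C%C * ctilt z x =
  let w := v%:C%C + (t^-1)%:C%C * z in
  cexp (v%:C%C * z) * cexp (w * x%:C%C - w ^+ 2 * (t / 2)%:C%C).
Proof.
rewrite /ctilt -cexp_real -!cexpD/= half_complex; congr cexp.
case: z => a b; apply/eqP; rewrite eq_complex !expr2/=.
by apply/andP; split; apply/eqP; field; rewrite gt_eqF.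
Qed.

Lemma cintegral_exp_ctilt z (v : R) :
  cintegrable gauss (fun x => (expR (v * x - v ^+ 2 * t / 2))%:C%C * ctilt z x) /\
  cintegral gauss (fun x => (expR (v * x - v ^+ 2 * t / 2))%:C%C * ctilt z x) =
  cexp (v%:C%C * z).
Proof.
have [i1 i2] := cintegral_cexp_quad (v%:C%C + (t^-1)%:C%C * z).
have -> := funext (exp_ctilt z v).
split; first exact: cintegrableZl.
by rewrite cintegralZl// i2 mulr1.
Qed.

Let hcoef_ctilt_dom z (v x : R) n :
  `|v ^+ n * hcoef t x n| * normc (ctilt z x) <= 2^-1 ^+ n *
  (expR ((4 * t + 2 * t) * v ^+ 2) * expR (- (Re (z ^+ 2) / (2 * t))) *
   expR (Re z / t * x + (4 * t)^-1 * x ^+ 2)).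
Proof.
rewrite normc_ctilt; apply: (le_trans (ler_wpM2r _ (herm_dom v x n))).
  by rewrite mulr_ge0 ?expR_ge0.
rewrite mul0r add0r [expR (Re z / t * x + _)]expRD.
by rewrite le_eqVlt; apply/orP; left; apply/eqP; ring.
Qed.

(** Expand [cintegral_exp_ctilt] in powers of [v] on both sides and compare the
    coefficients. *)
Lemma cintegral_hcoef_ctilt z n :
  cintegrable gauss (fun x => (hcoef t x n)%:C%C * ctilt z x) /\
  cintegral gauss (fun x => (hcoef t x n)%:C%C * ctilt z x) = z ^+ n / n`!%:R.
Proof.
have ih k : cintegrable gauss (fun x => (hcoef t x k)%:C%C * ctilt z x).
  apply: (cintegrable_le (G := fun x => 2^-1 ^+ k *
    (expR ((4 * t + 2 * t) * 1 ^+ 2) * expR (- (Re (z ^+ 2) / (2 * t)))) *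
     expR (Re z / t * x + (4 * t)^-1 * x ^+ 2))).
  - apply: cmeasurableM; last exact: cmeasurable_ctilt.
    by apply: cmeasurable_real; exact: measurable_hcoef.
  - exact: integrable_gauss_sqr.
  - move=> x; rewrite Normc.normcM normcR -mulrA.
    by have := hcoef_ctilt_dom z 1 x k; rewrite expr1n mul1r.
split => //.
have E b : (fun n => cpart b (cintegral gauss (fun x => (hcoef t x n)%:C%C * ctilt z x)))
    = (fun n => cpart b (z ^+ n) / n`!%:R).
  apply: (@power_series_unique _ _ _ (fun v => cpart b (cexp (v%:C%C * z)))) => v.
    have [i1 i2] := cintegral_exp_ctilt z v; rewrite -i2 cpart_cintegral.
    have -> : series (fun n => v ^+ n * cpart b (cintegral gauss
        (fun x => (hcoef t x n)%:C%C * ctilt z x))) =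
      series (fun n => \int[gauss]_x (v ^+ n * (hcoef t x n * cpart b (ctilt z x)))).
      congr series; apply/funext => k; rewrite cpart_cintegral -RintegralZl//.
        by apply: eq_Rintegral => x _; rewrite cpartZ.
      exact: integrable_cpart.
    apply: (@cvg_series_Rintegral _ _ _ gauss
      (fun n x => v ^+ n * (hcoef t x n * cpart b (ctilt z x)))
      (fun x => cpart b ((expR (v * x - v ^+ 2 * t / 2))%:C%C * ctilt z x))
      (fun x => expR ((4 * t + 2 * t) * v ^+ 2) *
        expR (- (Re (z ^+ 2) / (2 * t))) *
        expR (Re z / t * x + (4 * t)^-1 * x ^+ 2))).
    + move=> k; apply: measurable_funM => //; apply: measurable_funM.
        exact: measurable_hcoef.
      by apply: cmeasurable_cpart; exact: cmeasurable_ctilt.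
    + apply: cmeasurable_cpart; apply: cmeasurableM; last exact: cmeasurable_ctilt.
      apply: cmeasurable_real.
      by apply: measurableT_comp => //; exact: affine_measurable.
    + exact: integrable_gauss_sqr.
    + move=> k x; apply: le_trans (hcoef_ctilt_dom z v x k).
      by rewrite mulrA normrM ler_wpM2l// ler_norm_cpart.
    + move=> x; rewrite cpartZ.
      have -> : series (fun n => v ^+ n * (hcoef t x n * cpart b (ctilt z x))) =
          (fun k => series (fun n => v ^+ n * hcoef t x n) k * cpart b (ctilt z x)).
        apply/funext => k; rewrite /series/= mulr_suml.
        by apply: eq_bigr => i _; rewrite mulrA.
      by apply: cvgM; [exact: hermite_generating_hcoef|exact: cvg_cst].
  have := @hermite_generating_cpart R 0 1 (v%:C%C * z) b.
  rewrite mul0r mulr0 subr0 mulr1.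
  by under eq_fun do rewrite exprMn -rmorphXn cpartZ hcoef01 -mulrA.
rewrite [LHS]cpart_eta (congr1 (fun f => f n) (E true)) (congr1 (fun f => f n) (E false)).
rewrite -[n`!%:R in RHS](rmorph_nat (real_complex R)) -fmorphV.
by case: (z ^+ n) => a b; apply/eqP; rewrite eq_complex/= !mulr0 ?subr0 ?add0r !eqxx.
Qed.

End gaussian_integrals.

(** * Hermite polynomials and Gaussian vectors *)

Section multivariate.
Variables (R : realType) (d : nat).
Implicit Types (v x l : d.-tuple R) (z : 'rV[R[i]]_d) (a : d.-tuple nat).
Local Notation normc := (@Normc.normc R).

(** The Hermite polynomial divided by the factorial of its index, which is the
    coefficient of the generating function. *)
Definition mhcoef a (t : R) x : R := \prod_(i < d) hcoef t (tnth x i) (tnth a i).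

Lemma mhermiteE a t x : mhermite a t x = (mfact a)%:R * mhcoef a t x.
Proof.
rewrite /mhermite /mfact /mhcoef natr_prod -big_split/=.
by apply: eq_bigr => i _; rewrite hermiteE.
Qed.

Lemma mfact_neq0 a : (mfact a)%:R != 0 :> R.
Proof.
rewrite pnatr_eq0 -lt0n /mfact; apply: prodn_gt0 => i; exact: fact_gt0.
Qed.

Lemma dotp_ge0 x : 0 <= dotp x x.
Proof. by apply: sumr_ge0 => i _; rewrite -expr2 sqr_ge0. Qed.

Lemma expR_dotp_sqr (c : R) l x : expR (dotp l x + c * dotp x x) =
  \prod_(i < d) expR (tnth l i * tnth x i + c * tnth x i ^+ 2).
Proof. by rewrite -expR_sum big_split/= -mulr_sumr. Qed.

Lemma stoch_expE v t x : stoch_exp v t x =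
  \prod_(i < d) expR (tnth v i * tnth x i - tnth v i ^+ 2 * t / 2).
Proof.
rewrite /stoch_exp -expR_sum; congr expR; rewrite sumrB -!mulr_suml.
by congr (_ - _ * _ / _); apply: eq_bigr.
Qed.

Definition mtilt (t : R) z x : R[i] :=
  cexp ((t^-1)%:C%C * (cdotp x z - csqr z / 2)).

Lemma mtiltE t z x : mtilt t z x = \prod_(i < d) ctilt t (z 0 i) (tnth x i).
Proof.
rewrite /mtilt /ctilt -cexp_sum; congr cexp.
rewrite -mulr_sumr; congr (_ * _); rewrite sumrB -mulr_suml.
by congr (_ - _); apply: eq_bigr => i _; rewrite mulrC.
Qed.

(** The coordinatewise Young estimates multiply. *)
Lemma mhcoef_gauss v x a t e : 0 <= t -> 0 < e ->
  `|mpow v a * mhcoef a t x| <=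
  mwt R a * (expR (e * dotp x x) * expR ((e^-1 + 2 * t) * dotp v v)).
Proof.
move=> t0 e0; rewrite /mpow /mhcoef -big_split/= normr_prod.
rewrite /mwt !mulr_sumr !expR_sum -!big_split/=.
apply: ler_prod => i _; rewrite normr_ge0/=.
have := hcoef_gauss (tnth x i) (tnth v i) (tnth a i) t0 e0.
by rewrite -!expr2.
Qed.

(** The sum over a box is a product of partial sums of the one-dimensional
    generating functions, so that the box sums converge to the stochastic
    exponential; [dist_box_limit] passes to an arbitrary partial sum. *)
Lemma stoch_exp_expansion v x t e F : 0 <= t -> 0 < e -> uniq F ->
  `|stoch_exp v t x - \sum_(a <- F) mpow v a * mhcoef a t x| <=
  gap R F * (expR (e * dotp x x) * expR ((e^-1 + 2 * t) * dotp v v)).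
Proof.
move=> t0 e0 uF; rewrite [leRHS]mulrC; apply: dist_box_limit => // [a|].
  by rewrite [leRHS]mulrC mhcoef_gauss.
have -> : (fun N => \sum_(a <- box d N) mpow v a * mhcoef a t x) = (fun N =>
    \prod_(i < d) series (fun n => tnth v i ^+ n * hcoef t (tnth x i) n) N).
  apply/funext => N; rewrite /series/=.
  under [RHS]eq_bigr do rewrite big_mkord.
  rewrite -(sum_box (fun i n => tnth v i ^+ n * hcoef t (tnth x i) n)).
  by apply: eq_bigr => a _; rewrite /mpow /mhcoef -big_split.
rewrite stoch_expE; apply: (@cvg_big R 'I_d (@GRing.mul R) 1 xpredT (@mul_continuous R)) => i _.
exact: hermite_generating_hcoef.
Qed.

End multivariate.

Lemma measurable_dotp dT (T : measurableType dT) (R : realType) d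
    (f g : T -> d.-tuple R) :
  measurable_fun setT f -> measurable_fun setT g ->
  measurable_fun setT (fun w => dotp (f w) (g w)).
Proof.
move=> mf mg; apply: measurable_sum => i; apply: measurable_funM.
  exact: (measurableT_comp (measurable_tnth i) mf).
exact: (measurableT_comp (measurable_tnth i) mg).
Qed.

Section gaussian_vectors.
Context dO (Omega : measurableType dO) (R : realType) (P : probability Omega R).
Variables (d : nat) (Y : Omega -> d.-tuple R) (t : R).
Hypotheses (t0 : 0 < t) (mY : measurable_fun setT Y).
Hypothesis law : forall B : 'I_d -> set R, (forall i, measurable (B i)) ->
  P [set w | forall i, B i (tnth (Y w) i)] = (\prod_(i < d) gauss t (B i))%E.
Implicit Types (v l : d.-tuple R) (z : 'rV[R[i]]_d) (a : d.-tuple nat).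
Local Notation normc := (@Normc.normc R).

Let mYi i : measurable_fun setT (fun w => tnth (Y w) i).
Proof.
exact: (measurableT_comp (measurable_tnth i) mY).
Qed.

Let gaussoo : (gauss t setT < +oo)%E.
Proof. by rewrite gauss_setT ltry. Qed.

(** Completing the square in every coordinate; the choice of [s] sets the
    coefficient of the square of the norm. *)
Lemma expectation_exp_quad (s : R) l : 0 < s ->
  (\int[P]_w (expR (dotp l (Y w) + (t^-1 - s ^- 2) / 2 * dotp (Y w) (Y w)))%:E =
  ((s / Num.sqrt t) ^+ d * expR (dotp l l * s ^+ 2 / 2))%:E)%E.
Proof.
move=> s0; under eq_integral do rewrite expR_dotp_sqr.
rewrite (ge0_integral_prod gaussoo mYi law (f := fun i x =>
  expR (tnth l i * x + (t^-1 - s ^- 2) / 2 * x ^+ 2))).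
- under eq_bigr do rewrite integral_gauss_exp//.
  have -> : (s / Num.sqrt t) ^+ d = \prod_(i < d) (s / Num.sqrt t).
    by rewrite prodr_const card_ord.
  rewrite /dotp !mulr_suml expR_sum -big_split/=.
  elim/big_rec2: _ => // i y1 y2 _ ->; rewrite -EFinM.
  by rewrite -expr2.
- move=> i; apply: measurableT_comp => //; apply: measurable_funD.
    exact: measurable_funM.
  by apply: measurable_funM => //; exact: measurable_funX.
- by move=> i y; exact: expR_ge0.
- by move=> i; rewrite integral_gauss_exp// ltry.
Qed.

Lemma expectation_exp_sqr l :
  (\int[P]_w (expR (dotp l (Y w) + (4 * t)^-1 * dotp (Y w) (Y w)))%:E =
  (Num.sqrt 2 ^+ d * expR (dotp l l * t))%:E)%E.
Proof.
have s0 : 0 < Num.sqrt (2 * t) by rewrite sqrtr_gt0 mulr_gt0.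
have := expectation_exp_quad l s0; rewrite sqr_sqrtr ?mulr_ge0 ?ltW//.
have -> : dotp l l * (2 * t) / 2 = dotp l l * t by field.
rewrite sqrtrM// mulfK ?gt_eqF ?sqrtr_gt0//.
by have -> : (t^-1 - (2 * t)^-1) / 2 = (4 * t)^-1 by field; rewrite gt_eqF.
Qed.

Lemma integrable_exp_sqr (k : R) l : P.-integrable setT (EFin \o (fun w =>
  k * expR (dotp l (Y w) + (4 * t)^-1 * dotp (Y w) (Y w)))).
Proof.
rewrite (_ : _ \o _ = (fun w =>
  k%:E * (expR (dotp l (Y w) + (4 * t)^-1 * dotp (Y w) (Y w)))%:E)%E)//.
apply: integrableZl => //; apply/integrableP; split.
  apply/measurable_EFinP; apply: measurableT_comp => //.
  apply: measurable_funD; first by apply: measurable_dotp => //; exact: measurable_cst.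
  by apply: measurable_funM => //; exact: measurable_dotp.
under eq_integral do rewrite /= ger0_norm ?expR_ge0//.
by rewrite expectation_exp_sqr ltry.
Qed.

Lemma expectation_stoch_exp_tilt v z :
  cintegrable P (fun w => (stoch_exp v t (Y w))%:C%C * mtilt t z (Y w)) /\
  cintegral P (fun w => (stoch_exp v t (Y w))%:C%C * mtilt t z (Y w)) =
  cexp (cdotp v z).
Proof.
have [i1 i2] := cintegral_prod gaussoo mYi law
  (fun i => (cintegral_exp_ctilt t0 (z 0 i) (tnth v i)).1).
have -> : (fun w => (stoch_exp v t (Y w))%:C%C * mtilt t z (Y w)) =
   (fun w => \prod_(i < d)
     ((expR (tnth v i * tnth (Y w) i - tnth v i ^+ 2 * t / 2))%:C%C *
      ctilt t (z 0 i) (tnth (Y w) i))).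
  apply/funext => w; rewrite stoch_expE mtiltE rmorph_prod -big_split.
  by [].
split => //; rewrite i2 /cdotp cexp_sum; apply: eq_bigr => i _.
exact: (cintegral_exp_ctilt t0 (z 0 i) (tnth v i)).2.
Qed.

Lemma expectation_mhcoef_tilt a z :
  cintegrable P (fun w => (mhcoef a t (Y w))%:C%C * mtilt t z (Y w)) /\
  cintegral P (fun w => (mhcoef a t (Y w))%:C%C * mtilt t z (Y w)) =
  cmpow z a / (mfact a)%:R.
Proof.
have [i1 i2] := cintegral_prod gaussoo mYi law
  (fun i => (cintegral_hcoef_ctilt t0 (z 0 i) (tnth a i)).1).
have -> : (fun w => (mhcoef a t (Y w))%:C%C * mtilt t z (Y w)) =
   (fun w => \prod_(i < d) ((hcoef t (tnth (Y w) i) (tnth a i))%:C%C *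
      ctilt t (z 0 i) (tnth (Y w) i))).
  by apply/funext => w; rewrite mtiltE rmorph_prod -big_split.
split => //; rewrite i2 /cmpow /mfact natr_prod -prodfV -big_split.
apply: eq_bigr => i _.
exact: (cintegral_hcoef_ctilt t0 (z 0 i) (tnth a i)).2.
Qed.

Lemma normc_mtilt z x : normc (mtilt t z x) =
  expR (- (complex.Re (csqr z) / (2 * t))) *
  expR (dotp [tuple complex.Re (z 0 i) / t | i < d] x).
Proof.
rewrite mtiltE normc_prod; under eq_bigr do rewrite normc_ctilt//.
rewrite /csqr raddf_sum/= mulr_suml -sumrN /dotp !expR_sum -big_split/=.
by apply: eq_bigr => i _; rewrite tnth_mktuple.
Qed.

End gaussian_vectors.

(** * Convergence in L^p and integration against charges *)

Section Lp_norms.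
Context dO (Omega : measurableType dO) (R : realType) (P : probability Omega R).
Implicit Types (p c : R) (f G : Omega -> R).

Lemma Lp_normE p f :
  Lp_norm P p f = ((\int[P]_w (`|f w| `^ p)%:E) `^ p^-1)%E.
Proof. by rewrite /Lp_norm unlock. Qed.

Lemma measurable_powR_norm p f : measurable_fun setT f ->
  measurable_fun setT (fun w => (`|f w| `^ p)%:E).
Proof.
move=> mf; apply/measurable_EFinP.
apply: (measurableT_comp (f := @powR R ^~ p)); first exact: measurable_powR.
exact: measurableT_comp.
Qed.

Lemma le_poweR p (x y : \bar R) :
  0 <= p -> (0 <= x)%E -> (x <= y)%E -> (x `^ p <= y `^ p)%E.
Proof.
move=> p0 x0 xy; have y0 := le_trans x0 xy.
by apply: (gt0_ler_poweR p0) => //; rewrite in_itv/= leey andbT.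
Qed.

Lemma Lp_norm_le p c f G : 0 < p -> 0 <= c -> measurable_fun setT f ->
    measurable_fun setT G -> (forall w, 0 <= G w) ->
    {ae P, forall w, `|f w| <= c * G w} ->
  (Lp_norm P p f <= c%:E * Lp_norm P p G)%E.
Proof.
move=> p0 c0 mf mG G0 fG; rewrite !Lp_normE.
have I0 : (0 <= \int[P]_w (`|G w| `^ p)%:E)%E.
  by apply: integral_ge0 => w _; rewrite lee_fin powR_ge0.
have -> : (c%:E * (\int[P]_w (`|G w| `^ p)%:E) `^ p^-1 =
    (\int[P]_w (`|c * G w| `^ p)%:E) `^ p^-1)%E.
  have -> : (\int[P]_w (`|c * G w| `^ p)%:E =
      (c `^ p)%:E * \int[P]_w (`|G w| `^ p)%:E)%E.
    rewrite -ge0_integralZl ?lee_fin ?powR_ge0//; last exact: measurable_powR_norm.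
    apply: eq_integral => w _; rewrite -EFinM normrM powRM//.
    by rewrite (ger0_norm c0).
  rewrite poweRM ?lee_fin ?powR_ge0//.
  by rewrite poweR_EFin -powRrM mulfV ?gt_eqF// powRr1.
apply: le_poweR.
- by rewrite invr_ge0 ltW.
- by apply: integral_ge0 => w _; rewrite lee_fin powR_ge0.
apply: ae_ge0_le_integral => //.
- exact: measurable_powR_norm.
- by apply: measurable_powR_norm; exact: measurable_funM.
apply: filterS fG => w fGw _; rewrite lee_fin ge0_ler_powR ?nnegrE//.
  exact: ltW.
by rewrite (le_trans fGw)// ler_norm.
Qed.

Lemma Lp_norm_ge0 p f : (0 <= Lp_norm P p f)%E.
Proof. exact: Lnorm_ge0. Qed.

(** The norm of [G] factors out of every estimate, so that only the weights are
    summed and only the gaps have to tend to 0. *)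
Lemma Lp_abs_cvg_dominated d p (V : d.-tuple nat -> Omega -> R) f G :
    0 < p -> (forall a, measurable_fun setT (V a)) -> measurable_fun setT f ->
    measurable_fun setT G -> (forall w, 0 <= G w) -> (Lp_norm P p G < +oo)%E ->
    (forall a w, `|V a w| <= mwt R a * G w) ->
    (forall F, uniq F ->
      {ae P, forall w, `|f w - \sum_(a <- F) V a w| <= gap R F * G w}) ->
  Lp_abs_cvg P p V f.
Proof.
move=> p0 mV mf mG G0 Goo VG fG.
have Gfin : Lp_norm P p G = (fine (Lp_norm P p G))%:E.
  by rewrite fineK// ge0_fin_numE// Lp_norm_ge0.
have g0 : 0 <= fine (Lp_norm P p G) by rewrite fine_ge0// Lp_norm_ge0.
split.
  apply: (esum_mwt_lty g0) => a; rewrite Lp_norm_ge0/= mulrC EFinM -Gfin.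
  apply: Lp_norm_le => //; first exact: mwt_ge0.
  by apply: aeW => w; exact: VG.
move=> e be; rewrite /Lp_series_cvg.
have gc : ((gap R (prefix_seq e n) * fine (Lp_norm P p G))%:E @[n --> \oo] --> 0)%E.
  apply: cvg_EFin; first exact: nearW.
  rewrite -(mul0r (fine (Lp_norm P p G))); apply: cvgM; last exact: cvg_cst.
  exact: gap_prefix_cvg.
apply: (squeeze_cvge _ (cvg_cst _) gc); apply: nearW => n.
rewrite Lp_norm_ge0/= EFinM -Gfin.
have ue : uniq (prefix_seq e n) := uniq_prefix n (bij_inj be).
apply: Lp_norm_le => //; first exact: gap_ge0.
  by apply: measurable_funB => //; exact: measurable_sum.
apply: filterS (fG _ ue) => w; rewrite distrC.
by rewrite -(sum_prefix (fun a => V a w)).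
Qed.

End Lp_norms.

Section charge_integrals.
Context d (T : measurableType d) (R : realType) (mu : {charge set T -> \bar R}).
Implicit Types (f g G : T -> R).
Local Notation tv := (Defs.total_variation mu).
Local Notation pos := (jordan_pos (hahn_pos_neg mu)).
Local Notation neg := (jordan_neg (hahn_pos_neg mu)).

Lemma ge0_integral_total_variation (f : T -> \bar R) :
  measurable_fun setT f -> (forall x, 0 <= f x)%E ->
  (\int[tv]_x f x = \int[pos]_x f x + \int[neg]_x f x)%E.
Proof.
move=> mf f0; rewrite -ge0_integral_measure_add//.
apply: eq_measure_integral => A mA _.
by rewrite /measure_add/= /msum !big_ord_recl big_ord0/= adde0.
Qed.

Lemma charge_integrable_parts f : charge_integrable mu f ->
  pos.-integrable setT (EFin \o f) /\ neg.-integrable setT (EFin \o f).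
Proof.
move=> /integrableP[mf]; rewrite ge0_integral_total_variation//; last first.
  exact: measurableT_comp.
move=> foo; split; apply/integrableP; split => //; apply: le_lt_trans foo.
  by rewrite leeDl// integral_ge0.
by rewrite leeDr// integral_ge0.
Qed.

Lemma charge_integralZl (c : R) f : charge_integrable mu f ->
  charge_integral mu (fun x => c * f x) = c * charge_integral mu f.
Proof.
move=> /charge_integrable_parts[fp fn].
by rewrite /charge_integral !RintegralZl// mulrBr.
Qed.

Lemma charge_integrableZl (c : R) f : charge_integrable mu f ->
  charge_integrable mu (fun x => c * f x).
Proof. by move=> cf; apply: eq_integrable (integrableZl measurableT c cf). Qed.

Lemma charge_integralB f g : charge_integrable mu f -> charge_integrable mu g ->
  charge_integral mu (fun x => f x - g x) =
  charge_integral mu f - charge_integral mu g.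
Proof.
move=> /charge_integrable_parts[fp fn] /charge_integrable_parts[gp gn].
by rewrite /charge_integral !RintegralB//; ring.
Qed.

Lemma charge_integrableB f g : charge_integrable mu f -> charge_integrable mu g ->
  charge_integrable mu (fun x => f x - g x).
Proof.
by move=> cf cg; apply: eq_integrable (integrableB measurableT cf cg).
Qed.

Lemma charge_integral_sum (I : Type) (r : seq I) (f : I -> T -> R) :
  (forall i, charge_integrable mu (f i)) ->
  charge_integrable mu (fun x => \sum_(i <- r) f i x) /\
  charge_integral mu (fun x => \sum_(i <- r) f i x) =
  \sum_(i <- r) charge_integral mu (f i).
Proof.
move=> cf; elim: r => [|i r [IH1 IH2]].
  rewrite big_nil (_ : (fun _ => _) = cst 0); last first.
    by apply/funext => x; rewrite big_nil.
  split; first exact: integrable0.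
  by rewrite /charge_integral /Rintegral !integral0 subrr.
rewrite big_cons (_ : (fun _ => _) = (fun x => f i x + \sum_(j <- r) f j x)); last first.
  by apply/funext => x; rewrite big_cons.
split; first by apply: eq_integrable (integrableD measurableT (cf i) IH1).
have [ip in_] := charge_integrable_parts (cf i).
have [sp sn] := charge_integrable_parts IH1.
by rewrite -IH2 /charge_integral !RintegralD//; ring.
Qed.

Lemma charge_integrable_le f G : measurable_fun setT f ->
  charge_integrable mu G -> (forall x, `|f x| <= G x) -> charge_integrable mu f.
Proof.
move=> mf cG fG; apply: le_integrable cG => //; first exact/measurable_EFinP.
by move=> x _; rewrite /= lee_fin (le_trans (fG x))// ler_norm.
Qed.

Lemma normr_charge_integral_le f G : charge_integrable mu f ->
  charge_integrable mu G -> (forall x, `|f x| <= G x) ->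
  `|charge_integral mu f| <= \int[tv]_x G x.
Proof.
move=> cf cG fG; have [fp fn] := charge_integrable_parts cf.
have [Gp Gn] := charge_integrable_parts cG.
have G0 x : 0 <= G x by exact: le_trans (fG x).
have mG : measurable_fun setT (EFin \o G) by exact: measurable_int cG.
have -> : \int[tv]_x G x = \int[pos]_x G x + \int[neg]_x G x.
  rewrite /Rintegral ge0_integral_total_variation//.
  by rewrite fineD//; exact: (integrable_fin_num measurableT).
rewrite /charge_integral (le_trans (ler_normB _ _))// lerD//.
  apply: le_trans (le_normr_Rintegral _ _) _ => //.
  by apply: le_Rintegral => //; exact: (integrable_norm fp).
apply: le_trans (le_normr_Rintegral _ _) _ => //.
by apply: le_Rintegral => //; exact: (integrable_norm fn).
Qed.

End charge_integrals.

(** * Expansion under quadratic exponential moments *)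

Section brownian_marginals.
Context dO (Omega : measurableType dO) (R : realType) (P : probability Omega R).
Variables (d : nat) (X : R -> Omega -> d.-tuple R).
Hypothesis BX : brownian_motion P X.

(** The increment from time 0 agrees almost surely with the position. *)
Lemma brownian_marginal (t : R) : 0 < t ->
  forall B : 'I_d -> set R, (forall i, measurable (B i)) ->
  P [set w | forall i, B i (tnth (X t w) i)] = (\prod_(i < d) gauss t (B i))%E.
Proof.
move=> t0 B mB; have := bm_gaussian BX (lexx 0) t0 mB; rewrite subr0 => <-.
have mset (f : Omega -> d.-tuple R) : measurable_fun setT f ->
    measurable [set w | forall i, B i (tnth (f w) i)].
  move=> mf; have -> : [set w | forall i, B i (tnth (f w) i)] =
      \bigcap_(i in setT) ((fun w => tnth (f w) i) @^-1` B i).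
    by apply/seteqP; split => w /=; [move=> h i _|move=> h i]; exact: h.
  apply: fin_bigcap_measurable => [|i _]; first exact: finite_finset.
  rewrite -[_ @^-1` _]setTI.
  exact: (measurableT_comp (measurable_tnth i) mf).
have m1 := mset _ (bm_measurable BX (ltW t0)).
have m2 : measurable [set w | forall i, B i (tnth (increment X 0 t w) i)].
  apply: mset; apply/measurable_fun_tnthP => i.
  rewrite (_ : _ \o _ = fun w => tnth (X t w) i - tnth (X 0 w) i); last first.
    by apply/funext => w /=; rewrite tnth_mktuple.
  apply: measurable_funB.
    exact: (measurableT_comp (measurable_tnth i) (bm_measurable BX (ltW t0))).
  exact: (measurableT_comp (measurable_tnth i) (bm_measurable BX (lexx 0))).
transitivity (\int[P]_w (\1_[set w | forall i, B i (tnth (X t w) i)] w)%:E)%E.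
  by rewrite integral_indic// setIT.
transitivity (\int[P]_w
    (\1_[set w | forall i, B i (tnth (increment X 0 t w) i)] w)%:E)%E; last first.
  by rewrite integral_indic// setIT.
apply: ae_eq_integral => //; try by apply/measurable_EFinP; exact: measurable_indic.
apply: filterS (bm_start BX) => w X0 _; congr EFin; rewrite !indicE.
have E i : tnth (increment X 0 t w) i = tnth (X t w) i.
  by rewrite tnth_mktuple X0 tnth_mktuple subr0.
by congr (nat_of_bool _)%:R; apply/idP/idP; rewrite !inE /= => h i;
  [rewrite E|rewrite -E]; exact: h.
Qed.

(** The moment of order [p] only multiplies [e] by [p], and the exponential is
    integrable as long as [p * e] is at most [(4 * t)^-1]. *)
Lemma brownian_exp_sqr_Lp (t p : R) : 0 <= t -> 0 < p -> exists2 e : R, 0 < e &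
  (Lp_norm P p (fun w => expR (e * dotp (X t w) (X t w))) < +oo)%E.
Proof.
move=> t0 p0.
suff [e e0 H] : exists2 e : R, 0 < e &
    (\int[P]_w (expR (p * e * dotp (X t w) (X t w)))%:E < +oo)%E.
  exists e => //; rewrite Lp_normE; apply: poweR_lty.
  under eq_integral do rewrite ger0_norm ?expR_ge0// -expRM mulrC mulrA.
  exact: H.
move: t0; rewrite le_eqVlt => /predU1P[<-|t0].
  exists 1 => //; have mX0 := bm_measurable BX (lexx 0).
  rewrite (_ : integral _ _ _ = \int[P]_w 1%:E)%E.
    rewrite integral_cst// mul1e.
    exact: le_lt_trans (probability_le1 P measurableT) (ltry 1).
  apply: ae_eq_integral => //.
    apply/measurable_EFinP; apply: measurableT_comp => //.
    by apply: measurable_funM => //; exact: measurable_dotp.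
  apply: filterS (bm_start BX) => w -> _.
  rewrite /dotp big1 ?mulr0 ?expR0// => i _.
  by rewrite tnth_mktuple mul0r.
exists ((4 * t)^-1 / p); first by rewrite divr_gt0// invr_gt0 mulr_gt0.
have := expectation_exp_sqr t0 (bm_measurable BX (ltW t0)) (brownian_marginal t0)
  [tuple 0 | i < d].
rewrite mulrCA divff ?gt_eqF// mulr1.
rewrite (_ : integral _ _ _ = \int[P]_w
  (expR ((4 * t)^-1 * dotp (X t w) (X t w)))%:E)%E; first by move=> ->; rewrite ltry.
apply: eq_integral => w _; rewrite [dotp [tuple _ | _ < _] _]big1 ?add0r//.
by move=> i _; rewrite tnth_mktuple mul0r.
Qed.

End brownian_marginals.

Section quadratic_moments.
Context (R : realType) (d : nat) (mu : {charge set (d.-tuple R) -> \bar R}).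
Hypothesis qm : quad_exp_moments mu.
Local Notation tv := (Defs.total_variation mu).
Implicit Types (v x : d.-tuple R) (a : d.-tuple nat).

Lemma measurable_mpow a : measurable_fun setT (fun v : d.-tuple R => mpow v a).
Proof.
apply: measurable_prod => i _; apply: measurable_funX.
exact: measurable_tnth.
Qed.

Lemma measurable_stoch_exp (t : R) x :
  measurable_fun setT (fun v : d.-tuple R => stoch_exp v t x).
Proof.
apply: measurableT_comp => //; apply: measurable_funB.
  by apply: measurable_dotp => //; exact: measurable_cst.
by apply: measurable_funM => //; apply: measurable_funM => //; exact: measurable_dotp.
Qed.

Lemma charge_integrable_quad (k l : R) : 0 < l ->
  charge_integrable mu (fun v => k * expR (l * dotp v v)).
Proof.
move=> l0; apply: charge_integrableZl; apply/integrableP; split.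
  apply/measurable_EFinP; apply: measurableT_comp => //.
  by apply: measurable_funM => //; exact: measurable_dotp.
by under eq_integral do rewrite /= ger0_norm ?expR_ge0//; exact: qm.
Qed.

(** At time 0 and at the point with all coordinates 1 the Hermite coefficient is
    the inverse of the factorial, and [mhcoef_gauss] bounds the monomial. *)
Lemma charge_integrable_mpow a : charge_integrable mu (fun v => mpow v a).
Proof.
apply: (charge_integrable_le (measurable_mpow a) (G := fun v =>
  ((mfact a)%:R * (mwt R a * expR (1 * dotp [tuple 1 | i < d] [tuple 1 | i < d]))) *
  expR ((1^-1 + 2 * 0) * dotp v v))).
  by apply: charge_integrable_quad; rewrite mulr0 addr0 invr1.
move=> v; have := mhcoef_gauss v [tuple 1 | i < d] a (lexx 0) ltr01.
have -> : mhcoef a 0 [tuple 1 | i < d] = (mfact a)%:R^-1 :> R.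
  rewrite /mhcoef /mfact natr_prod -prodfV; apply: eq_bigr => i _.
  by rewrite tnth_mktuple hcoef01.
rewrite normrM normfV [`|_%:R|]ger0_norm// ler_pdivrMr; last first.
  by rewrite lt0r mfact_neq0/=.
by move=> h; apply: le_trans h _; rewrite le_eqVlt; apply/orP; left; apply/eqP; ring.
Qed.

Lemma charge_integrable_stoch_exp (t : R) x : 0 <= t ->
  charge_integrable mu (fun v => stoch_exp v t x).
Proof.
move=> t0; have := @stoch_exp_expansion R d _ x t 1 [::] t0 ltr01 isT => h.
apply: (charge_integrable_le (measurable_stoch_exp t x) (G := fun v =>
  (gap R (Nil (d.-tuple nat)) * expR (1 * dotp x x)) *
  expR ((1^-1 + 2 * t) * dotp v v))).
  by apply: charge_integrable_quad; rewrite ltr_wpDr// ?invr_gt0// mulr_ge0.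
by move=> v; have := h v; rewrite big_nil subr0 mulrA.
Qed.

Let moment a := charge_integral mu (fun v => mpow v a).
Let K (t e : R) := \int[tv]_v expR ((e^-1 + 2 * t) * dotp v v).

Let quad0 (t e : R) : 0 <= t -> 0 < e -> 0 < e^-1 + 2 * t.
Proof. by move=> t0 e0; rewrite ltr_wpDr ?invr_gt0// mulr_ge0. Qed.

Let Kint (t e : R) : 0 <= t -> 0 < e ->
  charge_integrable mu (fun v => expR ((e^-1 + 2 * t) * dotp v v)).
Proof.
move=> t0 e0; have := charge_integrable_quad 1 (quad0 t0 e0).
by rewrite (_ : (fun v => 1 * _) = fun v => expR ((e^-1 + 2 * t) * dotp v v))//;
  apply/funext => v; rewrite mul1r.
Qed.

Let scaled_bound (f : d.-tuple R -> R) (c t e : R) : 0 <= t -> 0 < e ->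
    charge_integrable mu f ->
    (forall v, `|f v| <= c * expR ((e^-1 + 2 * t) * dotp v v)) ->
  `|charge_integral mu f| <= c * K t e.
Proof.
move=> t0 e0 cf fc.
have := normr_charge_integral_le cf (charge_integrable_quad c (quad0 t0 e0)) fc.
by rewrite RintegralZl//; exact: Kint.
Qed.

Lemma moment_mhcoef_le a x (t e : R) : 0 <= t -> 0 < e ->
  `|moment a * mhcoef a t x| <= mwt R a * (K t e * expR (e * dotp x x)).
Proof.
move=> t0 e0; have cm := charge_integrable_mpow a.
rewrite mulrC -charge_integralZl// [X in _ <= _ * X]mulrC mulrA.
apply: scaled_bound => //; first exact: charge_integrableZl.
by move=> v; rewrite mulrC -mulrA mhcoef_gauss.
Qed.

(** Integrating the expansion of the stochastic exponential against the charge
    keeps the error estimate, so that no limit theorem is involved. *)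
Lemma widder_expansion_le x (t e : R) F : 0 <= t -> 0 < e -> uniq F ->
  `|charge_integral mu (fun v => stoch_exp v t x) -
    \sum_(a <- F) moment a * mhcoef a t x| <=
  gap R F * (K t e * expR (e * dotp x x)).
Proof.
move=> t0 e0 uF.
have cm a : charge_integrable mu (fun v => mhcoef a t x * mpow v a).
  by apply: charge_integrableZl; exact: charge_integrable_mpow.
have [S1 S2] := charge_integral_sum F cm.
have -> : \sum_(a <- F) moment a * mhcoef a t x =
    charge_integral mu (fun v => \sum_(a <- F) mhcoef a t x * mpow v a).
  rewrite S2; apply: eq_bigr => a _.
  by rewrite charge_integralZl; [rewrite mulrC|exact: charge_integrable_mpow].
have cs := @charge_integrable_stoch_exp t x t0.
rewrite -charge_integralB// [X in _ <= _ * X]mulrC mulrA.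
apply: scaled_bound => //; first exact: charge_integrableB.
move=> v; rewrite -mulrA.
have -> : \sum_(a <- F) mhcoef a t x * mpow v a =
    \sum_(a <- F) mpow v a * mhcoef a t x by apply: eq_bigr => a _; rewrite mulrC.
exact: stoch_exp_expansion.
Qed.

End quadratic_moments.

(** The bounds [moment_mhcoef_le] and [widder_expansion_le] share the random factor
    [expR (e * dotp x x)], and [e] can be chosen so small that this factor belongs
    to [L^p]. *)
Lemma hermite_expansion_of_quadratic_moments (R : realType) (d : nat)
    (dO : measure_display) (Omega : measurableType dO) (P : probability Omega R)
    (X : R -> Omega -> d.-tuple R) (g : R -> d.-tuple R -> R)
    (mu : {charge set (d.-tuple R) -> \bar R}) :
    brownian_motion P X ->
    (forall t, 0 <= t -> measurable_fun setT (fun w => g t (X t w))) ->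
    widder_representation P X g mu -> quad_exp_moments mu ->
  exists b : d.-tuple nat -> R,
     (forall t, 0 <= t -> forall p, 1 <= p ->
        Lp_abs_cvg P p (fun a w => b a * mhermite a t (X t w))
          (fun w => g t (X t w))) /\
     (forall a, charge_integrable mu (fun v => mpow v a) /\
        b a = (mfact a)%:R^-1 * charge_integral mu (fun v => mpow v a)).
Proof.
move=> BX mg gmu qm.
exists (fun a => (mfact a)%:R^-1 * charge_integral mu (fun v => mpow v a)).
split; last by move=> a; split => //; exact: charge_integrable_mpow.
move=> t t0 p p1; have p0 : 0 < p := lt_le_trans ltr01 p1.
have [e e0 Ge] := brownian_exp_sqr_Lp BX t0 p0.
have mX := bm_measurable BX t0.
pose K := \int[Defs.total_variation mu]_v expR ((e^-1 + 2 * t) * dotp v v).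
have K0 : 0 <= K by apply: Rintegral_ge0 => v _; exact: expR_ge0.
have bE a w : (mfact a)%:R^-1 * charge_integral mu (fun v => mpow v a) *
    mhermite a t (X t w) =
    charge_integral mu (fun v => mpow v a) * mhcoef a t (X t w).
  by rewrite mhermiteE mulrA [_ * (mfact a)%:R]mulrAC mulVf ?mul1r ?mfact_neq0.
have mG : measurable_fun setT (fun w => expR (e * dotp (X t w) (X t w))).
  apply: measurableT_comp => //.
  by apply: measurable_funM => //; exact: measurable_dotp.
apply: (Lp_abs_cvg_dominated (G := fun w => K * expR (e * dotp (X t w) (X t w)))) => //.
- move=> a; under eq_fun do rewrite bE.
  apply: measurable_funM => //; apply: measurable_prod => i _.
  apply: (measurableT_comp (f := fun x : R => hcoef t x (tnth a i))).
    exact: measurable_hcoef.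
  exact: (measurableT_comp (measurable_tnth i) mX).
- exact: mg.
- exact: measurable_funM.
- by move=> w; rewrite mulr_ge0 ?expR_ge0.
- apply: le_lt_trans (Lp_norm_le (c := K) (G := fun w => expR (e * dotp (X t w) (X t w)))
    p0 K0 _ mG _ _) _.
  + exact: measurable_funM.
  + by move=> w; exact: expR_ge0.
  + by apply: aeW => w; rewrite ger0_norm// mulr_ge0 ?expR_ge0.
  + by rewrite lte_mul_pinfty// lee_fin.
- by move=> a w; rewrite bE; exact: moment_mhcoef_le.
- move=> F uF; apply: filterS (gmu t t0) => w ->.
  under eq_bigr do rewrite bE.
  exact: widder_expansion_le.
Qed.

(** * Growth of Hermite series that converge in L^1 *)

Section L1_limits.
Context dO (Omega : measurableType dO) (R : realType) (P : probability Omega R).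
Variables (d : nat) (V : d.-tuple nat -> Omega -> R) (f : Omega -> R).
Variable e : nat -> d.-tuple nat.
Hypotheses (be : bijective e) (mV : forall a, measurable_fun setT (V a)).
Hypotheses (mf : measurable_fun setT f) (Vf : Lp_series_cvg P 1 V e f).

Lemma Lp_norm1E (h : Omega -> R) : (Lp_norm P 1 h = \int[P]_w `|h w|%:E)%E.
Proof. by rewrite /Lp_norm Lnorm1. Qed.

Let D n w := \sum_(k < n) V (e k) w - f w.

Let mD n : measurable_fun setT (D n).
Proof. by apply: measurable_funB => //; exact: measurable_sum. Qed.

Let cD : (\int[P]_w `|D n w|%:E @[n --> \oo] --> 0)%E.
Proof. by move: Vf; rewrite /Lp_series_cvg; under eq_fun do rewrite Lp_norm1E. Qed.

Let mnorm (h : Omega -> R) : measurable_fun setT h ->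
  measurable_fun setT (fun w => `|h w|%:E).
Proof. by move=> mh; apply/measurable_EFinP; exact: measurableT_comp. Qed.

(** A term is the difference of two neighbouring partial sums, and past some rank
    these are within distance 1 of the limit. *)
Lemma L1_terms_bounded : (forall a, (\int[P]_w `|V a w|%:E < +oo)%E) ->
  exists2 M : R, 0 <= M & forall a, (\int[P]_w `|V a w|%:E <= M%:E)%E.
Proof.
move=> Voo.
have V0 a : (0 <= \int[P]_w `|V a w|%:E)%E.
  by apply: integral_ge0 => w _; rewrite lee_fin.
have [N _ DN] : \forall n \near \oo, (\int[P]_w `|D n w|%:E < 1%:E)%E.
  have h : nbhs (0%E : \bar R) [set y | (y < 1%:E)%E].
    by apply: open_ereal_lt'; rewrite lte_fin.
  exact: (cD h).
pose u k : R := fine (\int[P]_w `|V (e k) w|%:E)%E.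
have u0 k : 0 <= u k by exact: fine_ge0.
have uE k : (\int[P]_w `|V (e k) w|%:E = (u k)%:E)%E.
  by rewrite fineK// ge0_fin_numE.
exists (2 + \sum_(k < N) u k); first by rewrite addr_ge0// sumr_ge0.
move=> a; have [e' _ e'e] := be; rewrite -[a]e'e; move: (e' a) => {a}k.
have [kN|Nk] := ltnP k N.
  rewrite uE lee_fin (bigD1 (Ordinal kN))//= addrCA lerDl.
  by rewrite addr_ge0// sumr_ge0.
apply: (@le_trans _ _ (2%:E)); last by rewrite lee_fin lerDl sumr_ge0.
apply: (@le_trans _ _ (\int[P]_w (`|D k.+1 w|%:E + `|D k w|%:E))%E).
  apply: ge0_le_integral => //.
  - exact: mnorm.
  - by apply: emeasurable_funD; exact: mnorm.
  - move=> w _; rewrite -EFinD lee_fin.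
    have -> : V (e k) w = D k.+1 w - D k w.
      by rewrite /D big_ord_recr/=; ring.
    exact: ler_normB.
rewrite ge0_integralD//; try exact: mnorm.
rewrite (_ : 2%:E = 1%:E + 1%:E)%E; last by rewrite -EFinD.
by apply: leeD; apply: ltW; apply: DN => //=; rewrite (leq_trans Nk)// leqnSn.
Qed.

(** A dominated family controls the remainders of any series of its terms, and
    the [L^1] limit inherits this control: the excess [h] over the bound has
    integral at most the [L^1] distance to a late partial sum. *)
Lemma L1_limit_remainder (G : Omega -> R) F : measurable_fun setT G ->
    (forall w, 0 <= G w) -> (forall a w, `|V a w| <= mwt R a * G w) -> uniq F ->
  {ae P, forall w, `|f w - \sum_(a <- F) V a w| <= gap R F * G w}.
Proof.
move=> mG G0 VG uF; have ie := bij_inj be.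
pose h w := Num.max 0 (`|f w - \sum_(a <- F) V a w| - gap R F * G w).
have h0 w : 0 <= h w by rewrite le_max lexx.
have mh : measurable_fun setT h.
  apply: measurable_maxr; first exact: measurable_cst.
  apply: measurable_funB; last exact: measurable_funM.
  apply: measurableT_comp => //; apply: measurable_funB => //.
  exact: measurable_sum.
have [N FN] := sub_prefix F be.
have hD n : (N <= n)%N -> (\int[P]_w (h w)%:E <= \int[P]_w `|D n w|%:E)%E.
  move=> Nn; apply: ge0_le_integral => //.
  - by move=> w _; rewrite lee_fin h0.
  - exact/measurable_EFinP.
  - exact: mnorm.
  - move=> w _; rewrite lee_fin ge_max normr_ge0/= lerBlDr.
    have VGw a : `|V a w| <= G w * mwt R a by rewrite mulrC.
    have := dist_sum_sub VGw uF (uniq_prefix n ie) (FN n Nn).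
    rewrite -(sum_prefix (fun a => V a w)) => hw.
    have -> : f w - \sum_(a <- F) V a w =
      (\sum_(k < n) V (e k) w - \sum_(a <- F) V a w) - D n w by rewrite /D; ring.
    rewrite (le_trans (ler_normB _ _))// addrC lerD2l (le_trans hw)// mulrC.
    rewrite ler_wpM2r// gerBl; exact: gap_ge0 (uniq_prefix n ie).
have hint0 : (\int[P]_w `|(h w)%:E| = 0)%E.
  apply/eqP; rewrite eq_le integral_ge0// andbT.
  under eq_integral do rewrite gee0_abs ?lee_fin//.
  apply: (cvge_to_ge cD); exists N => // n /= Nn; exact: hD.
have := (ae_eq_integral_abs P measurableT (f := EFin \o h) _).1 hint0.
move=> hae; have {}hae := hae _; apply: filterS (hae _); last exact/measurable_EFinP.
move=> w /(_ I)[hw].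
have : `|f w - \sum_(a <- F) V a w| - gap R F * G w <= h w.
  by rewrite le_max lexx orbT.
by rewrite hw subr_le0.
Qed.

End L1_limits.

Section coefficient_bounds.
Context dO (Omega : measurableType dO) (R : realType) (P : probability Omega R).
Variables (d : nat) (X : R -> Omega -> d.-tuple R) (g : R -> d.-tuple R -> R).
Variable b : d.-tuple nat -> R.
Hypothesis BX : brownian_motion P X.
Hypothesis mg : forall t, 0 <= t -> measurable_fun setT (fun w => g t (X t w)).
Hypothesis bg : forall t, 0 <= t -> exists e : nat -> d.-tuple nat, bijective e /\
  Lp_series_cvg P 1 (fun a w => b a * mhermite a t (X t w)) e
    (fun w => g t (X t w)).
Local Notation normc := (@Normc.normc R).
Local Notation V t a w := (b a * mhermite a t (X t w)).

Lemma dotp0l (x : d.-tuple R) : dotp [tuple 0 | i < d] x = 0.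
Proof. by rewrite /dotp big1// => i _; rewrite tnth_mktuple mul0r. Qed.

Lemma measurable_hermite_term t a : 0 <= t ->
  measurable_fun setT (fun w => V t a w).
Proof.
move=> t0; have mX := bm_measurable BX t0.
under eq_fun do rewrite mhermiteE mulrA.
apply: measurable_funM => //; apply: measurable_prod => i _.
apply: (measurableT_comp (f := fun x : R => hcoef t x (tnth a i))).
  exact: measurable_hcoef.
exact: (measurableT_comp (measurable_tnth i) mX).
Qed.

Lemma integrable_hermite_term t a : 0 < t ->
  P.-integrable setT (EFin \o (fun w => V t a w)).
Proof.
move=> t0; have mX := bm_measurable BX (ltW t0).
have e0 : 0 < (4 * t)^-1 by rewrite invr_gt0 mulr_gt0.
pose u := [tuple (1 : R) | i < d].
have u1 : mpow u a = 1.
  by rewrite /mpow big1// => i _; rewrite tnth_mktuple expr1n.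
pose k := `|b a * (mfact a)%:R| *
  (mwt R a * expR (((4 * t)^-1^-1 + 2 * t) * dotp u u)).
have := integrable_exp_sqr t0 mX (brownian_marginal BX t0) k [tuple 0 | i < d].
apply: le_integrable => //.
  by apply/measurable_EFinP; apply: measurable_hermite_term; exact: ltW.
move=> w _; rewrite /= lee_fin dotp0l add0r mhermiteE mulrA normrM.
rewrite [leRHS]ger0_norm; last first.
  by rewrite !mulr_ge0 ?expR_ge0 ?mwt_ge0.
rewrite -mulrA ler_wpM2l//.
have := mhcoef_gauss u (X t w) a (ltW t0) e0; rewrite u1 mul1r => h.
by apply: le_trans h _; rewrite le_eqVlt; apply/orP; left; apply/eqP; ring.
Qed.

(** Testing a bounded term against the tilt of imaginary argument [i s], whose
    modulus is constant, isolates its coefficient. *)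
Lemma coefficient_bound t : 0 < t -> exists2 M : R, 0 <= M &
  forall a s, `|b a| * `|mpow s a| <= M * expR (dotp s s / (2 * t)).
Proof.
move=> t0; have [e [be Ve]] := bg (ltW t0).
have mX := bm_measurable BX (ltW t0); have lawX := brownian_marginal BX t0.
have iV a := integrable_hermite_term a t0.
have inV a : P.-integrable setT (EFin \o (fun w => `|V t a w|)).
  exact: (integrable_norm (iV a)).
have [|M M0 VM] := L1_terms_bounded be
    (fun a => measurable_hermite_term a (ltW t0)) (mg (ltW t0)) Ve.
  by move=> a; have /integrableP[] := iV a.
exists (2 * M) => [|a s]; first exact: mulr_ge0.
pose z : 'rV[R[i]]_d := \row_j Complex 0 (tnth s j).
have zE j : z 0 j = Complex 0 (tnth s j) by rewrite mxE.
have nz : normc (cmpow z a) = `|mpow s a|.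
  rewrite /cmpow normc_prod /mpow normr_prod; apply: eq_bigr => j _.
  by rewrite normcX zE /= expr0n add0r sqrtr_sqr normrX.
have ReS : complex.Re (csqr z) = - dotp s s.
  rewrite /csqr raddf_sum/= -sumrN; apply: eq_bigr => j _.
  by rewrite zE expr2/= mul0r sub0r.
have nt x : normc (mtilt t z x) = expR (dotp s s / (2 * t)).
  rewrite normc_mtilt// ReS mulNr opprK.
  rewrite (_ : [tuple _ | _ < _] = [tuple 0 | i < d]) ?dotp0l ?expR0 ?mulr1//.
  by apply: eq_from_tnth => j; rewrite !tnth_mktuple zE mul0r.
have [i1 i2] := expectation_mhcoef_tilt t0 mX lawX a z.
pose c := (b a * (mfact a)%:R)%:C%C.
have cE w : c * ((mhcoef a t (X t w))%:C%C * mtilt t z (X t w)) =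
    (V t a w)%:C%C * mtilt t z (X t w).
  by rewrite mulrA /c -rmorphM mhermiteE mulrA.
have iG : P.-integrable setT
    (EFin \o (fun w => `|V t a w| * expR (dotp s s / (2 * t)))).
  by apply: eq_integrable (integrableZr measurableT _ (inV a)).
have := normc_cintegral_le (cintegrableZl c i1) iG _.
rewrite (cintegralZl c i1) i2 => h.
have {}h := h _; apply: le_trans (_ : _ <= _) (le_trans (h _) _).
- have m0 : (mfact a)%:R != 0 :> R[i].
    by rewrite -(rmorph_nat (real_complex R)) fmorph_eq0 mfact_neq0.
  have -> : c * (cmpow z a / (mfact a)%:R) = (b a)%:C%C * cmpow z a.
    by rewrite /c rmorphM rmorph_nat; field.
  by rewrite Normc.normcM nz normcR.
- by move=> w; rewrite cE Normc.normcM nt normcR.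
rewrite RintegralZr// -mulrA ler_wpM2l// ler_wpM2r ?expR_ge0//.
rewrite -lee_fin /Rintegral fineK//.
exact: (integrable_fin_num measurableT (inV a)).
Qed.

(** For a long enough time horizon the coefficients decay fast enough to dominate
    the Hermite series at any given earlier time. Every coordinate of [s] and [l]
    is of the order of the square root of the degree, which optimizes both
    estimates. *)
Lemma hermite_series_dominated t e : 0 <= t -> 0 < e -> exists2 K : R, 0 <= K &
  forall a x, `|b a * mhermite a t x| <= mwt R a * (K * expR (e * dotp x x)).
Proof.
(* With [l] the square root of [n], [hcoef_bound] and Young's inequality give
   [n `^ (n / 2) * |hcoef t x n| <= expR (A * n + e * x ^+ 2)]. Testing with
   [s = sg * l] at the time [sg ^+ 2 / 2] costs [expR n] and gains the powers of
   [sg], which absorb [expR (A * n)], [expR n] and the weight; the two powers of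
   [l] absorb the factorial, which is at most [n ^ n]. *)
move=> t0 e0; pose A := (4 * e)^-1 + t / 2.
pose sg := 2 * expR (A + 1); have sg0 : 0 < sg by rewrite mulr_gt0 ?expR_gt0.
have T0 : 0 < sg ^+ 2 / 2 by rewrite divr_gt0 ?exprn_gt0.
have [M M0 bM] := coefficient_bound T0; exists M => // a x.
pose r i : R := Num.sqrt (tnth a i)%:R.
have r2 i : r i ^+ 2 = (tnth a i)%:R by rewrite sqr_sqrtr.
have r0 i : 0 <= r i by exact: sqrtr_ge0.
have hb := bM a [tuple sg * r i | i < d].
have hs : dotp [tuple sg * r i | i < d] [tuple sg * r i | i < d] /
    (2 * (sg ^+ 2 / 2)) = \sum_(i < d) (tnth a i)%:R.
  rewrite /dotp mulr_suml; apply: eq_bigr => i _.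
  by rewrite tnth_mktuple -r2; field; rewrite gt_eqF.
rewrite hs expR_sum /mpow normr_prod in hb.
have hh : `|mhcoef a t x| * \prod_(i < d) r i ^+ tnth a i <=
    \prod_(i < d) (expR (A * (tnth a i)%:R) * expR (e * tnth x i ^+ 2)).
  rewrite /mhcoef normr_prod -big_split/=; apply: ler_prod => i _.
  rewrite mulr_ge0 ?exprn_ge0//=.
  apply: le_trans (hcoef_bound (tnth x i) (tnth a i) t0 (r0 i)) _.
  rewrite -expRD ler_expR r2.
  have := two_mul_le_sqr (r i / 2) `|tnth x i| e0.
  rewrite real_normK ?num_real// exprMn r2 => h.
  apply: le_trans (_ : (e * tnth x i ^+ 2 + (tnth a i)%:R * 2^-1 ^+ 2 / e) +
    (tnth a i)%:R * t / 2 <= _).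
    by rewrite lerD2r (le_trans _ h)// le_eqVlt; apply/orP; left; apply/eqP; field.
  rewrite /A le_eqVlt; apply/orP; left; apply/eqP; field.
  by rewrite gt_eqF.
pose D := \prod_(i < d) (2 ^+ tnth a i * expR ((A + 1) * (tnth a i)%:R)).
have D0 : 0 < D by apply: prodr_gt0 => i _; rewrite mulr_gt0 ?exprn_gt0 ?expR_gt0.
have facts : D * (mfact a)%:R <=
    (\prod_(i < d) `|tnth [tuple sg * r i | i < d] i ^+ tnth a i|) *
    \prod_(i < d) r i ^+ tnth a i.
  rewrite /D /mfact natr_prod -!big_split/=; apply: ler_prod => i _.
  rewrite !mulr_ge0 ?exprn_ge0 ?expR_ge0//= tnth_mktuple.
  rewrite ger0_norm ?exprn_ge0 ?mulr_ge0 ?(ltW sg0)//.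
  have -> : (sg * r i) ^+ tnth a i * r i ^+ tnth a i =
      sg ^+ tnth a i * (tnth a i)%:R ^+ tnth a i.
    by rewrite -r2 expr2 !exprMn mulrA.
  rewrite /sg exprMn -expRM_natr.
  rewrite ler_wpM2l ?mulr_ge0 ?exprn_ge0 ?expR_ge0//.
  rewrite -natrX ler_nat.
  elim: (tnth a i) => // n IH; rewrite factS expnS leq_mul//.
  by apply: (leq_trans IH); case: n {IH} => // n; rewrite leq_exp2r.
rewrite -(ler_pM2r D0).
have -> : mwt R a * (M * expR (e * dotp x x)) * D =
    M * \prod_(i < d) expR (tnth a i)%:R *
    \prod_(i < d) (expR (A * (tnth a i)%:R) * expR (e * tnth x i ^+ 2)).
  rewrite /mwt /D mulrCA -!mulrA; congr (M * _).
  rewrite /dotp mulr_sumr expR_sum -!big_split/=; apply: eq_bigr => i _.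
  rewrite -expr2 mulrDl mul1r expRD.
  have h : (2^-1 : R) ^+ tnth a i * 2 ^+ tnth a i = 1.
    by rewrite -exprMn mulVf ?expr1n.
  move: (2^-1 ^+ _) (2 ^+ _) (expR (A * _)) (expR (_)%:R) (expR (e * _)) h.
  by move=> p q u v w pq; transitivity (p * q * (v * (u * w))); [ring|rewrite pq; ring].
rewrite mhermiteE normrM.
apply: le_trans (ler_pM _ _ hb hh); rewrite ?mulr_ge0 ?prodr_ge0//; last first.
  by move=> i _; rewrite exprn_ge0.
rewrite [leRHS]mulrACA normrM (ger0_norm (ler0n _ _)).
apply: le_trans (ler_wpM2l _ facts); last by rewrite mulr_ge0.
by rewrite le_eqVlt; apply/orP; left; apply/eqP; ring.
Qed.

(** The [L^1] limit inherits the domination: the remainders of the series are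
    controlled by a Gaussian exponential that stays integrable. *)
Lemma hermite_remainder t e : 0 <= t -> 0 < e -> exists2 K : R, 0 <= K &
  (forall a x, `|b a * mhermite a t x| <= mwt R a * (K * expR (e * dotp x x))) /\
  forall F, uniq F -> {ae P, forall w,
    `|g t (X t w) - \sum_(a <- F) V t a w| <=
    gap R F * (K * expR (e * dotp (X t w) (X t w)))}.
Proof.
move=> t0 e0; have [K K0 VK] := hermite_series_dominated t0 e0.
exists K => //; split => // F uF; have [s [bs Vs]] := bg t0.
have mX := bm_measurable BX t0.
apply: (@L1_limit_remainder _ _ _ _ _ (fun a w => V t a w) _ s bs _ (mg t0) Vs
  (fun w => K * expR (e * dotp (X t w) (X t w))) F _ _ _ uF).
- by move=> a; exact: measurable_hermite_term.
- apply: measurable_funM => //; apply: measurableT_comp => //.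
  by apply: measurable_funM => //; exact: measurable_dotp.
- by move=> w; rewrite mulr_ge0 ?expR_ge0.
- by move=> a w; exact: VK.
Qed.

End coefficient_bounds.

(** * Quadratic exponential moments of positive charges *)

Section positive_charges.
Context d (T : measurableType d) (R : realType) (mu : {charge set T -> \bar R}).
Hypothesis mu0 : forall A, measurable A -> (0 <= mu A)%E.
Local Notation pos := (jordan_pos (hahn_pos_neg mu)).
Local Notation neg := (jordan_neg (hahn_pos_neg mu)).

(** On the negative set of a Hahn decomposition the charge is both nonnegative and
    nonpositive. *)
Lemma jordan_neg_positive A : measurable A -> neg A = 0%E.
Proof.
move=> mA; have [_ [mN _] _ _] := hahn_pos_neg mu.
apply/eqP; rewrite eq_le measure_ge0 andbT.
rewrite jordan_negE cjordan_negE /crestr0 mem_set// /crestr leeNl oppe0.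
by apply: mu0; exact: measurableI.
Qed.

Lemma integral_total_variation_positive (f : T -> \bar R) :
  (\int[Defs.total_variation mu]_x f x = \int[pos]_x f x)%E.
Proof.
apply: eq_measure_integral => A mA _ /=.
rewrite -[RHS]adde0; congr (_ + _)%E; exact: jordan_neg_positive.
Qed.

Lemma charge_integral_positive (f : T -> R) :
  charge_integral mu f = \int[pos]_x f x.
Proof.
rewrite /charge_integral [X in _ - X](_ : _ = 0) ?subr0// /Rintegral.
rewrite (eq_measure_integral mzero) ?integral_measure_zero// => A mA _.
exact: jordan_neg_positive.
Qed.

Lemma integrable_total_variation_positive (f : T -> \bar R) :
  (Defs.total_variation mu).-integrable setT f <-> pos.-integrable setT f.
Proof.
split => /integrableP[mf foo]; apply/integrableP; split => //.
  by rewrite -integral_total_variation_positive.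
by rewrite integral_total_variation_positive.
Qed.

Lemma charge_cintegral_positive (f : T -> R[i]) :
  charge_cintegral mu f = cintegral pos f.
Proof. by rewrite /charge_cintegral !charge_integral_positive. Qed.

Lemma charge_cintegrable_positive (f : T -> R[i]) :
  charge_cintegrable mu f <-> cintegrable pos f.
Proof.
by split => -[f1 f2]; split; apply/integrable_total_variation_positive.
Qed.

End positive_charges.

Section quadratic_moments_of_positive_charges.
Context dO (Omega : measurableType dO) (R : realType) (P : probability Omega R).
Variables (d : nat) (X : R -> Omega -> d.-tuple R) (g : R -> d.-tuple R -> R).
Variables (b : d.-tuple nat -> R) (mu : {charge set (d.-tuple R) -> \bar R}).
Hypothesis BX : brownian_motion P X.
Hypothesis mg : forall t, 0 <= t -> measurable_fun setT (fun w => g t (X t w)).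
Hypothesis bg : forall t, 0 <= t -> exists e : nat -> d.-tuple nat, bijective e /\
  Lp_series_cvg P 1 (fun a w => b a * mhermite a t (X t w)) e
    (fun w => g t (X t w)).
Hypothesis gmu : widder_representation P X g mu.
Hypothesis mu0 : forall A, measurable A -> (0 <= mu A)%E.
Local Notation pos := (jordan_pos (hahn_pos_neg mu)).

Lemma dotpDl (x y z : d.-tuple R) :
  dotp [tuple tnth x i + tnth y i | i < d] z = dotp x z + dotp y z.
Proof.
by rewrite /dotp -big_split; apply: eq_bigr => i _; rewrite tnth_mktuple mulrDl.
Qed.

Lemma dotpC (x y : d.-tuple R) : dotp x y = dotp y x.
Proof. by apply: eq_bigr => i _; rewrite mulrC. Qed.

Lemma dotp_le_sqr (c : R) (x y : d.-tuple R) : 0 < c ->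
  2 * dotp x y <= c * dotp y y + dotp x x / c.
Proof.
move=> c0; rewrite /dotp !mulr_sumr mulr_suml -big_split/=.
apply: ler_sum => i _; rewrite mulrA -!expr2; exact: two_mul_le_sqr.
Qed.

Lemma stoch_exp_le (v x : d.-tuple R) (t : R) : 0 < t ->
  stoch_exp v t x <= expR (dotp x x / (2 * t)).
Proof.
move=> t0; rewrite ler_expR; have := dotp_le_sqr x v t0.
rewrite (dotpC x v) => h.
rewrite lerBlDr -(ler_pM2l (ltr0n R 2 : 0 < 2)) ?ltr0n//.
apply: le_trans h _; rewrite le_eqVlt; apply/orP; left; apply/eqP; field.
by rewrite gt_eqF.
Qed.

Lemma measurable_stoch_exp_prod (t : R) : 0 <= t ->
  measurable_fun setT (fun u : Omega * d.-tuple R => stoch_exp u.2 t (X t u.1)).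
Proof.
move=> t0; have mX := bm_measurable BX t0.
apply: measurableT_comp => //; apply: measurable_funB.
  by apply: measurable_dotp => //; exact: measurableT_comp.
by apply: measurable_funM => //; apply: measurable_funM => //; exact: measurable_dotp.
Qed.

Lemma integrable_stoch_exp_pos (t : R) x : 0 < t ->
  pos.-integrable setT (EFin \o (fun v => stoch_exp v t x)).
Proof.
move=> t0; have := finite_measure_integrable_cst pos (expR (dotp x x / (2 * t))) measurableT.
apply: le_integrable => //.
  by apply/measurable_EFinP; exact: measurable_stoch_exp.
move=> v _; rewrite /= lee_fin !ger0_norm ?expR_ge0//; exact: stoch_exp_le.
Qed.

Lemma widder_positive (t : R) : 0 < t -> {ae P, forall w,
  (\int[pos]_v (stoch_exp v t (X t w))%:E)%E = (g t (X t w))%:E}.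
Proof.
move=> t0; apply: filterS (gmu (ltW t0)) => w ->.
rewrite charge_integral_positive// /Rintegral fineK//.
exact: (integrable_fin_num measurableT (integrable_stoch_exp_pos _ t0)).
Qed.

(** Weighting the representation with a Gaussian exponential costs nothing on the
    side of the process, by domination, and produces a quadratic exponential on
    the side of the measure. The horizon tunes its order. *)
Lemma quad_exp_moments_positive : quad_exp_moments mu.
Proof.
(* The weight [expR ((8 * t)^-1 * |x| ^+ 2)] corresponds to the variance
   [s ^+ 2 = 4 / 3 * t] in [expectation_exp_quad]; with the factor
   [expR (- |v| ^+ 2 * t / 2)] of the stochastic exponential this leaves
   [expR (|v| ^+ 2 * t / 6)]. *)
move=> lambda l0; pose t := 6 * lambda.
have t0 : 0 < t by rewrite mulr_gt0.
have mX := bm_measurable BX (ltW t0); have lawX := brownian_marginal BX t0.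
have e0 : 0 < (8 * t)^-1 by rewrite invr_gt0 mulr_gt0.
have [K K0 [_ VK]] := hermite_remainder BX mg bg (ltW t0) e0.
rewrite integral_total_variation_positive//.
pose c : R := (Num.sqrt (4 / 3 * t) / Num.sqrt t) ^+ d.
have q0 : 0 < 4 / 3 * t by apply: mulr_gt0 => //; rewrite divr_gt0.
have s0 : 0 < Num.sqrt (4 / 3 * t) by rewrite sqrtr_gt0.
have c0 : 0 < c by rewrite exprn_gt0// divr_gt0// sqrtr_gt0.
pose F (u : Omega * d.-tuple R) : \bar R :=
  (expR ((8 * t)^-1 * dotp (X t u.1) (X t u.1)) * stoch_exp u.2 t (X t u.1))%:E.
have mq : measurable_fun setT
    (fun w => expR ((8 * t)^-1 * dotp (X t w) (X t w))).
  apply: measurableT_comp => //.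
  by apply: measurable_funM => //; exact: measurable_dotp.
have mF : measurable_fun setT F.
  apply/measurable_EFinP; apply: measurable_funM.
    exact: (measurableT_comp mq).
  by apply: measurable_stoch_exp_prod; exact: ltW.
have F0 u : (0 <= F u)%E by rewrite lee_fin mulr_ge0 ?expR_ge0.
have inner v : (\int[P]_w F (w, v) = (c * expR (lambda * dotp v v))%:E)%E.
  have := expectation_exp_quad t0 mX lawX v s0.
  rewrite sqr_sqrtr ?(ltW q0)// => h.
  transitivity (\int[P]_w ((expR (- (dotp v v * t / 2)))%:E *
    (expR (dotp v (X t w) + (t^-1 - (4 / 3 * t)^-1) / 2 *
      dotp (X t w) (X t w)))%:E))%E.
    apply: eq_integral => w _; rewrite -EFinM /F /stoch_exp -!expRD/=.
    by congr (expR _)%:E; field; rewrite gt_eqF.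
  rewrite ge0_integralZl//; last first.
    apply/measurable_EFinP; apply: measurableT_comp => //.
    apply: measurable_funD; first by apply: measurable_dotp => //; exact: measurable_cst.
    by apply: measurable_funM => //; exact: measurable_dotp.
  rewrite h -EFinM mulrCA -expRD; congr (c * expR _)%:E.
  by rewrite /t; field.
have T1 := fubini_tonelli (m1 := P) (m2 := pos) F mF F0.
have -> : (\int[pos]_v (expR (lambda * dotp v v))%:E =
    c^-1%:E * \int[P]_w \int[pos]_v F (w, v))%E.
  rewrite T1; under [in RHS]eq_integral do rewrite inner.
  rewrite -ge0_integralZl//.
  - apply: eq_integral => v _; rewrite -EFinM mulKf// gt_eqF//.
  - apply/measurable_EFinP; apply: measurable_funM => //.
    apply: measurableT_comp => //.
    by apply: measurable_funM => //; exact: measurable_dotp.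
  - by move=> v _; rewrite lee_fin mulr_ge0 ?expR_ge0// ltW.
  - by rewrite lee_fin invr_ge0 ltW.
apply: lte_mul_pinfty; rewrite ?lee_fin ?invr_ge0 ?(ltW c0)//.
have iG := integrable_exp_sqr t0 mX lawX (2 ^+ d * K) [tuple 0 | i < d].
have [_ Goo] := integrableP _ _ _ iG.
apply: le_lt_trans Goo; apply: ae_ge0_le_integral => //.
- by move=> w _; apply: integral_ge0 => v _; exact: F0.
- by apply: (measurable_fun_fubini_tonelli_F F).
- by apply: measurableT_comp => //; exact: measurable_int iG.
have VK0 := VK [::] isT.
near=> w => _.
have gw : (\int[pos]_v (stoch_exp v t (X t w))%:E)%E = (g t (X t w))%:E.
  by near: w; exact: widder_positive.
have gK : `|g t (X t w)| <= 2 ^+ d * (K * expR ((8 * t)^-1 * dotp (X t w) (X t w))).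
  near: w; apply: filterS VK0 => w; rewrite big_nil subr0 gap_nil.
  exact.
rewrite /F/=; under eq_integral do rewrite EFinM.
rewrite ge0_integralZl//; last 2 first.
- by apply/measurable_EFinP; exact: measurable_stoch_exp.
- by move=> v _; rewrite lee_fin expR_ge0.
rewrite gw -EFinM lee_fin dotp0l add0r [leRHS]ger0_norm; last first.
  by rewrite !mulr_ge0 ?expR_ge0// exprn_ge0.
apply: le_trans (ler_wpM2l (expR_ge0 _) (le_trans (ler_norm _) gK)) _.
set q := expR ((8 * t)^-1 * _).
have -> : q * (2 ^+ d * (K * q)) = 2 ^+ d * K * (q * q) by ring.
rewrite /q -expRD ler_wpM2l ?mulr_ge0 ?exprn_ge0// ler_expR.
rewrite le_eqVlt; apply/orP; left; apply/eqP; field.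
by rewrite gt_eqF.
Unshelve. all: by end_near. Qed.

End quadratic_moments_of_positive_charges.

(** * The Laplace transform and its representations *)

Section almost_everywhere_bounds.
Context d (T : measurableType d) (R : realType) (m : {measure set T -> \bar R}).
Local Notation normc := (@Normc.normc R).

Lemma integrable_le_ae (f G : T -> R) : measurable_fun setT f ->
    m.-integrable setT (EFin \o G) -> {ae m, forall x, `|f x| <= G x} ->
  m.-integrable setT (EFin \o f) /\ `|\int[m]_x f x| <= \int[m]_x `|G x|.
Proof.
move=> mf iG fG; have mG : measurable_fun setT G.
  by apply/measurable_EFinP; exact: measurable_int iG.
have le : (\int[m]_x `|f x|%:E <= \int[m]_x `|G x|%:E)%E.
  apply: ae_ge0_le_integral => //.
  - by apply/measurable_EFinP; exact: measurableT_comp.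
  - by apply/measurable_EFinP; exact: measurableT_comp.
  - apply: filterS fG => x fGx _; rewrite lee_fin (le_trans fGx)//.
    exact: ler_norm.
have iN : m.-integrable setT (EFin \o (fun x => `|G x|)) := integrable_norm iG.
have jf : m.-integrable setT (EFin \o f).
  apply/integrableP; split; first exact/measurable_EFinP.
  by apply: le_lt_trans le _; have /integrableP[] := iG.
split => //; rewrite (le_trans (le_normr_Rintegral _ jf))//.
rewrite /Rintegral fine_le//.
  exact: (integrable_fin_num measurableT (integrable_norm jf)).
exact: (integrable_fin_num measurableT iN).
Qed.

Lemma cintegrable_le_ae (f : T -> R[i]) (G : T -> R) : cmeasurable f ->
    m.-integrable setT (EFin \o G) -> {ae m, forall x, normc (f x) <= G x} ->
  cintegrable m f /\ normc (cintegral m f) <= 2 * \int[m]_x `|G x|.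
Proof.
move=> [mf1 mf2] iG fG.
have [i1 l1] : m.-integrable setT (EFin \o (@complex.Re R \o f)) /\
    `|\int[m]_x complex.Re (f x)| <= \int[m]_x `|G x|.
  apply: integrable_le_ae => //; apply: filterS fG => x; apply: le_trans.
  exact: ler_norm_Re.
have [i2 l2] : m.-integrable setT (EFin \o (@complex.Im R \o f)) /\
    `|\int[m]_x complex.Im (f x)| <= \int[m]_x `|G x|.
  apply: integrable_le_ae => //; apply: filterS fG => x; apply: le_trans.
  exact: ler_norm_Im.
split => //; rewrite (le_trans (normc_le_ReIm _))//= mulr_natl mulr2n.
exact: lerD.
Qed.

End almost_everywhere_bounds.

Section laplace_transform.
Variables (R : realType) (d : nat).
Variable m : {measure set (d.-tuple R) -> \bar R}.
Hypothesis quad_integrable : forall k l : R, 0 < l ->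
  m.-integrable setT (EFin \o (fun v => k * expR (l * dotp v v))).
Local Notation normc := (@Normc.normc R).
Implicit Types (z : 'rV[R[i]]_d) (v : d.-tuple R).

Definition re_tuple z : d.-tuple R := [tuple complex.Re (z 0 i) | i < d].

Lemma Re_cdotp v z : complex.Re (cdotp v z) = dotp v (re_tuple z).
Proof.
rewrite /cdotp raddf_sum; apply: eq_bigr => i _.
by rewrite /= cReM/= mul0r subr0 tnth_mktuple.
Qed.

Lemma cmeasurable_cexp_cdotp z :
  cmeasurable (fun v : d.-tuple R => cexp (cdotp v z)).
Proof.
apply: cmeasurable_cexp; apply: cmeasurable_sum => i _.
apply: cmeasurableM; last exact: cmeasurable_cst.
by apply: cmeasurable_real; exact: measurable_tnth.
Qed.

(** Young's inequality, so that half a quadratic exponential dominates the kernel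
    of the transform. *)
Lemma normc_cexp_cdotp_le v z : normc (cexp (cdotp v z)) <=
  expR (dotp (re_tuple z) (re_tuple z) / 2) * expR (2^-1 * dotp v v).
Proof.
rewrite normc_exp Re_cdotp -expRD ler_expR dotpC.
have := dotp_le_sqr (re_tuple z) v ltr01; rewrite mul1r divr1 => h.
by rewrite -(ler_pM2l (ltr0n R 2 : 0 < 2)) ?ltr0n// (le_trans h)//
  le_eqVlt; apply/orP; left; apply/eqP; field.
Qed.

Lemma cintegrable_cexp_cdotp z : cintegrable m (fun v => cexp (cdotp v z)).
Proof.
apply: (cintegrable_le (cmeasurable_cexp_cdotp z) (quad_integrable
  (expR (dotp (re_tuple z) (re_tuple z) / 2)) (l := 2^-1) _)).
  by rewrite invr_gt0.
by move=> v; exact: normc_cexp_cdotp_le.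
Qed.

End laplace_transform.

Section transform_of_positive_charges.
Context dO (Omega : measurableType dO) (R : realType) (P : probability Omega R).
Variables (d : nat) (X : R -> Omega -> d.-tuple R) (g : R -> d.-tuple R -> R).
Variables (b : d.-tuple nat -> R) (mu : {charge set (d.-tuple R) -> \bar R}).
Hypothesis BX : brownian_motion P X.
Hypothesis mg : forall t, 0 <= t -> measurable_fun setT (fun w => g t (X t w)).
Hypothesis bg : forall t, 0 <= t -> exists e : nat -> d.-tuple nat, bijective e /\
  Lp_series_cvg P 1 (fun a w => b a * mhermite a t (X t w)) e
    (fun w => g t (X t w)).
Hypothesis gmu : widder_representation P X g mu.
Hypothesis mu0 : forall A, measurable A -> (0 <= mu A)%E.
Local Notation pos := (jordan_pos (hahn_pos_neg mu)).
Local Notation normc := (@Normc.normc R).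
Implicit Types (z : 'rV[R[i]]_d) (v x : d.-tuple R).

Let qm : quad_exp_moments mu := quad_exp_moments_positive BX mg bg gmu mu0.

Lemma integrable_quad_pos (k l : R) : 0 < l ->
  pos.-integrable setT (EFin \o (fun v => k * expR (l * dotp v v))).
Proof.
move=> l0; apply/(integrable_total_variation_positive mu0).
exact: charge_integrable_quad.
Qed.

Section fixed_time.
Variables (t : R) (t0 : 0 < t) (z : 'rV[R[i]]_d).
Let mX := bm_measurable BX (ltW t0).
Let lawX := brownian_marginal BX t0.
Let r : d.-tuple R := [tuple complex.Re (z 0 i) / t | i < d].
Let k : R := expR (- (complex.Re (csqr z) / (2 * t))).

Let cmeasurable_mtilt : cmeasurable (fun w => mtilt t z (X t w)).
Proof.
under eq_fun do rewrite mtiltE.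
apply: cmeasurable_prod => i _; have [m1 m2] := cmeasurable_ctilt t (z 0 i).
have mi : measurable_fun setT (fun w => tnth (X t w) i).
  exact: (measurableT_comp (measurable_tnth i) mX).
by split; [exact: (measurableT_comp m1 mi)|exact: (measurableT_comp m2 mi)].
Qed.

Let measurable_cpart c : measurable_fun setT (fun w => cpart c (mtilt t z (X t w))).
Proof. by case: c; case: cmeasurable_mtilt. Qed.

Let F c (u : Omega * d.-tuple R) : \bar R :=
  (stoch_exp u.2 t (X t u.1) * cpart c (mtilt t z (X t u.1)))%:E.

Let mF c : measurable_fun setT (F c).
Proof.
apply/measurable_EFinP; apply: measurable_funM.
  by apply: (measurable_stoch_exp_prod BX); exact: ltW.
exact: (measurableT_comp (measurable_cpart c)).
Qed.

Let F_le c v w : `|stoch_exp v t (X t w) * cpart c (mtilt t z (X t w))| <=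
  k * expR (dotp [tuple tnth v i + tnth r i | i < d] (X t w)
     + (4 * t)^-1 * dotp (X t w) (X t w)).
Proof.
rewrite normrM ger0_norm ?expR_ge0//.
apply: le_trans (ler_wpM2l (expR_ge0 _) (ler_norm_cpart _ _)) _.
rewrite normc_mtilt// -/r -/k mulrCA ler_wpM2l ?expR_ge0// -expRD ler_expR.
rewrite dotpDl.
have h1 : 0 <= dotp v v * t / 2 by rewrite !mulr_ge0 ?dotp_ge0 ?ltW.
have h2 : 0 <= (4 * t)^-1 * dotp (X t w) (X t w).
  by rewrite mulr_ge0 ?dotp_ge0// invr_ge0 mulr_ge0 ?ltW.
lra.
Qed.

Let integrable_F_prod c : (P \x pos)%E.-integrable setT (F c).
Proof.
apply/integrable21ltyP; first exact: mF.
pose C := k * (Num.sqrt 2 ^+ d * expR (2 * t * dotp r r)).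
have C0 : 0 <= C by rewrite !mulr_ge0 ?expR_ge0// exprn_ge0.
have t20 : 0 < 2 * t by rewrite mulr_gt0.
have [_ Coo] := integrableP _ _ _ (integrable_quad_pos C t20).
apply: le_lt_trans Coo; apply: ge0_le_integral => //.
- by move=> v _; apply: integral_ge0.
- apply: (measurable_fun_fubini_tonelli_G (fun u => `|F c u|%E)) => //.
  exact: measurableT_comp.
- apply: measurableT_comp => //; apply/measurable_EFinP.
  apply: measurable_funM => //; apply: measurableT_comp => //.
  by apply: measurable_funM => //; exact: measurable_dotp.
move=> v _; pose l := [tuple tnth v i + tnth r i | i < d].
have [_ _] := integrableP _ _ _ (integrable_exp_sqr t0 mX lawX k l).
apply: (@le_trans _ _ (\int[P]_w (k%:E * (expR (dotp l (X t w) +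
    (4 * t)^-1 * dotp (X t w) (X t w)))%:E))%E).
  apply: ge0_le_integral => //.
  - apply: measurableT_comp => //; exact: (measurableT_comp (mF c)).
  - have /integrableP[+ _] := integrable_exp_sqr t0 mX lawX k l.
    exact.
  - by move=> w _; rewrite /F /= -EFinM lee_fin; exact: F_le.
rewrite ge0_integralZl//; last 2 first.
- have /integrableP[+ _] := integrable_exp_sqr t0 mX lawX 1 l.
  by under eq_fun do rewrite /= mul1r.
- by rewrite lee_fin expR_ge0.
rewrite expectation_exp_sqr// -EFinM /= lee_fin ger0_norm; last first.
  by rewrite mulr_ge0 ?expR_ge0.
rewrite /C -!mulrA ler_wpM2l ?expR_ge0// ler_wpM2l ?exprn_ge0//.
rewrite -expRD ler_expR dotpDl.
rewrite !(dotpC _ l) !dotpDl (dotpC r v).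
have := dotp_le_sqr v r ltr01; rewrite mul1r divr1 => h.
have {}h := ler_wpM2r (ltW t0) h.
by rewrite -subr_ge0; move: h; rewrite -subr_ge0; congr (0 <= _); ring.
Qed.

Let integrable_tilted_exp v c :
  P.-integrable setT (EFin \o (fun w =>
    stoch_exp v t (X t w) * cpart c (mtilt t z (X t w)))).
Proof.
have [[i1 i2] _] := expectation_stoch_exp_tilt t0 mX lawX v z.
case: c; [apply: eq_integrable i1|apply: eq_integrable i2] => // w _.
  by congr EFin; exact: (cpartZ true (stoch_exp v t (X t w)) (mtilt t z (X t w))).
by congr EFin; exact: (cpartZ false (stoch_exp v t (X t w)) (mtilt t z (X t w))).
Qed.

Let inner_F c v : (\int[P]_w F c (w, v))%E = (cpart c (cexp (cdotp v z)))%:E.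
Proof.
have [_ <-] := expectation_stoch_exp_tilt t0 mX lawX v z.
transitivity (\int[P]_w (stoch_exp v t (X t w) * cpart c (mtilt t z (X t w))))%:E.
  rewrite /Rintegral fineK//.
  exact: (integrable_fin_num measurableT (integrable_tilted_exp v c)).
congr EFin; case: c; apply: eq_Rintegral => w _.
  exact: (esym (cpartZ true (stoch_exp v t (X t w)) (mtilt t z (X t w)))).
exact: (esym (cpartZ false (stoch_exp v t (X t w)) (mtilt t z (X t w)))).
Qed.

Let outer_F c : {ae P, forall w,
  (\int[pos]_v F c (w, v))%E = (g t (X t w) * cpart c (mtilt t z (X t w)))%:E}.
Proof.
apply: filterS (widder_positive gmu mu0 t0) => w gw.
rewrite EFinM -gw -integralZr//; exact: integrable_stoch_exp_pos.
Qed.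

(* The tilt grows like the exponential of a linear function, so that multiplying
   the domination of the Hermite series by it keeps it integrable. *)
Let tilted_remainder : exists2 G : Omega -> R,
  P.-integrable setT (EFin \o G) /\ (forall w, 0 <= G w) &
  (forall a w, normc ((b a * mhermite a t (X t w))%:C%C * mtilt t z (X t w)) <=
     mwt R a * G w) /\
  (forall H, uniq H -> {ae P, forall w,
     normc ((g t (X t w) - \sum_(a <- H) b a * mhermite a t (X t w))%:C%C *
       mtilt t z (X t w)) <= gap R H * G w}).
Proof.
have e0 : 0 < (4 * t)^-1 by rewrite invr_gt0 mulr_gt0.
have [K K0 [VK gK]] := hermite_remainder BX mg bg (ltW t0) e0.
exists (fun w => K * k * expR (dotp r (X t w) + (4 * t)^-1 * dotp (X t w) (X t w))).
  split; first exact: integrable_exp_sqr.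
  by move=> w; rewrite !mulr_ge0 ?expR_ge0.
have key s (C : R) w : 0 <= C ->
    `|s| <= C * (K * expR ((4 * t)^-1 * dotp (X t w) (X t w))) ->
    normc (s%:C%C * mtilt t z (X t w)) <=
    C * (K * k * expR (dotp r (X t w) + (4 * t)^-1 * dotp (X t w) (X t w))).
  move=> C0 sC; rewrite Normc.normcM normcR normc_mtilt// -/r -/k.
  apply: le_trans (ler_wpM2r _ sC) _; first by rewrite mulr_ge0 ?expR_ge0.
  by rewrite expRD le_eqVlt; apply/orP; left; apply/eqP; ring.
split=> [a w|H uH]; first by apply: key; [exact: mwt_ge0|exact: VK].
by apply: filterS (gK H uH) => w; apply: key; exact: gap_ge0.
Qed.

Local Notation f := (cintegral pos (fun v => cexp (cdotp v z))).
Local Notation h := (fun w => (g t (X t w))%:C%C * mtilt t z (X t w)).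

Let mh : cmeasurable h.
Proof.
apply: cmeasurableM => //; apply: cmeasurable_real; apply: mg; exact: ltW.
Qed.

Lemma transform_integrable : cintegrable P h.
Proof.
have [G [iG G0] [_ gG]] := tilted_remainder.
apply: (cintegrable_le_ae mh (integrableZl measurableT (gap R [::] : R) iG) _).1.
apply: filterS (gG [::] isT) => w; rewrite big_nil subr0.
exact.
Qed.

(** Fubini's theorem exchanges the measure and the expectation, and the Gaussian
    tilt integrates the stochastic exponential to the kernel of the transform. *)
Lemma transform_expectation : f = cintegral P h.
Proof.
have E c : \int[pos]_v cpart c (cexp (cdotp v z)) =
    \int[P]_w cpart c ((g t (X t w))%:C%C * mtilt t z (X t w)).
  rewrite /Rintegral; congr fine.
  under eq_integral do rewrite -inner_F.
  rewrite -(Fubini (integrable_F_prod c)).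
  apply: ae_eq_integral => //.
  - exact: (measurable_fubini_F (integrable_F_prod c)).
  - by apply/measurable_EFinP; case: c; case: mh.
  - by apply: filterS (outer_F c) => w -> _; rewrite cpartZ.
by rewrite /cintegral; congr Complex; [exact: (E true)|exact: (E false)].
Qed.

Let term_integral a :
  cintegrable P (fun w => (b a * mhermite a t (X t w))%:C%C * mtilt t z (X t w)) /\
  cintegral P (fun w => (b a * mhermite a t (X t w))%:C%C * mtilt t z (X t w)) =
  (b a)%:C%C * cmpow z a.
Proof.
have [i1 i2] := expectation_mhcoef_tilt t0 mX lawX a z.
have -> : (fun w => (b a * mhermite a t (X t w))%:C%C * mtilt t z (X t w)) =
    (fun w => (b a * (mfact a)%:R)%:C%C *
      ((mhcoef a t (X t w))%:C%C * mtilt t z (X t w))).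
  by apply/funext => w; rewrite mulrA -rmorphM mhermiteE mulrA.
split; first exact: cintegrableZl.
have m0 : (mfact a)%:R != 0 :> R[i].
  by rewrite -(rmorph_nat (real_complex R)) fmorph_eq0 mfact_neq0.
by rewrite cintegralZl// i2 rmorphM rmorph_nat; field.
Qed.

(** Each term of the expansion pairs with the tilt to a monomial, and the error of
    a partial sum is the expectation of a dominated remainder. *)
Lemma transform_power_series : exists2 C : R, 0 <= C &
  (forall a, normc ((b a)%:C%C * cmpow z a) <= C * mwt R a) /\
  (forall H, uniq H ->
    normc (f - \sum_(a <- H) (b a)%:C%C * cmpow z a) <= C * gap R H).
Proof.
have [G [iG G0] [VG gG]] := tilted_remainder.
exists (2 * \int[P]_w G w); first by rewrite mulr_ge0// Rintegral_ge0.
split=> [a|H uH].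
  have [i1 <-] := term_integral a.
  have := normc_cintegral_le i1 (integrableZl measurableT (mwt R a) iG) (VG a).
  by rewrite RintegralZl// mulrCA mulrC.
have [S1 S2] := cintegral_sum H (fun a => (term_integral a).1).
have -> : f - \sum_(a <- H) (b a)%:C%C * cmpow z a = cintegral P (fun w =>
    (g t (X t w) - \sum_(a <- H) b a * mhermite a t (X t w))%:C%C *
      mtilt t z (X t w)).
  rewrite transform_expectation.
  under eq_bigr do rewrite -(term_integral _).2.
  rewrite -S2 -mulN1r -(cintegralZl _ S1) -cintegralD//; last 2 first.
  - exact: transform_integrable.
  - exact: cintegrableZl.
  apply: eq_cintegral => w; rewrite mulN1r -mulr_suml -mulrBl.
  by rewrite rmorphB rmorph_sum.
have iG' : P.-integrable setT (EFin \o (fun w => gap R H * G w)).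
  exact: (integrableZl measurableT (gap R H) iG).
have := fun mV => (cintegrable_le_ae mV iG' (gG H uH)).2.
under eq_Rintegral do rewrite ger0_norm ?mulr_ge0 ?gap_ge0//.
rewrite RintegralZl// mulrCA mulrC; apply.
apply: cmeasurableM => //; apply: cmeasurable_real.
apply: measurable_funB; first by apply: mg; exact: ltW.
by apply: measurable_sum => a; apply: (measurable_hermite_term b BX); exact: ltW.
Qed.

End fixed_time.
End transform_of_positive_charges.

(** * Analyticity of the Laplace transform *)

Section exponential_remainder.
Variable R : realType.
Local Notation normc := (@Normc.normc R).

(** Beyond the terms 1 and [w], the exponential series is the square of [w] times a
    series that the one of [expR (normc w)] dominates term by term. It is read
    off from the Hermite generating function at time 0 and position 1. *)
Lemma cexp_remainder (w : R[i]) :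
  normc (cexp w - 1 - w) <= 2 * (normc w ^+ 2 * expR (normc w)).
Proof.
pose n := normc w; have n0 : 0 <= n := normc_ge0 w.
have h0 k : 0 <= hcoef (0 : R) 1 k by rewrite hcoef01 invr_ge0.
have hle k : hcoef (0 : R) 1 k.+2 <= hcoef (0 : R) 1 k.
  rewrite !hcoef01 lef_pV2 ?posrE ?ltr0n ?fact_gt0// ler_nat !factS.
  by rewrite mulnA leq_pmull.
have expn N : \sum_(k < N) n ^+ k * hcoef 0 1 k <= expR n.
  have := @hermite_generating_hcoef R 0 1 n.
  rewrite mulr1 mulr0 mul0r subr0 => us.
  rewrite -(big_mkord xpredT (fun k => n ^+ k * hcoef 0 1 k)) -(cvg_lim _ us)//.
  apply: (nondecreasing_cvgn_le _ (cvgP _ us) N).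
  apply/nondecreasing_seqP => k; rewrite /series/= big_nat_recr//= lerDl.
  by rewrite mulr_ge0// exprn_ge0.
have key c : `|cpart c (cexp w - 1 - w)| <= n ^+ 2 * expR n.
  have us : series (fun k => cpart c (w ^+ k) * hcoef 0 1 k) @ \oo --> cpart c (cexp w).
    have := @hermite_generating_cpart R 0 1 w c.
    by rewrite mul0r mulr0 subr0 mulr1.
  have us2 : series (fun k => cpart c (w ^+ k) * hcoef 0 1 k) N.+2 - cpart c 1 - cpart c w
      @[N --> \oo] --> cpart c (cexp w) - cpart c 1 - cpart c w.
    apply: cvgB; last exact: cvg_cst.
    apply: cvgB; last exact: cvg_cst.
    have := us; rewrite -(cvg_shiftn 2)/=.
    by under eq_fun do rewrite addn2.
  have -> : cpart c (cexp w - 1 - w) = cpart c (cexp w) - cpart c 1 - cpart c w.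
    by rewrite !cpartB.
  apply: (cvgr_to_le (cvg_norm us2)); apply: nearW => N.
  rewrite /series/= big_nat_recl//= big_nat_recl//= expr0 expr1.
  rewrite [hcoef 0 1 0]hcoef01 [hcoef 0 1 1]hcoef01 !invr1 !mulr1.
  rewrite [X in `|X|](_ : _ =
    \sum_(0 <= k < N) cpart c (w ^+ k.+2) * hcoef 0 1 k.+2); last by ring.
  rewrite big_mkord (le_trans (ler_norm_sum _ _ _))//.
  apply: le_trans (_ : \sum_(k < N) n ^+ 2 * (n ^+ k * hcoef 0 1 k) <= _).
    apply: ler_sum => k _; rewrite normrM (ger0_norm (h0 _)) mulrA -exprD.
    by apply: ler_pM => //; rewrite add2n /n -normcX; exact: ler_norm_cpart.
  by rewrite -mulr_sumr ler_wpM2l ?exprn_ge0.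
rewrite (le_trans (normc_le_ReIm _))// mulr_natl mulr2n.
by apply: lerD; [exact: (key true)|exact: (key false)].
Qed.

End exponential_remainder.

Section differentiability.
Variables (R : realType) (d : nat).
Variable m : {measure set (d.-tuple R) -> \bar R}.
Hypothesis quad_integrable : forall k l : R, 0 < l ->
  m.-integrable setT (EFin \o (fun v => k * expR (l * dotp v v))).
Local Notation normc := (@Normc.normc R).
Implicit Types (z h : 'rV[R[i]]_d) (v : d.-tuple R).

Let f z : R[i] := cintegral m (fun v => cexp (cdotp v z)).

Let icexp z := cintegrable_cexp_cdotp quad_integrable z.

Let partial z (j : 'I_d) v : R[i] := (tnth v j)%:C%C * cexp (cdotp v z).

Let abs_le_exp (c : R) : 2 * `|c| <= c ^+ 2 + 1.
Proof.
have := two_mul_le_sqr 1 `|c| (ltr01 : 0 < (1 : R)).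
by rewrite mulr1 mul1r expr1n divr1 real_normK ?num_real.
Qed.

Let sqr_le_dotp v j : tnth v j ^+ 2 <= dotp v v.
Proof.
rewrite /dotp (bigD1 j)//= -expr2 lerDl.
by apply: sumr_ge0 => i _; rewrite -expr2 sqr_ge0.
Qed.

Let ipartial z j : cintegrable m (partial z j).
Proof.
apply: (cintegrable_le _ (quad_integrable
  (expR 1 * expR (dotp (re_tuple z) (re_tuple z) / 2)) ltr01)).
  apply: cmeasurableM; last exact: cmeasurable_cexp_cdotp.
  by apply: cmeasurable_real; exact: measurable_tnth.
move=> v; rewrite Normc.normcM normcR.
have vexp : `|tnth v j| <= expR (2^-1 * dotp v v + 1).
  apply: le_trans (_ : `|tnth v j| + 1 <= _); first by rewrite lerDl.
  rewrite addrC (le_trans (expR_ge1Dx _))// ler_expR.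
  have := abs_le_exp (tnth v j); have := sqr_le_dotp v j; lra.
apply: le_trans (ler_pM _ _ vexp (normc_cexp_cdotp_le v z)) _ => //.
  exact: normc_ge0.
by rewrite -!expRD ler_expR le_eqVlt; apply/orP; left; apply/eqP; field.
Qed.

Let L z h : R[i]^o := \sum_(j < d) h 0 j * cintegral m (partial z j).

Let L_linear z : linear (L z).
Proof.
move=> c h1 h2; rewrite /L scaler_sumr -big_split/=; apply: eq_bigr => j _.
by rewrite !mxE mulrDl -mulrA.
Qed.

Let K : numFieldType := R[i].

Let L_continuous z : continuous (L z : 'rV[K]_d -> K^o).
Proof.
move=> h; pose u j (w : 'rV[K]_d) : K^o := w 0 j * cintegral m (partial z j).
have ac : continuous (fun x : K^o * K^o => x.1 + x.2) by exact: add_continuous.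
have := @cvg_big K^o 'I_d +%R 0 xpredT ac _ (nbhs h)
  (index_enum 'I_d) u (fun j => u j h) _; apply => j _.
by apply: (@cvgM K); [exact: (@coord_continuous K)|exact: cvg_cst].
Qed.

Let cdotpD v z h : cdotp v (z + h) = cdotp v z + cdotp v h.
Proof.
by rewrite /cdotp -big_split; apply: eq_bigr => i _; rewrite mxE mulrDr.
Qed.

Let C z : R := 2 * (expR (9 * d%:R / 4) * expR (dotp (re_tuple z) (re_tuple z) / 2)).

Let kernel_remainder z h v (N : R) : 0 <= N -> N <= 1 ->
    (forall j, normc (h 0 j) <= N) ->
  normc (cexp (cdotp v (z + h)) - cexp (cdotp v z) -
    cdotp v h * cexp (cdotp v z)) <= N ^+ 2 * C z * expR (3 / 2 * dotp v v).
Proof.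
move=> N0 N1 hN; set w := cdotp v h; pose A := \sum_(j < d) `|tnth v j|.
have A0 : 0 <= A by exact: sumr_ge0.
have wA : normc w <= A * N.
  rewrite /w /cdotp /A mulr_suml.
  elim/big_ind2: _ => [|x1 x2 y1 y2 h1 h2|j _].
  - by rewrite Normc.normc0.
  - exact: le_trans (le_normcD _ _) (lerD h1 h2).
  - by rewrite Normc.normcM normcR ler_wpM2l.
have -> : cexp (cdotp v (z + h)) - cexp (cdotp v z) - w * cexp (cdotp v z) =
    cexp (cdotp v z) * (cexp w - 1 - w) by rewrite cdotpD cexpD; ring.
rewrite Normc.normcM.
apply: le_trans (ler_pM (normc_ge0 _) (normc_ge0 _)
  (normc_cexp_cdotp_le v z) (cexp_remainder w)) _.
have wA1 : normc w <= A by rewrite (le_trans wA)// ler_piMr.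
have AE : A <= expR A by have := expR_ge1Dx A; lra.
have q : normc w ^+ 2 * expR (normc w) <= N ^+ 2 * (expR A ^+ 2 * expR A).
  rewrite mulrA -exprMn; apply: ler_pM; rewrite ?exprn_ge0 ?normc_ge0 ?expR_ge0 ?ler_expR//.
  rewrite lerXn2r ?nnegrE ?normc_ge0 ?mulr_ge0 ?expR_ge0//.
  by rewrite (le_trans wA)// mulrC ler_wpM2l.
have q3 : expR A ^+ 2 * expR A <= expR (9 * d%:R / 4) * expR (dotp v v).
  rewrite -exprSr -expRM_natl -expRD ler_expR /A mulr_sumr.
  (* three times a coordinate is at most its square plus 9 / 4 *)
  have -> : 9 * d%:R / 4 = \sum_(j < d) (9 / 4 : R).
    by rewrite sumr_const card_ord -[RHS]mulr_natr; field.
  rewrite /dotp -big_split/=; apply: ler_sum => j _.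
  have := two_mul_le_sqr (3 / 2) `|tnth v j| (ltr01 : 0 < (1 : R)).
  by rewrite mul1r divr1 real_normK ?num_real// -expr2; lra.
have hq := le_trans q (ler_wpM2l (exprn_ge0 2 N0) q3).
apply: le_trans (ler_wpM2l (mulr_ge0 (expR_ge0 _) (expR_ge0 _))
  (ler_wpM2l (ler0n R 2) hq)) _.
rewrite /C; have -> : 3 / 2 * dotp v v = 2^-1 * dotp v v + dotp v v by field.
rewrite expRD le_eqVlt; apply/orP; left; apply/eqP; ring.
Qed.

Let remainder z h (N : R) : 0 <= N -> N <= 1 -> (forall j, normc (h 0 j) <= N) ->
  normc (f (z + h) - f z - L z h) <=
  N ^+ 2 * (2 * (C z * \int[m]_v expR (3 / 2 * dotp v v))).
Proof.
move=> N0 N1 hN; have l0 : 0 < 3 / 2 :> R by [].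
have [S1 S2] := cintegral_sum (index_enum 'I_d)
  (fun j => cintegrableZl (h 0 j) (ipartial z j)).
have LE : L z h = cintegral m (fun v => cdotp v h * cexp (cdotp v z)).
  rewrite /L; under eq_bigr do rewrite -cintegralZl//.
  rewrite -S2; apply: eq_cintegral => v; rewrite /cdotp mulr_suml.
  by apply: eq_bigr => j _; rewrite /partial; ring.
have iL : cintegrable m (fun v => cdotp v h * cexp (cdotp v z)).
  move: S1; congr (cintegrable m _); apply/funext => v.
  rewrite /cdotp mulr_suml; apply: eq_bigr => j _.
  by rewrite /partial; ring.
have iN z' : cintegrable m (fun v => -1 * cexp (cdotp v z')) by exact: cintegrableZl.
have iNL : cintegrable m (fun v => -1 * (cdotp v h * cexp (cdotp v z))).
  exact: cintegrableZl.
have E : f (z + h) - f z - L z h = cintegral m (fun v => cexp (cdotp v (z + h)) -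
    cexp (cdotp v z) - cdotp v h * cexp (cdotp v z)).
  rewrite LE /f; transitivity (cintegral m (fun v => cexp (cdotp v (z + h))) +
    -1 * cintegral m (fun v => cexp (cdotp v z)) +
    -1 * cintegral m (fun v => cdotp v h * cexp (cdotp v z))); first by rewrite !mulN1r.
  rewrite -cintegralZl// -cintegralZl// -cintegralD// -cintegralD//; last first.
    exact: cintegrableD.
  by apply: eq_cintegral => v; rewrite !mulN1r.
have iE : cintegrable m (fun v => cexp (cdotp v (z + h)) -
    cexp (cdotp v z) - cdotp v h * cexp (cdotp v z)).
  have := cintegrableD (cintegrableD (icexp (z + h)) (iN z)) iNL.
  by congr (cintegrable m _); apply/funext => v; rewrite !mulN1r.
rewrite E; have := normc_cintegral_le iE (quad_integrable (N ^+ 2 * C z) l0)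
  (fun v => kernel_remainder z v N0 N1 hN).
move=> h1; apply: le_trans h1 _.
have i1 : m.-integrable setT (EFin \o (fun v : d.-tuple R => expR (3 / 2 * dotp v v))).
  have := quad_integrable 1 l0.
  by congr (_.-integrable _ _); apply/funext => v /=; rewrite mul1r.
rewrite RintegralZl// le_eqVlt; apply/orP; left; apply/eqP; ring.
Qed.

Let norm_real (w : 'rV[R[i]]_d) : `|w| = (complex.Re `|w|)%:C%C.
Proof. by rewrite RRe_real// normr_real. Qed.

Let coord_le (w : 'rV[R[i]]_d) j : normc (w 0 j) <= complex.Re `|w|.
Proof.
rewrite -lecR -norm_real -[X in X <= _]/`|w 0 j|.
rewrite [leRHS]/Num.Def.normr/= mx_normE -[leLHS]nngE num_le.
exact: (le_bigmax _ (fun i : 'I_1 * 'I_d => `|w i.1 i.2|%:nng) (0, j)).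
Qed.

(** The derivative is the integral of the derivative of the kernel, with a
    remainder that is quadratic in the norm of the increment. *)
Lemma laplace_transform_differentiable :
  forall u, differentiable (f : 'rV[R[i]]_d -> R[i]^o) u.
Proof.
move=> z.
pose Lmixin := GRing.isLinear.Build K 'rV[K]_d K^o *:%R (L z) (L_linear z).
pose Lz : {linear 'rV[K]_d -> K^o} := HB.pack (L z : 'rV[K]_d -> K^o) Lmixin.
have Lo : (f : 'rV[K]_d -> K^o) \o shift z = cst (f z) + Lz +o_ 0 id.
  apply/eqaddoP => eps eps0.
  pose D := 2 * (C z * \int[m]_v expR (3 / 2 * dotp v v)).
  have D0 : 0 <= D.
    rewrite !mulr_ge0 ?expR_ge0//; apply: Rintegral_ge0 => v _; exact: expR_ge0.
  have epsE : eps = (complex.Re eps)%:C%C by rewrite RRe_real// gtr0_real.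
  have er0 : 0 < complex.Re eps by rewrite -ltcR -epsE.
  pose dl := Num.min 1 (complex.Re eps / (D + 1)).
  have dl0 : 0 < dl by rewrite lt_min ltr01 divr_gt0// ltr_wpDl.
  have dlc : (0 : K) < dl%:C%C by rewrite ltcR.
  near=> h.
  have hdl : complex.Re `|h| < dl.
    rewrite -ltcR -norm_real; near: h.
    have := @nbhs0_lt K 'rV[K]_d _ dlc.
    exact.
  have N0 : 0 <= complex.Re `|h| by rewrite -ler0c -norm_real normr_ge0.
  have N1 : complex.Re `|h| <= 1 by move: hdl; rewrite lt_min => /andP[/ltW].
  have := remainder z N0 N1 (coord_le h); rewrite -/D => hr.
  have -> : ((f \o shift z : 'rV[K]_d -> K^o) - (cst (f z) + Lz)) h =
      f (z + h) - f z - L z h.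
    transitivity (f (h + z) - (f z + L z h)); first by [].
    by rewrite opprD addrA (addrC h).
  rewrite [`|id h|]norm_real epsE -rmorphM /= lecR.
  apply: le_trans hr _; rewrite expr2 -mulrA mulrC ler_wpM2r//.
  move: hdl; rewrite lt_min => /andP[_ /ltW h2].
  apply: le_trans (ler_wpM2r D0 h2) _.
  rewrite mulrAC ler_pdivrMr ?ltr_wpDl// ler_wpM2l ?(ltW er0)//.
  by rewrite lerDl.
have dE := diff_unique (@L_continuous z : continuous Lz) Lo.
by apply/diff_locallyP; rewrite dE; split; [exact: L_continuous|exact: Lo].
Unshelve. all: by end_near. Qed.

(** The bound on the kernel has the exponential of half the square of the real part
    of [z] as a factor. *)
Lemma laplace_transform_analytic : analytic_order2 f.
Proof.
split; first exact: laplace_transform_differentiable.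
have l0 : 0 < 2^-1 :> R by rewrite invr_gt0.
pose I := \int[m]_v expR (2^-1 * dotp v v).
have I0 : 0 <= I by apply: Rintegral_ge0 => v _; exact: expR_ge0.
exists (2 * I + 1), 1; split => //; first by rewrite ltr_wpDl// mulr_ge0.
move=> z; rewrite norm_normc lecR mul1r.
have := normc_cintegral_le (icexp z) (quad_integrable
  (expR (dotp (re_tuple z) (re_tuple z) / 2)) l0) (fun v => normc_cexp_cdotp_le v z).
have i1 : m.-integrable setT (EFin \o (fun v : d.-tuple R => expR (2^-1 * dotp v v))).
  have := quad_integrable 1 l0.
  by congr (_.-integrable _ _); apply/funext => v /=; rewrite mul1r.
rewrite RintegralZl// -/I mulrCA => h; apply: le_trans h _; rewrite mulrC.
apply: ler_pM; rewrite ?mulr_ge0 ?expR_ge0 ?lerDl// ler_expR.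
have rz : dotp (re_tuple z) (re_tuple z) <= cnormsq z.
  apply: ler_sum => i _; rewrite tnth_mktuple -expr2 lerDl sqr_ge0//.
by have := dotp_ge0 (re_tuple z); lra.
Qed.

End differentiability.

(** * The theorem *)

Section dominated_complex_families.
Variables (R : realType) (d : nat).
Local Notation normc := (@Normc.normc R).

Lemma abs_sums_to_gap (u : d.-tuple nat -> R[i]) (s : R[i]) (C : R) : 0 <= C ->
    (forall a, normc (u a) <= C * mwt R a) ->
    (forall H, uniq H -> normc (s - \sum_(a <- H) u a) <= C * gap R H) ->
  abs_sums_to u s.
Proof.
move=> C0 uC sC; split.
  by apply: (esum_mwt_lty C0) => a; rewrite !lee_fin normc_ge0 uC.
move=> e be; apply/cvgrPdist_lt => /= eps eps0.
have epsE : eps = (complex.Re eps)%:C%C by rewrite RRe_real// gtr0_real.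
have er0 : 0 < complex.Re eps by rewrite -ltcR -epsE.
have cg : C * gap R (prefix_seq e n) @[n --> \oo] --> 0.
  rewrite -[X in _ --> X](mulr0 C); apply: cvgM; first exact: cvg_cst.
  exact: gap_prefix_cvg.
have [N _ gN] := (cvgr0Pnorm_lt _).1 cg _ er0.
exists N => // n Nn; have gn := gN n Nn.
have := sC _ (uniq_prefix n (bij_inj be)); rewrite -sum_prefix => sn.
rewrite epsE [`|_|]norm_normc ltcR.
exact: le_lt_trans sn (le_lt_trans (ler_norm _) gn).
Qed.

End dominated_complex_families.

Theorem theorem5p1 (R : realType) (d : nat) (d_gt0 : (0 < d)%N)
    (dO : measure_display) (Omega : measurableType dO)
    (P : probability Omega R) (P_complete : measure_is_complete P)
    (X : R -> Omega -> d.-tuple R) (X_brownian : brownian_motion P X)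
    (g : R -> d.-tuple R -> R)
    (g_martingale :
      martingale P (augmented_filtration P X) (fun t w => g t (X t w)))
    (g_continuous : continuous_paths P (fun t w => g t (X t w)))
    (g_L1_bounded : L1_bounded P (fun t w => g t (X t w)))
    (mu : {charge set (d.-tuple R) -> \bar R})
    (g_widder : widder_representation P X g mu) :
  (quad_exp_moments mu ->
   exists b : d.-tuple nat -> R,
     (forall t, 0 <= t -> forall p, 1 <= p ->
        Lp_abs_cvg P p (fun a w => b a * mhermite a t (X t w))
          (fun w => g t (X t w))) /\
     (forall a, charge_integrable mu (fun v => mpow v a) /\
        b a = (mfact a)%:R^-1 * charge_integral mu (fun v => mpow v a)))
  /\
  ((forall A, measurable A -> (0 <= mu A)%E) ->
   forall b : d.-tuple nat -> R,
   (forall t, 0 <= t -> exists e : nat -> d.-tuple nat, bijective e /\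
      Lp_series_cvg P 1 (fun a w => b a * mhermite a t (X t w)) e
        (fun w => g t (X t w))) ->
   let f (z : 'rV[R[i]]_d) := charge_cintegral mu (fun v => cexp (cdotp v z)) in
   let h (t : R) (z : 'rV[R[i]]_d) (w : Omega) :=
     (g t (X t w))%:C%C *
     cexp ((t^-1)%:C%C * (cdotp (X t w) z - csqr z / 2)) in
   [/\ quad_exp_moments mu,
       forall z, charge_cintegrable mu (fun v => cexp (cdotp v z)),
       analytic_order2 f,
       forall z, abs_sums_to (fun a => (b a)%:C%C * cmpow z a) (f z) &
       forall z (t : R), 0 < t ->
         cintegrable P (h t z) /\ f z = cintegral P (h t z)]).
Proof.
have mg t : 0 <= t -> measurable_fun setT (fun w => g t (X t w)).
  move=> t0; apply/measurable_EFinP.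
  exact: measurable_int (mart_integrable g_martingale t0).
split; first exact: (hermite_expansion_of_quadratic_moments X_brownian mg).
move=> mu0 b bg f h.
have fE : f = fun z =>
    cintegral (jordan_pos (hahn_pos_neg mu)) (fun v => cexp (cdotp v z)).
  by apply/funext => z; rewrite /f charge_cintegral_positive.
have quad := integrable_quad_pos X_brownian mg bg g_widder mu0.
split.
- exact: quad_exp_moments_positive X_brownian mg bg g_widder mu0.
- move=> z; apply/(charge_cintegrable_positive mu0).
  exact: cintegrable_cexp_cdotp.
- by rewrite fE; exact: laplace_transform_analytic.
- move=> z; rewrite fE.
  have [C C0 [bC sC]] :=
    transform_power_series X_brownian mg bg g_widder mu0 ltr01 z.
  exact: (abs_sums_to_gap C0).
- move=> z t t0; rewrite fE; split.
    exact: (transform_integrable X_brownian mg bg t0 z).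
  exact: (transform_expectation X_brownian mg bg g_widder mu0 t0 z).
Qed.
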